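(* Let $(G,E,\varphi)$ be a self-similar group which is pseudo-free and exhausting. Let $\theta$ be the partial action of $U(\mathcal{S}_{G,E})$ on $\Sigma_E$ induced by the Quigg–Raeburn partial action of the free group $\mathbb{F}_{E^1}$ on $\Sigma_E$ via the homomorphism $\phi:\mathbb{F}_{E^1}\to U(\mathcal{S}_{G,E})$, $\phi(e)=\sigma((e,1,\varnothing))$ (in particular, this induced action is defined). Then the partial crossed product $C(\Sigma_E)\rtimes_\theta U(\mathcal{S}_{G,E})$ is isomorphic to the Cuntz algebra $\mathcal{O}_{|E^1|}$, and the elements $g\in U(\mathcal{S}_{G,E})$ whose corresponding ideal in $C(\Sigma_E)$ is not $0$ generate $U(\mathcal{S}_{G,E})$.
   Context: **Self-similar groups.** A self-similar group $(G,E,\varphi)$ is a self-similar graph action in which the graph has one vertex. Concretely: $E$ is a finite directed graph with a single vertex $\varnothing$ and nonempty finite edge set $E^1$, so the set $E^*$ of finite paths is the free monoid on $E^1$ with identity the empty word $\varnothing$; $G$ is a countable discrete group acting on the set $E^1$ (and fixing $\varnothing$); and $\varphi:G\times E^1\to G$ satisfies $\varphi(gh,e)=\varphi(g,he)\varphi(h,e)$. The action and $\varphi$ extend to $E^*$ (length-preservingly) by $g\varnothing=\varnothing$, $\varphi(g,\varnothing)=g$, $g(\alpha\beta)=(g\alpha)(\varphi(g,\alpha)\beta)$, $\varphi(g,\alpha\beta)=\varphi(\varphi(g,\alpha),\beta)$. $\Sigma_E$ is the space of right-infinite words in $E^1$ with the product topology, and $\alpha\Sigma_E=\{\alpha x :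 x\in\Sigma_E\}$ for $\alpha\in E^*$. **Pseudo-free / exhausting.** $(G,E,\varphi)$ is pseudo-free if $ge=e$ and $\varphi(g,e)=1$ with $g\in G$, $e\in E^1$ imply $g=1$. It is exhausting if for all $g\in G$ there exists $\alpha\in E^*$ with $\varphi(g,\alpha)=1$. **The inverse semigroup and its universal group.** $\mathcal{S}_{G,E}=(E^*\times G\times E^* )\cup\{0\}$, with zero element $0$, involution $(\alpha,g,\beta)^*=(\beta,g^{-1},\alpha)$, and product $$(\alpha,g,\beta)(\gamma,h,\nu)=\begin{cases}(\alpha\, g\gamma',\ \varphi(g,\gamma')h,\ \nu) & \text{if }\gamma=\beta\gamma',\\ (\alpha,\ g\,\varphi(h^{-1},\beta')^{-1},\ \nu\, h^{-1}\beta') & \text{if }\beta=\gamma\beta',\\ 0 & \text{otherwise.}\end{cases}$$ The universal group $U(\mathcal{S}_{G,E})$ is the group generated by the set $\mathcal{S}_{G,E}\setminus\{0\}$ subject to the relations $s\cdot t=st$ whenever $st\neq0$; $\sigma:\mathcal{S}_{G,E}\setminus\{0\}\to U(\mathcal{S}_{G,E})$ is the natural map. **Partial actions.** A partial action of a group $H$ on a set $X$ is a family of subsets $D_h\subset X$ and bijections $\theta_h:D_{h^{-1}}\to D_h$ with $D_1=X$, $\theta_1=\mathrm{id}$ and $\theta_{gh}$ extending $\theta_g\circ\theta_h$ (the latter on its largest possible domain). If $X$ is a topological space we require $D_h$ open and $\theta_h$ a homeomorphism. **Quigg–Raeburn action.** The partial action of the free group $\mathbb{F}_{E^1}$ on $\Sigma_E$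 with $D_g=\emptyset$ if $g$ is not of the form $\alpha\beta^{-1}$ with $\alpha,\beta\in E^*$, and, when $g=\alpha\beta^{-1}$ in reduced form with $\alpha,\beta\in E^*$, $D_{g}=\alpha\Sigma_E$ and $\theta_{g}:\beta\Sigma_E\to\alpha\Sigma_E$, $\theta_{g}(\beta x)=\alpha x$. **Induced partial action.** Given a partial action $(\{D_g\},\{\theta_g\})$ of $F$ on $X$ and a surjective homomorphism $\phi:F\to H$ such that $\theta_{g_1}(x)=\theta_{g_2}(x)$ whenever $\phi(g_1)=\phi(g_2)$ and $x\in D_{g_1^{-1}}\cap D_{g_2^{-1}}$, the induced partial action of $H$ on $X$ is given by $E_h=\bigcup_{g\in\phi^{-1}(h)}D_g$ and $\theta_h:E_{h^{-1}}\to E_h$, $\theta_h(x)=\theta_g(x)$ for any $g\in\phi^{-1}(h)$ with $x\in D_{g^{-1}}$. **Partial crossed product.** For a partial action of a discrete group $H$ on a compact Hausdorff space $X$ with open sets $E_h$ and homeomorphisms $\theta_h$, the ideal corresponding to $h$ is $C_0(E_h)$ (functions in $C(X)$ vanishing outside $E_h$), with $*$-isomorphisms $\widetilde\theta_h:C_0(E_{h^{-1}})\to C_0(E_h)$, $\widetilde\theta_h(f)(x)=f(\theta_h^{-1}(x))$. The partial crossed product $C(X)\rtimes_\theta H$ is the (full, i.e. enveloping) C*-completion of the $*$-algebra of finite formal sums $\sum_h a_h\delta_h$, $a_h\in C_0(E_h)$, with $(a\delta_g)(b\delta_h)=\widetilde\theta_g(\widetilde\theta_{g^{-1}}(a)b)\delta_{gh}$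 and $(a\delta_g)^*=\widetilde\theta_{g^{-1}}(a^* )\delta_{g^{-1}}$. **Cuntz algebra.** For $n\ge 2$, $\mathcal{O}_n$ is the universal unital C*-algebra generated by isometries $s_1,\dots,s_n$ with $\sum_i s_is_i^*=1$; the same presentation with $n=1$ gives $\mathcal{O}_1=C(\mathbb{T})$. *)

(* Defs.v *)
From HB Require Import structures.
From mathcomp Require Import all_boot all_order all_algebra.
From mathcomp Require Import complex.
From mathcomp Require Import all_classical all_reals all_analysis.

Set Implicit Arguments.
Unset Strict Implicit.
Unset Printing Implicit Defensive.

Import Order.TTheory GRing.Theory Num.Theory.
Import numFieldNormedType.Exports.

Local Open Scope classical_set_scope.
Local Open Scope ring_scope.

(* In a presentation, a word is a sequence of letters                         *)
(* (x, true), standing for x, and (x, false), standing for x^-1; a relation   *)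
(* is a pair of words.                                                        *)

Section Presentation.
Variables (X : choiceType) (rel : seq (X * bool) -> seq (X * bool) -> Prop).
Local Notation word := (seq (X * bool)).

Inductive pres_congr : word -> word -> Prop :=
| pres_refl u : pres_congr u u
| pres_sym u v : pres_congr u v -> pres_congr v u
| pres_trans u v w : pres_congr u v -> pres_congr v w -> pres_congr u w
| pres_cancel u v x b :
    pres_congr (u ++ (x, b) :: (x, ~~ b) :: v) (u ++ v)
| pres_rel u v r s : rel r s -> pres_congr (u ++ r ++ v) (u ++ s ++ v).

Definition pres_eqb (u v : word) : bool := `[< pres_congr u v >].

Lemma pres_eqb_refl : reflexive pres_eqb.
Proof. by move=> u; apply/asboolP; exact: pres_refl. Qed.

Lemma pres_eqb_sym : symmetric pres_eqb.
Proof.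
by move=> u v; apply/idP/idP => /asboolP uv; apply/asboolP; exact: pres_sym.
Qed.

Lemma pres_eqb_trans : transitive pres_eqb.
Proof.
move=> v u w /asboolP uv /asboolP vw; apply/asboolP; exact: pres_trans uv vw.
Qed.

Canonical pres_equiv :=
  EquivRel pres_eqb pres_eqb_refl pres_eqb_sym pres_eqb_trans.

Definition presented := {eq_quot pres_equiv}%qT.
HB.instance Definition _ := Choice.on presented.

Definition pres_class (u : word) : presented := (\pi_{eq_quot pres_equiv} u)%qT.

Definition inv_word (u : word) : word := rev [seq (l.1, ~~ l.2) | l <- u].

Definition pres_one : presented := pres_class [::].
Definition pres_mul (a b : presented) : presented :=
  pres_class (repr a ++ repr b)%qT.
Definition pres_inv (a : presented) : presented :=
  pres_class (inv_word (repr a)%qT).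

Lemma pres_classP u v : pres_class u = pres_class v <-> pres_congr u v.
Proof.
split=> [e|uv].
  by apply/asboolP; move/eqmodP: e.
by apply/eqmodP; apply/asboolP.
Qed.

Lemma pres_repr a : pres_class (repr a)%qT = a.
Proof. exact: reprK. Qed.

Lemma pres_congr_ctx p q u v :
  pres_congr u v -> pres_congr (p ++ u ++ q) (p ++ v ++ q).
Proof.
elim=> {u v} [u|u v _|u v w _ uv _|u v x b|u v r s rs].
- exact: pres_refl.
- exact: pres_sym.
- exact: pres_trans.
- by have := pres_cancel (p ++ u) (v ++ q) x b; rewrite -!catA.
- by have := pres_rel (p ++ u) (v ++ q) rs; rewrite -!catA.
Qed.

Lemma pres_congr_cat u u' v v' :
  pres_congr u u' -> pres_congr v v' -> pres_congr (u ++ v) (u' ++ v').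
Proof.
move=> uu' vv'; apply: (@pres_trans _ (u' ++ v)).
  exact: (pres_congr_ctx [::] v uu').
by have := pres_congr_ctx u' [::] vv'; rewrite !cats0.
Qed.

Lemma pres_repr_class u : pres_congr (repr (pres_class u))%qT u.
Proof. by apply/pres_classP; rewrite pres_repr. Qed.

Lemma pres_classM u v :
  pres_mul (pres_class u) (pres_class v) = pres_class (u ++ v).
Proof.
by apply/pres_classP; apply: pres_congr_cat; exact: pres_repr_class.
Qed.

Lemma inv_wordV u : pres_congr (inv_word u ++ u) [::].
Proof.
elim: u => [|[x b] u ih]; first exact: pres_refl.
rewrite /inv_word /= rev_cons -cats1 -catA /=.
apply: pres_trans ih.
have := pres_cancel (inv_word u) u x (~~ b); rewrite negbK; exact.
Qed.

Lemma inv_wordK : involutive inv_word.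
Proof.
move=> u; rewrite /inv_word map_rev revK -map_comp -[RHS]map_id.
by apply: eq_map => -[x b] /=; rewrite negbK.
Qed.

Lemma pres_mulA : associative pres_mul.
Proof.
move=> a b c; rewrite -(pres_repr a) -(pres_repr b) -(pres_repr c).
by rewrite !pres_classM catA.
Qed.

Lemma pres_mul1 : left_id pres_one pres_mul.
Proof. by move=> a; rewrite -(pres_repr a) /pres_one pres_classM. Qed.

Lemma pres_mulr1 : right_id pres_one pres_mul.
Proof. by move=> a; rewrite -(pres_repr a) /pres_one pres_classM cats0. Qed.

Lemma pres_mulV : left_inverse pres_one pres_inv pres_mul.
Proof.
move=> a; rewrite -[X in pres_mul _ X](pres_repr a) /pres_inv pres_classM.
by apply/pres_classP; exact: inv_wordV.
Qed.

Lemma pres_mulrV : right_inverse pres_one pres_inv pres_mul.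
Proof.
move=> a; rewrite -[X in pres_mul X _](pres_repr a) /pres_inv pres_classM.
apply/pres_classP; set u := repr a.
by have := inv_wordV (inv_word u); rewrite inv_wordK.
Qed.

HB.instance Definition _ := isGroup.Build presented
  pres_mulA pres_mul1 pres_mulr1 pres_mulV pres_mulrV.

Definition pres_gen (x : X) : presented := pres_class [:: (x, true)].

End Presentation.

Definition free_group (X : choiceType) : groupType :=
  presented (fun _ _ : seq (X * bool) => False).

Section FreeGroup.
Variable X : choiceType.

Definition free_gen (x : X) : free_group X := pres_gen _ x.

Definition free_word (alpha : seq X) : free_group X :=
  (\prod_(x <- alpha) free_gen x)%g.

Variables (H : groupType) (f : X -> H).

Definition eval_word (u : seq (X * bool)) : H :=
  (\prod_(l <- u) if l.2 then f l.1 else (f l.1)^-1)%g.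

Definition free_lift (g : free_group X) : H := eval_word (repr g)%qT.

Lemma eval_word_congr u v :
  pres_congr (fun _ _ => False) u v -> eval_word u = eval_word v.
Proof.
elim=> {u v} // [u v w _ -> _ -> //|u v x b].
rewrite /eval_word !big_cat !big_cons /=; congr (_ * _)%g.
by case: b => /=; rewrite mulgA ?mulgV ?mulVg mul1g.
Qed.

Lemma free_lift_class u : free_lift (pres_class _ u) = eval_word u.
Proof. by apply: eval_word_congr; exact: pres_repr_class. Qed.

Lemma free_lift_gen x : free_lift (free_gen x) = f x.
Proof. by rewrite free_lift_class /eval_word big_seq1. Qed.

Lemma free_liftM : {morph free_lift : g h / (g * h)%g}.
Proof.
move=> g h; rewrite -(pres_repr g) -(pres_repr h) [(_ * _)%g]pres_classM.
by rewrite !free_lift_class /eval_word big_cat.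
Qed.

End FreeGroup.

(* The map theta_h is represented by a total function, whose values outside   *)
(* D_{h^-1} are irrelevant.                                                   *)
Record partial_action_data (H : groupType) (X : Type) := PartialActionData {
  pa_dom : H -> set X;
  pa_map : H -> X -> X
}.

(* The inverse of theta_h : D_{h^-1} -> D_h is theta_{h^-1} (by the last      *)
(* clause of is_partial_action), so the continuity of all the theta_h makes   *)
(* them homeomorphisms.                                                       *)
Definition is_partial_action (H : groupType) (X : Type)
    (p : partial_action_data H X) : Prop :=
  [/\ pa_dom p 1%g = setT,
      forall x, pa_map p 1%g x = x,
      forall h, set_bij (pa_dom p h^-1%g) (pa_dom p h) (pa_map p h) &
      forall g h x, pa_dom p h^-1%g x -> pa_dom p g^-1%g (pa_map p h x) ->
        pa_dom p (g * h)^-1%g x /\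
        pa_map p (g * h)%g x = pa_map p g (pa_map p h x)].

Definition is_topological_partial_action (H : groupType) (X : topologicalType)
    (p : partial_action_data H X) : Prop :=
  [/\ is_partial_action p,
      forall h, open (pa_dom p h) &
      forall h, {within pa_dom p h^-1%g, continuous (pa_map p h)}].

Section InducedPartialAction.
Variables (F H : groupType) (X : Type).
Variables (p : partial_action_data F X) (phi : F -> H).

Definition inducible : Prop :=
  [/\ {morph phi : g h / (g * h)%g},
      forall h, exists g, phi g = h &
      forall g1 g2 x, phi g1 = phi g2 ->
        pa_dom p g1^-1%g x -> pa_dom p g2^-1%g x ->
        pa_map p g1 x = pa_map p g2 x].

Definition induced_partial_action : partial_action_data H X := {|
  pa_dom h := \bigcup_(g in [set g | phi g = h]) pa_dom p g;
  pa_map h x :=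
    pa_map p (xget 1%g [set g | phi g = h /\ pa_dom p g^-1%g x]) x
|}.

End InducedPartialAction.

Section InfiniteWords.
Variable E : finType.

Definition infinite_words : Type :=
  prod_topology (fun _ : nat => discrete_topology E).
HB.instance Definition _ := Topological.on infinite_words.

Definition prepend (alpha : seq E) (x : infinite_words) : infinite_words :=
  fun n => nth (x (n - size alpha)%N) alpha n.

Definition cylinder (alpha : seq E) : set infinite_words := range (prepend alpha).

(* alpha beta^-1 is reduced as a word in the free group                       *)
Definition reduced_pair (alpha beta : seq E) : Prop :=
  forall alpha' beta' e, ~ (alpha = rcons alpha' e /\ beta = rcons beta' e).

Definition reduced_form (g : free_group E) (alpha beta : seq E) : Prop :=
  reduced_pair alpha beta /\ g = (free_word alpha * (free_word beta)^-1)%g.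

Definition quigg_raeburn : partial_action_data (free_group E) infinite_words := {|
  pa_dom g := [set x | exists alpha beta,
                 reduced_form g alpha beta /\ cylinder alpha x];
  pa_map g x := xget x [set y | exists alpha beta z,
                  [/\ reduced_form g alpha beta, x = prepend beta z &
                      y = prepend alpha z]]
|}.

End InfiniteWords.

Record self_similar_group (G : groupType) (E : Type) := SelfSimilarGroup {
  ss_act : G -> E -> E;
  ss_coc : G -> E -> G;
  ss_act1 : forall e, ss_act 1%g e = e;
  ss_actM : forall g h e, ss_act (g * h)%g e = ss_act g (ss_act h e);
  ss_cocM : forall g h e,
    ss_coc (g * h)%g e = (ss_coc g (ss_act h e) * ss_coc h e)%g
}.

Section SelfSimilarGroup.
Variables (G : groupType) (E : choiceType) (S : self_similar_group G E).

Fixpoint act_word (g : G) (alpha : seq E) : seq E :=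
  if alpha is e :: alpha' then ss_act S g e :: act_word (ss_coc S g e) alpha'
  else [::].

Fixpoint coc_word (g : G) (alpha : seq E) : G :=
  if alpha is e :: alpha' then coc_word (ss_coc S g e) alpha' else g.

Definition pseudo_free : Prop :=
  forall g e, ss_act S g e = e -> ss_coc S g e = 1%g -> g = 1%g.

Definition exhausting : Prop := forall g, exists alpha, coc_word g alpha = 1%g.

Definition ss_triple : Type := (seq E * G * seq E)%type.
HB.instance Definition _ := Choice.on ss_triple.

(* The inverse semigroup, None being its zero element.                        *)
Definition ss_semigroup : Type := option ss_triple.

Definition triple_mul (s t : ss_triple) : ss_semigroup :=
  let: (alpha, g, beta) := s in
  let: (gamma, h, nu) := t in
  if prefix beta gamma then
    let gamma' := drop (size beta) gamma in
    Some (alpha ++ act_word g gamma', (coc_word g gamma' * h)%g, nu)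
  else if prefix gamma beta then
    let beta' := drop (size gamma) beta in
    Some (alpha, (g * (coc_word h^-1 beta')^-1)%g, nu ++ act_word h^-1%g beta')
  else None.

Definition ss_mul (s t : ss_semigroup) : ss_semigroup :=
  match s, t with
  | Some s', Some t' => triple_mul s' t'
  | _, _ => None
  end.

Definition universal_rel (r w : seq (ss_triple * bool)) : Prop :=
  exists s t st : ss_triple, ss_mul (Some s) (Some t) = Some st /\
    r = [:: (s, true); (t, true)] /\ w = [:: (st, true)].

Definition universal_group : groupType := presented universal_rel.

Definition sigma (s : ss_triple) : universal_group := pres_gen _ s.

Definition phi_universal : free_group E -> universal_group :=
  free_lift (fun e => sigma ([:: e], 1%g, [::])).

End SelfSimilarGroup.

Definition theta_universal (G : groupType) (E : finType)
    (S : self_similar_group G E) :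
    partial_action_data (universal_group S) (infinite_words E) :=
  induced_partial_action (quigg_raeburn E) (phi_universal S).

Definition is_subgroup (H : groupType) (K : set H) : Prop :=
  [/\ K 1%g, forall g h, K g -> K h -> K (g * h)%g & forall g, K g -> K g^-1%g].

Definition generates (H : groupType) (A : set H) : Prop :=
  forall K, is_subgroup K -> A `<=` K -> K = setT.

Definition cplx (R : realType) : numClosedFieldType := R[i].

HB.mixin Record isCStarAlgebra (R : realType) A
    of CompleteNormedModule (cplx R) A := {
  cs_mul : A -> A -> A;
  cs_star : A -> A;
  cs_mulA : associative cs_mul;
  cs_mulDl : left_distributive cs_mul +%R;
  cs_mulDr : right_distributive cs_mul +%R;
  cs_scaleAl : forall (c : cplx R) a b, c *: cs_mul a b = cs_mul (c *: a) b;
  cs_scaleAr : forall (c : cplx R) a b, c *: cs_mul a b = cs_mul a (c *: b);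
  cs_starK : involutive cs_star;
  cs_starD : {morph cs_star : a b / a + b};
  cs_starZ : forall (c : cplx R) a, cs_star (c *: a) = c^* *: cs_star a;
  cs_starM : forall a b, cs_star (cs_mul a b) = cs_mul (cs_star b) (cs_star a);
  cs_normM : forall a b, `|cs_mul a b| <= `|a| * `|b| :> cplx R;
  cs_normC : forall a, `|cs_mul (cs_star a) a| = `|a| ^+ 2 :> cplx R
}.

(* C*-algebras are not assumed to be unital.                                  *)
#[short(type="cstarType")]
HB.structure Definition CStarAlgebra (R : realType) :=
  {A of isCStarAlgebra R A & CompleteNormedModule (cplx R) A}.

Section CStarMorphisms.
Variable R : realType.

(* Continuity is automatic for *-homomorphisms between C*-algebras.           *)
Definition star_hom (A B : cstarType R) (f : A -> B) : Prop :=
  [/\ forall (c : cplx R) a b, f (c *: a + b) = c *: f a + f b,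
      forall a b, f (cs_mul a b) = cs_mul (f a) (f b),
      forall a, f (cs_star a) = cs_star (f a) &
      continuous f].

Definition cstar_isomorphic (A B : cstarType R) : Prop :=
  exists2 f : A -> B, star_hom f & bijective f.

Definition is_unit (A : cstarType R) (u : A) : Prop :=
  forall a, cs_mul u a = a /\ cs_mul a u = a.

Definition cuntz_family (A : cstarType R) (u : A) (n : nat) (s : 'I_n -> A) : Prop :=
  [/\ is_unit u,
      forall i, cs_mul (cs_star (s i)) (s i) = u &
      \sum_(i < n) cs_mul (s i) (cs_star (s i)) = u].

Definition is_cuntz_algebra (n : nat) (A : cstarType R) : Prop :=
  exists (u : A) (s : 'I_n -> A), cuntz_family u s /\
    forall (B : cstarType R) (v : B) (t : 'I_n -> B), cuntz_family v t ->
      exists! f : A -> B,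
        [/\ star_hom f, f u = v & forall i, f (s i) = t i].

End CStarMorphisms.

Section CrossedProduct.
Variables (R : realType) (H : groupType) (X : topologicalType).
Variable p : partial_action_data H X.
Local Notation C := (cplx R).

Definition C0 (D : set X) : set (X -> C) :=
  [set f | continuous f /\ forall x, ~ D x -> f x = 0].

Definition theta_tilde (h : H) (f : X -> C) : X -> C :=
  fun x => if `[< pa_dom p h x >] then f (pa_map p h^-1%g x) else 0.

(* The formal sum \sum_h a_h delta_h is represented by the family (a_h)_h.    *)
Definition formal_sums : set (H -> X -> C) :=
  [set a | (forall h, C0 (pa_dom p h) (a h)) /\
           finite_set [set h | a h <> (fun=> 0)]].

Definition fs_add (a b : H -> X -> C) : H -> X -> C :=
  fun h x => a h x + b h x.

Definition fs_scale (c : C) (a : H -> X -> C) : H -> X -> C :=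
  fun h x => c * a h x.

(* The coefficient at k of a product collects the terms                       *)
(* (a_g delta_g)(b_h delta_h) with g h = k, that is h = g^-1 k.               *)
Definition fs_mul (a b : H -> X -> C) : H -> X -> C :=
  fun k x => \sum_(g \in [set: H])
    theta_tilde g (fun y => theta_tilde g^-1%g (a g) y * b (g^-1 * k)%g y) x.

(* (a_g delta_g)^* contributes to the coefficient at g^-1 only.               *)
Definition fs_star (a : H -> X -> C) : H -> X -> C :=
  fun h => theta_tilde h (fun x => (a h^-1%g x)^*).

Definition formal_sums_hom (B : cstarType R) (rho : (H -> X -> C) -> B) : Prop :=
  [/\ forall c a b, formal_sums a -> formal_sums b ->
        rho (fs_add (fs_scale c a) b) = c *: rho a + rho b,
      forall a b, formal_sums a -> formal_sums b ->
        rho (fs_mul a b) = cs_mul (rho a) (rho b) &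
      forall a, formal_sums a -> rho (fs_star a) = cs_star (rho a)].

(* A is the enveloping C*-algebra of the *-algebra of formal sums.            *)
Definition is_partial_crossed_product (A : cstarType R) : Prop :=
  exists iota : (H -> X -> C) -> A, formal_sums_hom iota /\
    forall (B : cstarType R) (rho : (H -> X -> C) -> B), formal_sums_hom rho ->
      exists! f : A -> B,
        star_hom f /\ forall a, formal_sums a -> f (iota a) = rho a.

End CrossedProduct.

Arguments C0 R {X} D _.

(* Main.v *)
Require Import Defs.
From HB Require Import structures.
From mathcomp Require Import finmap.
From mathcomp Require Import all_boot all_order all_algebra.
From mathcomp Require Import complex.
From mathcomp Require Import ring lra.
From mathcomp Require Import all_classical all_reals all_analysis.

(* Pseudo-freeness makes the letters of E act, compatibly with G, by          *)
(* permutations of a set that contains the Zappa-Szep product of E^* and G    *)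
(* (an HNN argument), so phi is injective on E^*; exhaustion makes phi        *)
(* surjective. Hence theta is the action by exchange of prefixes:             *)
(* h = phi(al) phi(be)^-1 maps be z to al z.                                  *)
(* The Cuntz algebra is constructed as the separated completion of the        *)
(* *-algebra of terms in a projection u and isometries s_e for the supremum   *)
(* of the seminorms coming from all families in all C*-algebras, where u need *)
(* only be a unit for the s_e. A function f vanishing off the domain of h is  *)
(* a uniform limit of combinations of indicators of cylinders al with         *)
(* h = phi(al) phi(be)^-1, and f delta_h is sent to the limit of the          *)
(* corresponding combinations of s_al s_be^*; this gives the crossed product  *)
(* relations. Conversely, a representation of the formal sums yields a family *)
(* (u, s_e), and it is determined by it on cylinders, hence everywhere,       *)
(* because a real function of modulus at most 1 is the real part of a unitary *)
(* and so has an image of bounded norm.                                       *)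

Set Implicit Arguments.
Unset Strict Implicit.
Unset Printing Implicit Defensive.

Import Order.TTheory GRing.Theory Num.Theory.
Import numFieldNormedType.Exports.

Local Open Scope classical_set_scope.
Local Open Scope ring_scope.

(** * Injectivity of phi on words *)

(** Two facts about phi drive the proof. It is onto, because exhaustion lets every [sigma S s] be
    rewritten as phi(al) phi(be)^-1 ([sigma_image], [phi_surj]). It is injective on words
    ([phi_universal_inj]): the universal group acts by permutations on a set containing the pairs
    (word, group element), each letter e acting by a bijection that prefixes e to words
    ([model_letters]), so phi(al) sends the empty word paired with 1 to al paired with 1.
    Pseudo-freeness makes the stabilizer actions free, and this allows the prefixing maps to be
    extended equivariantly to bijections ([letter_extension]).

    It follows that h and al determine be in h = phi(al) phi(be)^-1, that the Quigg-Raeburn maps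
    lying over one h agree where they overlap, and that theta_h replaces the prefix be by al
    ([theta_dom], [theta_map]). The analytic part only uses this description, for an arbitrary
    injective multiplicative map [w] from words to a group.

    Both C*-algebras are identified with one algebra [cuntz], universal for [corner_family]. Its
    projection u is not asked to be a unit of the target, since a representation of the formal sums
    may be degenerate. That [cuntz] has the universal property of the Cuntz algebra requires the
    ranges of Cuntz isometries to be orthogonal ([cuntz_orthogonal]).

    For the crossed product, f delta_h is sent to [op h f], with s_al s_be^* as the value at the
    indicator of the cylinder of al. On such indicators the convolution product and the product of
    operators obey the same prefix rule ([conv_cyl_fun], [op_conv_level]). The rest is uniform
    approximation: [op] is bounded by twice the supremum norm ([op_le]), and every admissible
    coefficient is a uniform limit of combinations of these indicators ([C0_level_closure]).
    Conversely a representation of the formal sums gives a corner family ([rho_gen_corner]); it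
    agrees with the induced morphism on cylinders, hence everywhere by the a priori bound
    [rho_bound]. Uniqueness of universal objects gives the isomorphism. Finally the ideal at phi(e)
    contains the indicator of the cylinder of e, and the elements phi(e) generate because phi is
    onto. *)

Section SelfSimilarWords.
Variables (G : groupType) (E : choiceType) (S : self_similar_group G E).
Local Open Scope group_scope.

Lemma ss_coc1 e : ss_coc S 1 e = 1.
Proof.
have := ss_cocM S 1 1 e; rewrite mulg1 ss_act1 => h.
by apply: (mulgI (ss_coc S 1 e)); rewrite -h mulg1.
Qed.

Lemma act_word1 al : act_word S 1 al = al.
Proof. by elim: al => //= e al ih; rewrite ss_act1 ss_coc1 ih. Qed.

Lemma coc_word1 al : coc_word S 1 al = 1.
Proof. by elim: al => //= e al ih; rewrite ss_coc1. Qed.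

Lemma act_wordM g h al : act_word S (g * h) al = act_word S g (act_word S h al).
Proof. by elim: al g h => //= e al ih g h; rewrite ss_actM ss_cocM ih. Qed.

Lemma coc_wordM g h al :
  coc_word S (g * h) al = coc_word S g (act_word S h al) * coc_word S h al.
Proof. by elim: al g h => //= e al ih g h; rewrite ss_cocM ih. Qed.

Lemma pseudo_free_word : pseudo_free S ->
  forall g al, act_word S g al = al -> coc_word S g al = 1 -> g = 1.
Proof.
move=> pf g al; elim: al g => //= e al ih g [ge gal] c1.
by apply: (pf g e ge); exact: ih gal c1.
Qed.

End SelfSimilarWords.

(* Two free actions with the same (countably infinite) number of orbits are   *)
(* isomorphic.                                                                *)
Section FreeActions.
Variables (G : groupType) (K : set G).
Hypotheses (K1 : K 1%g) (KM : forall g h, K g -> K h -> K (g * h)%g)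
  (KV : forall g, K g -> K g^-1%g).
Local Open Scope group_scope.

(** Multiplicativity is demanded on K only: in the application [a] is twisted by the cocycle at a
    letter, and that cocycle is a homomorphism on the stabilizer of the letter. *)
Definition free_invariant (P : choiceType) (a : G -> P ->
  P) (A : set P) : Prop :=
  [/\ forall x, a 1 x = x,
      forall g h x, K g -> K h -> a (g * h) x = a g (a h x),
      forall g x, K g -> A x -> A (a g x) &
      forall g x, K g -> A x -> a g x = x -> g = 1].

Definition orbit_of (P : choiceType) (a : G -> P -> P) (x : P) : set P :=
  [set y | exists2 k, K k & y = a k x].

Section Representatives.
Variables (P : choiceType) (a : G -> P -> P) (A : set P) (p0 : P).
Hypothesis Aa : free_invariant a A.

(** [xget] depends only on the set, so all points of an orbit receive the same representative. An
    orbit is nonempty, hence [p0] is never returned. *)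
Definition orbit_repr (x : P) : P := xget p0 (orbit_of a x).

Definition orbit_coord (x : P) : G :=
  xget 1 [set k | K k /\ x = a k (orbit_repr x)].

Let a1 x : a 1 x = x. Proof. by case: Aa. Qed.
Let aM g h x : K g -> K h -> a (g * h) x = a g (a h x).
Proof. by case: Aa => _ h1 _ _; exact: h1. Qed.
Let aK g x : K g -> a g^-1 (a g x) = x.
Proof. by move=> Kg; rewrite -aM ?mulVg//; exact: KV. Qed.

Lemma orbit_ofE k x : K k -> orbit_of a (a k x) = orbit_of a x.
Proof.
move=> Kk; apply/seteqP; split=> y [l Kl ->].
  by exists (l * k); [exact: KM|rewrite aM].
exists (l * k^-1); first by apply: KM => //; exact: KV.
by rewrite aM ?aK//; exact: KV.
Qed.

Lemma orbit_reprE k x : K k -> orbit_repr (a k x) = orbit_repr x.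
Proof. by move=> Kk; rewrite /orbit_repr orbit_ofE. Qed.

Lemma orbit_repr_of x : orbit_of a x (orbit_repr x).
Proof.
rewrite /orbit_repr; case: xgetP => // /(_ x) []; exists 1 => //.
Qed.

Lemma orbit_coordP x : K (orbit_coord x) /\ x =
  a (orbit_coord x) (orbit_repr x).
Proof.
rewrite /orbit_coord; case: xgetP => // nex.
have [k Kk e] := orbit_repr_of x.
by case: (nex k^-1); split; [exact: KV|rewrite e aK].
Qed.

Lemma orbit_repr_in x : A x -> A (orbit_repr x).
Proof. by case: Aa => _ _ h _ Ax; have [k Kk ->] := orbit_repr_of x;
  exact: h. Qed.

Lemma orbit_repr_idem x : orbit_repr (orbit_repr x) = orbit_repr x.
Proof. by have [k Kk {1}->] := orbit_repr_of x; exact: orbit_reprE. Qed.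

Lemma free_invariant_inj k l x : K k -> K l -> A x -> a k x = a l x -> k = l.
Proof.
case: Aa => _ _ inv fr Kk Kl Ax e.
have : l^-1 * k = 1.
  apply: (fr _ x) => //; first by apply: KM => //; exact: KV.
  by rewrite aM ?e ?aK//; exact: KV.
by move=> h; apply: (mulgI l^-1); rewrite h mulVg.
Qed.

Lemma orbit_coordE k x : K k -> A x -> orbit_coord (a k x) = k * orbit_coord x.
Proof.
move=> Kk Ax; have [Kc e] := orbit_coordP x.
have [Kc' e'] := orbit_coordP (a k x).
apply: (free_invariant_inj (x := orbit_repr x)) => //.
- exact: KM.
- exact: orbit_repr_in.
- by rewrite aM// -e [RHS]e' orbit_reprE.
Qed.

Lemma orbit_coord_repr x : A x -> orbit_coord (orbit_repr x) = 1.
Proof.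
move=> Ax; have [Kc e] := orbit_coordP (orbit_repr x).
apply: (free_invariant_inj (x := orbit_repr x)) => //.
  exact: orbit_repr_in.
by rewrite a1 [RHS]e orbit_repr_idem.
Qed.

Lemma orbit_repr_card (enc : P -> nat) (o : nat -> P) : injective enc ->
  (forall n, A (o n)) ->
  (forall m n k, K k -> o m = a k (o n) -> m = n) ->
  (orbit_repr @` A #= [set: nat])%card.
Proof.
move=> enc_inj oA o_orb; apply: eq_card_nat.
  by apply/countable_injP; exists enc => x y _ _; exact: enc_inj.
pose P' : pointedType := HB.pack P (isPointed.Build P p0).
apply/infiniteP/(@pcard_leP _ P')/injfunPex.
exists (orbit_repr \o o) => [n _|m n _ _ /= e]; first by exists (o n).
have [Km em] := orbit_coordP (o m); have [Kn en] := orbit_coordP (o n).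
apply: (o_orb _ _ (orbit_coord (o m) * (orbit_coord (o n))^-1)).
  by apply: KM => //; exact: KV.
rewrite aM//; last exact: KV.
have -> : a (orbit_coord (o n))^-1 (o n) = orbit_repr (o n) by rewrite {2}en aK.
by rewrite -e.
Qed.

End Representatives.

(** Match the orbit representatives by a bijection f0 between countably infinite sets, and send
    [a k r] to [b k (f0 r)]. By freeness a point determines its coordinate k, so this is well
    defined and injective. *)
Lemma free_actions_bij (P Q : choiceType) (a : G -> P -> P) (b : G -> Q -> Q)
    (A : set P) (B : set Q) (encP : P -> nat) (encQ : Q -> nat)
    (o : nat -> P) (o' : nat -> Q) :
  free_invariant a A -> free_invariant b B ->
  injective encP -> injective encQ ->
  (forall n, A (o n)) -> (forall m n k, K k -> o m = a k (o n) -> m = n) ->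
  (forall n, B (o' n)) -> (forall m n k, K k -> o' m = b k (o' n) -> m = n) ->
  exists2 f : P -> Q, set_bij A B f &
    forall k x, K k -> A x -> f (a k x) = b k (f x).
Proof.
move=> Aa Bb encPi encQi oA oi oB oi'.
pose rA := orbit_repr a (o 0%N); pose rB := orbit_repr b (o' 0%N).
pose kA := orbit_coord a (o 0%N); pose kB := orbit_coord b (o' 0%N).
have cA : (rA @` A #= [set: nat])%card by exact: orbit_repr_card encPi oA oi.
have cB : (rB @` B #= [set: nat])%card by exact: orbit_repr_card encQi oB oi'.
have [f0 f0b] : exists f0 : P -> Q, set_bij (rA @` A) (rB @` B) f0.
  pose Q' : pointedType := HB.pack Q (isPointed.Build Q (o' 0%N)).
  have : (rA @` A #= (rB @` B : set Q'))%card by rewrite (card_eqr cB).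
  by move/card_set_bijP.
have [f0fun f0inj f0surj] := f0b.
have rAA x : A x -> (rA @` A) (rA x) by move=> Ax; exists x.
have f0B x : A x -> exists2 y, B y & rB y = f0 (rA x).
  by move=> /rAA/f0fun [y By e]; exists y.
have f0BB x : A x -> B (f0 (rA x)).
  by move=> /f0B[y By <-]; exact: (orbit_repr_in (o' 0%N) Bb).
have rBf x : A x -> rB (f0 (rA x)) = f0 (rA x).
  by move=> /f0B[y By <-]; exact: (orbit_repr_idem (o' 0%N) Bb).
have [_ bM binv _] := Bb.
have KA x : K (kA x) by have [] := orbit_coordP (o 0%N) Aa x.
have KB x : K (kB x) by have [] := orbit_coordP (o' 0%N) Bb x.
exists (fun x => b (kA x) (f0 (rA x))); last first.
  move=> k x Kk Ax.
  by rewrite /kA /rA (orbit_coordE _ Aa)// (orbit_reprE _ Aa)// bM.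
split.
- by move=> x Ax; apply: binv => //; exact: f0BB.
- move=> x y /set_mem Ax /set_mem Ay e.
  have er : rA x = rA y.
    apply: f0inj; rewrite ?inE; try exact: rAA.
    rewrite -(rBf x)// -(rBf y)// /rB.
    rewrite -(orbit_reprE (o' 0%N) Bb (f0 (rA x)) (KA x)).
    by rewrite e (orbit_reprE (o' 0%N) Bb (f0 (rA y)) (KA y)).
  have ek : kA x = kA y.
    apply: (free_invariant_inj Bb (KA x) (KA y) (f0BB x Ax)).
    by rewrite e er.
  have [_ ->] := orbit_coordP (o 0%N) Aa x.
  by have [_ ->] := orbit_coordP (o 0%N) Aa y; rewrite -/kA -/rA er ek.
- move=> y By.
  have [x [x0 Ax0 xE] fx] : (f0 @` (rA @` A)) (rB y) by apply: f0surj; exists y.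
  have Ax : A x by rewrite -xE; exact: (orbit_repr_in (o 0%N) Aa).
  have rx : rA x = x by rewrite -xE; exact: (orbit_repr_idem (o 0%N) Aa).
  have kx : kA x = 1 by rewrite -rx; exact: (orbit_coord_repr (o 0%N) Aa).
  have [_ _ ainv _] := Aa.
  exists (a (kB y) x) => /=; first exact: ainv.
  rewrite /kA (orbit_coordE _ Aa)// -/kA kx mulg1 /rA (orbit_reprE _ Aa)// -/rA
    rx fx.
  by have [_ {3}->] := orbit_coordP (o' 0%N) Bb y.
Qed.

End FreeActions.

(** * A permutation representation of the universal group *)

Section UniversalGroupModel.
Variables (G : groupType) (E : finType) (S : self_similar_group G E).
Hypotheses (countG : countable [set: G]) (pf : pseudo_free S).
Local Open Scope group_scope.

(* The first summand is the Zappa-Szep product of E^* and G; the second one   *)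
(* leaves room to extend e x : M -> M to a permutation compatible with G.     *)
Definition model : Type := ((seq E * G) + (G * nat))%type.
HB.instance Definition _ := Choice.on model.

Definition model_act (g : G) (y : model) : model :=
  match y with
  | inl (al, h) => inl (act_word S g al, coc_word S g al * h)
  | inr (h, n) => inr (g * h, n)
  end.

Lemma model_act1 y : model_act 1 y = y.
Proof.
by case: y => -[a b] /=; rewrite ?act_word1 ?coc_word1 mul1g.
Qed.

Lemma model_actM g h y : model_act (g * h) y = model_act g (model_act h y).
Proof.
by case: y => -[a b] /=; rewrite ?act_wordM ?coc_wordM mulgA.
Qed.

Lemma model_act_free g y : model_act g y = y -> g = 1.
Proof.
case: y => -[a b] /= [].
  by rewrite -{2}(mul1g b) => ga /mulIg; exact: pseudo_free_word ga.
by rewrite -{2}(mul1g a) => /mulIg.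
Qed.

Lemma model_enc : exists enc : model -> nat, injective enc.
Proof.
have /countable_injP[c cinj0] := countG.
have cinj : injective c by move=> x y; apply: cinj0; rewrite inE.
exists (fun y : model => pickle (match y with
  | inl (al, h) => inl (al, c h) | inr (h, n) => inr (c h, n)
  end : (seq E * nat) + (nat * nat))).
move=> [[a b]|[a b]] [[a' b']|[a' b']] /(pcan_inj pickleK) => -[].
- by move=> -> /cinj ->.
- by [].
- by [].
- by move=> /cinj -> ->.
Qed.

(** On the first summand T is prescribed. It remains to map the second summand bijectively onto the
    complement of the words starting with e0, equivariantly for the stabilizer K of e0, which acts
    on the source through its cocycle at e0. Pseudo-freeness makes both K-sets free, and each has
    countably infinitely many orbits. *)
Lemma letter_extension (e0 : E) : exists T : model -> model,
  [/\ bijective T, forall al h, T (inl (al, h)) = inl (e0 :: al, h) &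
      forall k y, ss_act S k e0 = e0 ->
        T (model_act (ss_coc S k e0) y) = model_act k (T y)].
Proof.
pose K := [set k | ss_act S k e0 = e0].
have K1 : K 1 by rewrite /K /= ss_act1.
have KM g h : K g -> K h -> K (g * h) by rewrite /K /= ss_actM => gK ->.
have KV g : K g -> K g^-1.
  by rewrite /K /= => gK; rewrite -{1}gK -ss_actM mulVg ss_act1.
have KcM g h : K g -> K h -> ss_coc S (g * h) e0 =
  ss_coc S g e0 * ss_coc S h e0.
  by move=> _ hK; rewrite ss_cocM hK.
pose A : set (G * nat)%type := setT.
pose a (k : G) (x : G * nat) : G * nat := (ss_coc S k e0 * x.1, x.2).
pose B : set model := [set y | forall al h, y <> inl (e0 :: al, h)].
have Aa : free_invariant K a A.
  split=> //.
  - by move=> [h n]; rewrite /a ss_coc1 mul1g.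
  - by move=> g h [x n] Kg Kh; rewrite /a /= KcM// mulgA.
  - move=> g [x n] Kg _ [] e; apply: (pf Kg).
    by apply: (mulIg x); rewrite e mul1g.
have Bb : free_invariant K model_act B.
  split=> [|g h y _ _|g y Kg By al h e|g y Kg By].
  - exact: model_act1.
  - exact: model_actM.
  - have [] := By (act_word S (ss_coc S g^-1 e0) al)
      (coc_word S (ss_coc S g^-1 e0) al * h).
    rewrite -(model_act1 y) -(mulVg g) model_actM e /=.
    by rewrite (KV g Kg).
  - exact: model_act_free.
have [enc enc_inj] := model_enc.
pose o n : G * nat := (1, n).
pose o' n : model := inr (1, n).
have [f [ffun finj fsurj] fK] : exists2 f : G * nat -> model, set_bij A B f &
    forall k x, K k -> A x -> f (a k x) = model_act k (f x).
  apply: (free_actions_bij K1 KM KV Aa Bb (encP := enc \o inr) (encQ := enc)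
    (o := o) (o' := o')) => //.
  - by move=> x y /enc_inj[].
  - by move=> m n k _ [].
  - by move=> m n k _ [].
exists (fun y => match y with
  | inl (al, h) => inl (e0 :: al, h) | inr x => f x end); split=> //;
    last first.
  move=> k [[al h]|[h n]] Kk /=; first by rewrite Kk.
  by rewrite -fK.
rewrite -setTT_bijective; split=> //.
- move=> [[al h]|p] [[al' h']|p'] _ _.
  + by move=> [-> ->].
  + by move=> e; have [] := ffun p' I al h.
  + by move=> e; have [] := ffun p I al' h'.
  + by move=> /finj -> //; rewrite inE.
- move=> y _; have [[[al h] ->]|ny] :=
    pselect (exists ah : seq E * G, y = inl (e0 :: ah.1, ah.2)).
    by exists (inl (al, h)).
  have [x _ <-] := fsurj y (fun al h e => ny (ex_intro _ (al, h) e)).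
  by exists (inr x).
Qed.

Definition letter_orbit (e : E) : pred E :=
  fun f => `[< exists g, ss_act S g e = f >].

Definition letter_base (e : E) : E := odflt e [pick f in letter_orbit e].

Lemma letter_baseE g e : letter_base (ss_act S g e) = letter_base e.
Proof.
rewrite /letter_base.
have -> : [pick f in letter_orbit (ss_act S g e)] = [pick f in letter_orbit e].
  apply: eq_pick => f; apply/asboolP/asboolP => -[h <-].
    by exists (h * g); rewrite ss_actM.
  by exists (h * g^-1); rewrite -ss_actM mulgVK.
case: pickP => // /(_ e) /negP []; apply/asboolP; exists 1; exact: ss_act1.
Qed.

Lemma letter_base_of e : exists g, ss_act S g (letter_base e) = e.
Proof.
rewrite /letter_base; case: pickP => [f /asboolP[g <-]|_] /=.
  by exists g^-1; rewrite -ss_actM mulVg ss_act1.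
by exists 1; rewrite ss_act1.
Qed.

(** Choose the permutation at one base letter r of each orbit and conjugate: T_e = k_e T_r c_e^-1,
    where k_e sends r to e and c_e is the cocycle of k_e at r. The relation for g and e then reduces
    to the one at r for l = k_e'^-1 g k_e with e' = g e, an element that fixes r. *)
Lemma model_letters : exists T Ti : E -> model -> model,
  [/\ forall e, cancel (T e) (Ti e), forall e, cancel (Ti e) (T e),
      forall e al h, T e (inl (al, h)) = inl (e :: al, h) &
      forall g e y,
        model_act g (T e y) = T (ss_act S g e) (model_act (ss_coc S g e) y)].
Proof.
have [T0 T0P] := choice letter_extension.
have /choice[T0i T0iP] : forall e, exists f, cancel (T0 e) f /\ cancel f (T0 e).
  by move=> e; have [[f fK Kf] _ _] := T0P e; exists f.
have [k kP] := choice letter_base_of.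
pose r := letter_base; pose c e := ss_coc S (k e) (r e).
exists (fun e y => model_act (k e) (T0 (r e) (model_act (c e)^-1 y))).
exists (fun e y => model_act (c e) (T0i (r e) (model_act (k e)^-1 y))).
have aK g : cancel (model_act g) (model_act g^-1).
  by move=> y; rewrite -model_actM mulVg model_act1.
have aVK g : cancel (model_act g^-1) (model_act g).
  by move=> y; rewrite -model_actM mulgV model_act1.
split.
- by move=> e y; have [T0K _] := T0iP (r e); rewrite aK T0K aVK.
- by move=> e y; have [_ T0K] := T0iP (r e); rewrite aK T0K aVK.
- move=> e al h; have [_ T0E _] := T0P (r e).
  rewrite /= T0E /= kP -/(c e); congr (inl (_ :: _, _)).
    by rewrite -act_wordM mulgV act_word1.
  by rewrite mulgA -coc_wordM mulgV coc_word1 mul1g.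
- move=> g e y; set e' := ss_act S g e.
  have re : r e' = r e by exact: letter_baseE.
  pose l := (k e')^-1 * g * k e.
  have lr : ss_act S l (r e) = r e.
    have h : ss_act S (k e') (r e) = e' by rewrite -re kP.
    by rewrite /l !ss_actM kP -/e' -{2}h -ss_actM mulVg ss_act1.
  have kl : k e' * l = g * k e by rewrite /l !mulgA mulgV mul1g.
  have cl : (c e')^-1 * ss_coc S g e = ss_coc S l (r e) * (c e)^-1.
    have : c e' * ss_coc S l (r e) = ss_coc S g e * c e.
      have := ss_cocM S g (k e) (r e); rewrite kP -/(c e) => <-.
      by rewrite -kl ss_cocM lr /c re.
    move=> h; apply: (mulgI (c e')); rewrite mulgA mulgV mul1g mulgA h.
    by rewrite -mulgA mulgV mulg1.
  rewrite -[in RHS]model_actM cl [in RHS]model_actM re.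
  by have [_ _ ->//] := T0P (r e); rewrite -!model_actM kl.
Qed.

(* Through the model, T al \o g \o (T be)^-1 represents (al, g, be).          *)
Lemma phi_universal_inj al be :
  phi_universal S (free_word al) = phi_universal S (free_word be) -> al = be.
Proof.
have [T [Ti [TK TiK T_inl T_rel]]] := model_letters.
pose Tw al y := foldr T y al.
pose Twi al y := foldl (fun y e => Ti e y) y al.
have TwK a : cancel (Tw a) (Twi a).
  by rewrite /Tw /Twi; elim: a => //= e a ih y; rewrite TK ih.
have TwiK a : cancel (Twi a) (Tw a).
  by rewrite /Tw /Twi; elim: a => //= e a ih y; rewrite ih TiK.
have Tw_cat a b y : Tw (a ++ b) y = Tw a (Tw b y) by rewrite /Tw foldr_cat.
have Twi_cat a b y : Twi (a ++ b) y = Twi b (Twi a y) by rewrite /Twi foldl_cat.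
have Tw_rel g a y : model_act g (Tw a y) =
    Tw (act_word S g a) (model_act (coc_word S g a) y).
  by elim: a g y => //= e a ih g y; rewrite T_rel ih.
have aK g : cancel (model_act g) (model_act g^-1).
  by move=> y; rewrite -model_actM mulVg model_act1.
have aVK g : cancel (model_act g^-1) (model_act g).
  by move=> y; rewrite -model_actM mulgV model_act1.
pose F (s : ss_triple G E) y :=
  let: (a, g, b) := s in Tw a (model_act g (Twi b y)).
pose Fi (s : ss_triple G E) y :=
  let: (a, g, b) := s in Tw b (model_act g^-1 (Twi a y)).
pose act (u : seq (ss_triple G E * bool)) y :=
  foldr (fun l y => if l.2 then F l.1 y else Fi l.1 y) y u.
have FK s : cancel (F s) (Fi s).
  by case: s => -[a g] b y; rewrite /F /Fi TwK aK TwiK.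
have FiK s : cancel (Fi s) (F s).
  by case: s => -[a g] b y; rewrite /F /Fi TwK aVK TwiK.
(* Moving g to the left past the inverse of T_b; this rule matches the second case of the semigroup
   product. *)
have Twi_rel g b y : Twi b (model_act g y) =
    model_act (coc_word S g^-1 b)^-1 (Twi (act_word S g^-1 b) y).
  apply: (can_inj (TwK b)); rewrite TwiK; apply: (can_inj (aK g^-1)).
  by rewrite aK Tw_rel aVK TwiK.
have actP u v : pres_congr (@universal_rel _ _ S) u v -> act u =1 act v.
  elim=> {u v} //.
  - by move=> u v _ ih y; rewrite ih.
  - by move=> u v w _ ih1 _ ih2 y; rewrite ih1.
  - move=> u v x b y; rewrite /act !foldr_cat /=; congr foldr.
    by case: b => /=; rewrite ?FK ?FiK.
  - move=> u v _ _ [s [t [st [est [-> ->]]]]] y.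
    rewrite /act !foldr_cat; congr foldr; move: (foldr _ y v) => {}y /=.
    move: s t est => [[a g] b] [[c h] d]; rewrite /ss_mul /triple_mul.
    case: ifP => [/prefixP[c' ->] [<-]|_].
      rewrite drop_size_cat// /F !Tw_cat TwK; congr (Tw a _).
      by rewrite Tw_rel model_actM.
    case: ifP => // /prefixP[b' ->] [<-].
    rewrite drop_size_cat// /F !Twi_cat TwK.
    by rewrite Twi_rel model_actM.
have wordP a : phi_universal S (free_word a) =
    pres_class _ [seq (([:: e], 1, [::]), true) | e <- a].
  rewrite /free_word; elim: a => [|e a ih].
    rewrite big_nil; rewrite /phi_universal.
    by rewrite [LHS](free_lift_class _ [::]) /eval_word big_nil.
  rewrite big_cons /phi_universal free_liftM -/(phi_universal S) ih.
  by rewrite /phi_universal free_lift_gen [LHS]pres_classM.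
have act_inl a : act [seq (([:: e], 1, [::]), true) | e <- a] (inl ([::], 1)) =
    inl (a, 1).
  elim: a => //= e a ih; rewrite ih model_act1.
  by rewrite /Tw /= T_inl.
rewrite !wordP => /pres_classP/actP/(_ (inl ([::], 1))).
by rewrite !act_inl => -[].
Qed.

End UniversalGroupModel.

(** * Infinite words *)

Section InfiniteWordsTopology.
Variable E : finType.
Local Notation X := (infinite_words E).

Lemma prepend_nil (z : X) : prepend [::] z = z.
Proof. by apply/funext => n; rewrite /prepend /= nth_nil subn0. Qed.

Lemma prepend_lt al (z : X) n x0 : (n < size al)%N ->
  prepend al z n = nth x0 al n.
Proof. by move=> nal; exact: set_nth_default. Qed.

Lemma prepend_ge al (z : X) n : (size al <= n)%N ->
  prepend al z n = z (n - size al)%N.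
Proof. by move=> aln; rewrite /prepend nth_default. Qed.

Lemma prepend_cat al be (z : X) :
  prepend (al ++ be) z = prepend al (prepend be z).
Proof.
apply/funext => n; rewrite {1}/prepend nth_cat size_cat subnDA.
by case: ltnP => nal; [exact: set_nth_default|rewrite prepend_ge].
Qed.

Lemma prepend_inj al : injective (@prepend E al).
Proof.
move=> z z' e; apply/funext => n.
have := congr1 (fun x : X => x (size al + n)%N) e.
by rewrite !prepend_ge ?leq_addr// addKn.
Qed.

Definition wdrop n (x : X) : X := fun i => x (n + i)%N.

Lemma prepend_mkseq n (x : X) : prepend (mkseq x n) (wdrop n x) = x.
Proof.
apply/funext => i; rewrite /prepend size_mkseq /wdrop; case: (ltnP i n) => ni.
  by rewrite nth_mkseq.
by rewrite nth_default ?size_mkseq// subnKC.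
Qed.

Lemma wdrop_prepend al (z : X) : wdrop (size al) (prepend al z) = z.
Proof. by apply/funext => n; rewrite /wdrop prepend_ge ?leq_addr// addKn. Qed.

Lemma mkseq_prepend al (z : X) : mkseq (prepend al z) (size al) = al.
Proof.
apply: (@eq_from_nth _ (z 0%N)); rewrite size_mkseq// => i ial.
by rewrite nth_mkseq// (prepend_lt _ (z 0%N)).
Qed.

Lemma mkseqD (x : X) m n : mkseq x (m + n) = mkseq x m ++ mkseq (wdrop m x) n.
Proof.
rewrite /mkseq iotaD map_cat add0n; congr (_ ++ _).
by rewrite -{1}[m]addn0 iotaDl -map_comp.
Qed.

Lemma take_mkseq (x : X) m n : (m <= n)%N -> take m (mkseq x n) = mkseq x m.
Proof. by move=> mn; rewrite /mkseq -map_take take_iota (minn_idPl mn). Qed.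

Lemma cylinderP al (x : X) : cylinder al x <-> mkseq x (size al) = al.
Proof.
split=> [[z _ <-]|e]; first exact: mkseq_prepend.
by exists (wdrop (size al) x) => //; rewrite -{1}e prepend_mkseq.
Qed.

Lemma cylinder_mkseq (x : X) n : cylinder (mkseq x n) x.
Proof. by apply/cylinderP; rewrite size_mkseq. Qed.

Lemma prepend_prefix al be (z z' : X) : (size al <= size be)%N ->
  prepend al z = prepend be z' ->
  exists ga, be = al ++ ga /\ z = prepend ga z'.
Proof.
move=> albe e; have := mkseq_prepend be z'; rewrite -e.
rewrite -(subnKC albe) mkseqD mkseq_prepend => be_al.
exists (mkseq (wdrop (size al) (prepend al z)) (size be - size al)); split=> //.
by apply: (@prepend_inj al); rewrite -prepend_cat be_al.
Qed.

(** A cylinder around x is a finite intersection of conditions on single coordinates. Conversely the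
    cylinders around x generate a filter that converges in each coordinate, hence in the product
    topology. *)
Lemma nbhs_cylinder (x : X) (U : set X) :
  nbhs x U <-> exists n, cylinder (mkseq x n) `<=` U.
Proof.
split=> [|[n nU]]; last first.
  apply: filterS nU _; elim: n => [|n ih].
    by apply: filterS filterT => y _; apply/cylinderP.
  have xn : nbhs x [set y : X | y n = x n].
    have /cvg_sup/(_ n) : (nbhs x : set_system X) --> x by exact: cvg_id.
    apply; exists [set y : X | y n = x n]; split=> //.
    exists [set x n] => //; exact: discrete_open.
  apply: filterS2 ih xn => y /cylinderP; rewrite size_mkseq => e /= en.
  by apply/cylinderP; rewrite size_mkseq !mkseqS e en.
pose F : set_system X := [set V | exists n, cylinder (mkseq x n) `<=` V].
have FF : Filter F.
  split.
  - by exists 0%N.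
  - move=> A B [n nA] [m mB]; exists (maxn n m) => y /cylinderP.
    rewrite size_mkseq => e; split.
      apply: nA; apply/cylinderP; rewrite size_mkseq.
      by rewrite -(take_mkseq y (leq_maxl n m)) e take_mkseq// leq_maxl.
    apply: mB; apply/cylinderP; rewrite size_mkseq.
    by rewrite -(take_mkseq y (leq_maxr n m)) e take_mkseq// leq_maxr.
  - by move=> A B AB [n nA]; exists n; exact: subset_trans AB.
suff Fx : F --> x by exact: Fx.
apply/cvg_sup => i V [B [[A Aop <-] /= Ax] BV].
(* The coordinate of index i is fixed once the first i + 1 letters are. *)
exists i.+1 => y /cylinderP; rewrite size_mkseq => e; apply: BV => /=.
have := congr1 (nth (x i) ^~ i) e.
by rewrite /= !nth_mkseq// => ->.
Qed.

Lemma cylinder_open al : open (@cylinder E al).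
Proof.
rewrite openE => x /cylinderP e; apply/nbhs_cylinder.
by exists (size al); rewrite e.
Qed.

(** König's lemma, the form in which compactness of the space of infinite words is used. Call a word
    bad if it has extensions of every length outside Q. As E is finite, a bad word has a bad
    one-letter extension; iterating produces an infinite word with no prefix in Q. *)
Lemma koenig_bar (Q : set (seq E)) :
  (forall al e, Q al -> Q (rcons al e)) -> (forall x : X, exists n,
    Q (mkseq x n)) ->
  exists n, forall al, size al = n -> Q al.
Proof.
move=> Qh Qbar; apply: contrapT => nobar.
have Qcat al be : Q al -> Q (al ++ be).
  by elim/last_ind: be => [|be e ih] Qal; rewrite ?cats0// -rcons_cat;
    apply/Qh/ih.
pose bad al := forall n, exists2 be, size be = n & ~ Q (al ++ be).
have bad0 : bad [::].
  move=> n; apply: contrapT => h; apply: nobar; exists n => al aln.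
  by apply: contrapT => nQ; apply: h; exists al.
have badS al : bad al -> exists e, bad (rcons al e).
  move=> bal; apply: contrapT => h.
  have /choice[N NP] : forall e, exists n, forall be, size be = n ->
    Q (rcons al e ++ be).
    move=> e; apply: contrapT => hn; apply: h; exists e => n.
    apply: contrapT => hb; apply: hn; exists n => be ben.
    by apply: contrapT => nQ; apply: hb; exists be.
  (* The additional 1 pays for the letter e, so that the remaining [be] still has length at least
     [N e]. *)
  have [[//|e be]] := bal (\max_e N e).+1.
  move=> [sbe] []; rewrite -cat_rcons -(cat_take_drop (N e) be) catA.
  apply: Qcat; apply: NP; rewrite size_takel// sbe.
  exact: (leq_bigmax e).
have [nx nxP] : exists nx : seq E -> E, forall al, bad al ->
  bad (rcons al (nx al)).
  have [e0 _] := badS [::] bad0.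
  have /choice[f fP] : forall al, exists e, bad al -> bad (rcons al e).
    move=> al; have [b|nb] := pselect (bad al); last by exists e0.
    by have [e be] := badS al b; exists e.
  by exists f.
pose w n := iter n (fun al => rcons al (nx al)) [::].
have wbad n : bad (w n) by elim: n => //= n ih; exact: nxP.
pose x : X := fun n => nx (w n).
have wx n : w n = mkseq x n.
  elim: n => //= n ih; by rewrite mkseqS -ih.
have [n Qn] := Qbar x; have [be /size0nil -> ] := wbad n 0%N.
by rewrite cats0 wx.
Qed.

End InfiniteWordsTopology.

(** * The induced partial action *)

(* The partial action through which the words of E^* act by prefixing, for a  *)
(* multiplicative injection of E^* into a group.                              *)
Section PrefixExchange.
Variables (E : finType) (H : groupType) (w : seq E -> H).
Hypotheses (w_cat : forall al be, w (al ++ be) = (w al * w be)%g)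
  (w_inj : injective w).
Local Notation X := (infinite_words E).

(** The pair al, be need not be reduced: a common suffix cancels in h and can be moved into z. *)
Definition exchange (h : H) (x y : X) : Prop := exists al be z,
  [/\ h = (w al * (w be)^-1)%g, x = prepend be z & y = prepend al z].

Lemma exchange1 x : exchange 1%g x x.
Proof. by exists [::], [::], x; rewrite prepend_nil mulgV. Qed.

Lemma exchangeV h x y : exchange h x y -> exchange h^-1%g y x.
Proof. by move=> [al [be [z [-> -> ->]]]]; exists be, al, z; rewrite invgF. Qed.

(** The middle point begins with both al and de, so one of these is a prefix of the other.
    Lengthening the shorter pair by the missing suffix makes the middle words equal, and they
    cancel. *)
Lemma exchangeM g h x y u :
  exchange h x y -> exchange g y u -> exchange (g * h)%g x u.
Proof.
move=> [al [be [z [-> -> ->]]]] [ga [de [t [-> e ->]]]].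
case/orP: (leq_total (size de) (size al)) => sz.
  have [c [-> ->]] := prepend_prefix sz (esym e).
  exists (ga ++ c), be, z; rewrite prepend_cat; split=> //.
  by rewrite !w_cat !mulgA mulgVK.
have [c [-> ->]] := prepend_prefix sz e.
exists ga, (be ++ c), t; rewrite prepend_cat; split=> //.
by rewrite !w_cat !invgM !mulgA mulgVK.
Qed.

(** Injectivity of [w] enters here: h = 1 forces al = be. Applied to the composite of the relation
    with its inverse, this makes the relation single-valued ([exchange_fun]). *)
Lemma exchange_eq1 x y : exchange 1%g x y -> x = y.
Proof.
move=> [al [be [z [e -> ->]]]]; congr prepend; apply: w_inj.
by rewrite -[LHS]mul1g e mulgVK.
Qed.

Lemma exchange_fun h x y y' : exchange h x y -> exchange h x y' -> y = y'.
Proof.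
move=> /exchangeV hV h'; apply: exchange_eq1.
by have := exchangeM hV h'; rewrite mulgV.
Qed.

Variable p : partial_action_data H X.
Hypotheses (p_dom : forall h y, pa_dom p h y <-> exists x, exchange h x y)
  (p_map : forall h x y, exchange h x y -> pa_map p h x = y).

Lemma p_domV h x : pa_dom p h^-1%g x <-> exchange h x (pa_map p h x).
Proof.
split=> [/p_dom[y /exchangeV]|xy]; rewrite ?invgK.
  by move=> xy; rewrite (p_map xy).
by apply/p_dom; exists (pa_map p h x); exact: exchangeV.
Qed.

Lemma p_mapK h x : pa_dom p h x -> pa_map p h (pa_map p h^-1%g x) = x.
Proof.
by rewrite -{1}[h]invgK => /p_domV/exchangeV; rewrite invgK; exact: p_map.
Qed.

Lemma exchange_partial_action : is_partial_action p.
Proof.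
split.
- apply/seteqP; split=> // x _; apply/p_dom; exists x; exact: exchange1.
- by move=> x; apply: p_map; exact: exchange1.
- move=> h; split.
  + by move=> x /p_domV hx; apply/p_dom; exists x.
  + move=> x y /set_mem/p_domV hx /set_mem/p_domV hy e.
    by apply: exchange_fun (exchangeV hx) _; rewrite e; exact: exchangeV.
  + move=> y /p_dom[x xy]; exists x; last exact: p_map.
    by apply/p_domV; rewrite (p_map xy).
- move=> g h x /p_domV hx /p_domV ghx; have xx := exchangeM hx ghx.
  by split; [apply/p_domV; rewrite (p_map xx)|exact: p_map].
Qed.

Lemma p_dom_open h : open (pa_dom p h).
Proof.
rewrite openE => y /p_dom[x [al [be [z [-> _ ->]]]]].
rewrite /interior; apply: (@filterS _ _ _ (cylinder al)).
  by move=> _ [t _ <-]; apply/p_dom; exists (prepend be t), al, be, t.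
by apply: open_nbhs_nbhs; split; [exact: cylinder_open|exists z].
Qed.

Lemma p_map_prepend al be z :
  pa_map p (w al * (w be)^-1)%g (prepend be z) = prepend al z.
Proof. by apply: p_map; exists al, be, z. Qed.

Lemma p_map_continuous h : {in pa_dom p h^-1%g, continuous (pa_map p h)}.
Proof.
move=> x /set_mem/p_domV[al [be [z [-> -> ez]]]].
rewrite /continuous_at ez => U /nbhs_cylinder[n nU].
change (nbhs (prepend be z) (pa_map p (w al * (w be)^-1)%g @^-1` U)).
apply/nbhs_cylinder; exists (size be + n)%N.
rewrite mkseqD mkseq_prepend wdrop_prepend => _ [t _ <-] /=.
rewrite prepend_cat p_map_prepend; apply: nU.
have e m : mkseq (prepend al z) (size al + m) = al ++ mkseq z m.
  by rewrite mkseqD mkseq_prepend; congr (_ ++ mkseq _ _); exact: wdrop_prepend.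
have n_le : (n <= size al + n)%N by exact: leq_addl.
apply/cylinderP; rewrite size_mkseq -prepend_cat -[RHS](take_mkseq _ n_le) e.
rewrite -(take_mkseq _ n_le); congr take.
by have := mkseq_prepend (al ++ mkseq z n) t; rewrite size_cat size_mkseq.
Qed.

Lemma exchange_topological : is_topological_partial_action p.
Proof.
split; [exact: exchange_partial_action|exact: p_dom_open|move=> h].
rewrite continuous_open_subspace; first exact: p_map_continuous.
exact: p_dom_open.
Qed.

End PrefixExchange.

(** * The partial action of the universal group *)

Section UniversalPartialAction.
Variables (G : groupType) (E : finType) (S : self_similar_group G E).
Hypotheses (countG : countable [set: G]) (pf : pseudo_free S)
  (ex : exhausting S).
Local Notation X := (infinite_words E).
Local Notation phi := (phi_universal S).

Definition word_image (al : seq E) : universal_group S := phi (free_word al).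
Local Notation w := word_image.

Lemma free_word_cat (al be : seq E) :
  free_word (al ++ be) = (free_word al * free_word be)%g.
Proof. by rewrite /free_word big_cat. Qed.

Lemma phiM : {morph phi : g h / (g * h)%g}.
Proof. exact: free_liftM. Qed.

Lemma phi1 : phi 1%g = 1%g.
Proof. by apply: (mulgI (phi 1%g)); rewrite -phiM !mulg1. Qed.

Lemma phiV g : phi g^-1%g = (phi g)^-1%g.
Proof. by apply: (mulgI (phi g)); rewrite -phiM !mulgV phi1. Qed.

Lemma word_image_cat al be : w (al ++ be) = (w al * w be)%g.
Proof. by rewrite /word_image free_word_cat phiM. Qed.

Lemma word_image_inj : injective w.
Proof. by move=> al be; exact: phi_universal_inj. Qed.

Lemma sigmaM s t st : ss_mul S (Some s) (Some t) = Some st ->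
  (sigma S s * sigma S t)%g = sigma S st.
Proof.
move=> e; rewrite [LHS]pres_classM; apply/pres_classP.
have r : @universal_rel _ _ S [:: (s, true); (t, true)] [:: (st, true)].
  by exists s, t, st.
exact: (pres_rel [::] [::] r).
Qed.

(** The triple is an idempotent of the semigroup, and a group has no idempotent besides 1. *)
Lemma sigma_idem al : sigma S (al, 1%g, al) = 1%g.
Proof.
have : (sigma S (al, 1%g, al) * sigma S (al, 1%g, al))%g =
  sigma S (al, 1%g, al).
  by apply: sigmaM; rewrite /= prefix_refl drop_size /= cats0 mulg1.
by rewrite -[X in _ = X -> _]mulg1 => /mulgI.
Qed.

Lemma sigma_word al : sigma S (al, 1%g, [::]) = w al.
Proof.
elim/last_ind: al => [|al e ih].
  by rewrite sigma_idem /w /free_word big_nil phi1.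
rewrite -cats1 word_image_cat -ih.
have -> : w [:: e] = sigma S ([:: e], 1%g, [::]).
  by rewrite /w /free_word big_seq1 /phi_universal free_lift_gen.
apply/esym/sigmaM => /=.
by rewrite !ss_act1 ss_coc1 mulg1.
Qed.

Lemma sigma_words al be : sigma S (al, 1%g, be) = (w al * (w be)^-1)%g.
Proof.
rewrite -!sigma_word; apply: (mulIg (sigma S (be, 1%g, [::]))).
rewrite mulgVK; apply: sigmaM.
by rewrite /= prefix_refl drop_size /= cats0 mulg1.
Qed.

(* Multiplying by an idempotent (be ga, 1, be ga) with trivial ga-cocycle     *)
(* removes the group element.                                                 *)
Lemma sigma_image s : exists al be, sigma S s = (w al * (w be)^-1)%g.
Proof.
case: s => -[al g] be; have [ga gga] := ex g.
exists (al ++ act_word S g ga), (be ++ ga); rewrite -sigma_words.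
rewrite -[LHS]mulg1 -(sigma_idem (be ++ ga)); apply: sigmaM.
by rewrite /= prefix_prefix drop_size_cat// gga mulg1.
Qed.

Lemma phi_surj h : exists g, phi g = h.
Proof.
have sig s : exists g, phi g = sigma S s.
  have [al [be ->]] := sigma_image s.
  by exists (free_word al * (free_word be)^-1)%g; rewrite phiM phiV.
rewrite -(pres_repr h); elim: (repr h) => [|[s b] u [g gu]].
  by exists 1%g; rewrite phi1.
have [k ks] := sig s.
have -> : pres_class (@universal_rel _ _ S) ((s, b) :: u) =
    ((if b then sigma S s else (sigma S s)^-1) * pres_class _ u)%g.
  have -> : (if b then sigma S s else (sigma S s)^-1)%g =
    pres_class _ [:: (s, b)].
    case: b => //; apply/esym/(mulgI (sigma S s)); rewrite mulgV.
    rewrite [LHS]pres_classM; apply/pres_classP.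
    exact: (pres_cancel _ [::] [::] s true).
  by rewrite [RHS]pres_classM.
exists ((if b then k else k^-1) * g)%g; rewrite phiM gu; congr (_ * _)%g.
by case: (b); rewrite ?phiV ks.
Qed.

Lemma reduce_pair (al be : seq E) : exists al0 be0 ga,
  [/\ al = al0 ++ ga, be = be0 ++ ga & reduced_pair al0 be0].
Proof.
elim/last_ind: al be => [|al e ih] be.
  exists [::], be, [::]; rewrite !cats0; split=> // a b e [/eqP].
  by rewrite eq_sym -size_eq0 size_rcons.
case/lastP: be => [|be f].
  exists (rcons al e), [::], [::]; rewrite !cats0; split=> // a b c [_ /eqP].
  by rewrite eq_sym -size_eq0 size_rcons.
have [->|ef] := eqVneq e f.
  have [al0 [be0 [ga [-> -> red]]]] := ih be.
  by exists al0, be0, (rcons ga f); rewrite !rcons_cat.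
exists (rcons al e), (rcons be f), [::]; rewrite !cats0; split=> //.
move=> a b c [/rcons_inj[_ ec] /rcons_inj[_ fc]].
by rewrite ec fc eqxx in ef.
Qed.

Lemma reduced_formV g (al be : seq E) :
  reduced_form g al be -> reduced_form g^-1%g be al.
Proof.
move=> [red ->]; split; last by rewrite invgF.
by move=> a b e [h1 h2]; apply: (red b a e).
Qed.

Lemma reduced_form_image g al be :
  reduced_form g al be -> phi g = (w al * (w be)^-1)%g.
Proof. by move=> [_ ->]; rewrite phiM phiV. Qed.

(** [quigg_raeburn] speaks of reduced pairs only. The common suffix of al and be is moved into the
    tail, which changes neither the two infinite words nor the image in the universal group. *)
Lemma reduced_form_ex al be z : exists g al0 be0 z0,
  [/\ reduced_form g al0 be0, phi g = (w al * (w be)^-1)%g,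
      prepend al z = prepend al0 z0 :> X & prepend be z = prepend be0 z0].
Proof.
have [al0 [be0 [ga [-> -> red]]]] := reduce_pair al be.
exists (free_word al0 * (free_word be0)^-1)%g, al0, be0, (prepend ga z).
split=> //; rewrite ?prepend_cat//.
by rewrite phiM phiV !word_image_cat invgM mulgA mulgK.
Qed.

Lemma quigg_raeburn_map g x : pa_dom (quigg_raeburn E) g^-1%g x ->
  exchange w (phi g) x (pa_map (quigg_raeburn E) g x).
Proof.
move=> [be [al [/reduced_formV + [z _ xz]]]]; rewrite invgK => red.
rewrite /=; case: xgetP => [y _ [a [b [t [/reduced_form_image ga -> ->]]]]|].
  by exists a, b, t.
by move=> /(_ (prepend al z))[]; exists al, be, z.
Qed.

Lemma theta_dom h y : pa_dom (theta_universal S) h y <-> exists x,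
  exchange w h x y.
Proof.
split=> [[g /= <- [al [be [/reduced_form_image e [z _ <-]]]]]|].
  by exists (prepend be z), al, be, z.
move=> [x [al [be [z [-> _ ->]]]]].
have [g [al0 [be0 [z0 [red ge ez _]]]]] := reduced_form_ex al be z.
by exists g => //; exists al0, be0; split=> //; rewrite ez; exists z0.
Qed.

(** The induced action evaluates some g over h picked by [xget]. Whatever g is, the result is
    related to x by [exchange], which is single-valued. *)
Lemma theta_map h x y : exchange w h x y -> pa_map (theta_universal S) h x = y.
Proof.
move=> xy; apply: (exchange_fun word_image_cat word_image_inj _ xy).
change (exchange w h x (pa_map (quigg_raeburn E)
  (xget 1%g [set g | phi g = h /\ pa_dom (quigg_raeburn E) g^-1%g x]) x)).
case: xgetP => [g _ [<- xg]|nog]; first exact: quigg_raeburn_map.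
case: xy => al [be [z [e xe ye]]].
have [g [al0 [be0 [z0 [red ge ez ez']]]]] := reduced_form_ex al be z.
have [] := nog g; split; first by rewrite ge e.
by exists be0, al0; split; [exact: reduced_formV|rewrite xe ez'; exists z0].
Qed.

Lemma phi_inducible : inducible (quigg_raeburn E) phi.
Proof.
split; [exact: phiM|exact: phi_surj|].
move=> g1 g2 x e /quigg_raeburn_map h1 /quigg_raeburn_map h2.
by apply: (exchange_fun word_image_cat word_image_inj h1); rewrite e.
Qed.

Lemma theta_topological : is_topological_partial_action (theta_universal S).
Proof.
exact: exchange_topological word_image_cat word_image_inj _ theta_dom theta_map.
Qed.

End UniversalPartialAction.

(** * Convergence in C*-algebras *)

Section RealNorm.
Variables (R : realType).
Local Notation C := (cplx R).

(* The norms of normed modules over R[i] are complex numbers.                 *)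
Definition nrm (A : normedZmodType C) (a : A) : R := complex.Re (`|a| : R[i]).

Lemma nrmE (A : normedZmodType C) (a : A) : `|a| = (nrm a)%:C%C :> C.
Proof.
have := normr_ge0 a; rewrite /nrm; case: (`|a| : R[i]) => x y.
by rewrite lecE /= => /andP[/eqP -> _].
Qed.

Lemma nrm_le (A B : normedZmodType C) (a : A) (b : B) :
  (`|a| <= `|b| :> C) = (nrm a <= nrm b).
Proof. by rewrite !nrmE lecR. Qed.

Lemma nrm_ge0 (A : normedZmodType C) (a : A) : 0 <= nrm a.
Proof. by have := normr_ge0 a; rewrite nrmE -lecR. Qed.

Lemma nrm0 (A : normedZmodType C) : nrm (0 : A) = 0.
Proof. by rewrite /nrm normr0. Qed.

Lemma nrm0_eq0 (A : normedZmodType C) (a : A) : nrm a = 0 -> a = 0.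
Proof. by move=> a0; apply/normr0_eq0; rewrite nrmE a0. Qed.

Lemma nrmD (A : normedZmodType C) (a b : A) : nrm (a + b) <= nrm a + nrm b.
Proof. by have := ler_normD a b; rewrite !nrmE -rmorphD /= lecR. Qed.

Lemma nrmN (A : normedZmodType C) (a : A) : nrm (- a) = nrm a.
Proof. by rewrite /nrm normrN. Qed.

Lemma nrmB (A : normedZmodType C) (a b : A) : nrm (a - b) = nrm (b - a).
Proof. by rewrite /nrm distrC. Qed.

Lemma nrm_triangle (A : normedZmodType C) (c a b : A) :
  nrm (a - b) <= nrm (a - c) + nrm (c - b).
Proof. by rewrite -[X in nrm X](subrKA c); exact: nrmD. Qed.

Lemma nrm_sum (A : normedZmodType C) (I : Type) (r : seq I) (P : pred I) (F : I
  -> A) :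
  nrm (\sum_(i <- r | P i) F i) <= \sum_(i <- r | P i) nrm (F i).
Proof.
elim/big_ind2: _ => [|a x b y ax bY|//]; first by rewrite nrm0.
by apply: le_trans (nrmD _ _) _; exact: lerD.
Qed.

Lemma nrmZ (A : normedModType C) (c : C) (a : A) : nrm (c *: a) = nrm c * nrm a.
Proof.
have := normrZ c a; rewrite !nrmE -rmorphM /= => h.
by move: (congr1 (@complex.Re R) h).
Qed.

Lemma nrmCM (c d : C) : nrm (c * d) = nrm c * nrm d.
Proof.
have := normrM c d; rewrite !nrmE -rmorphM /= => h.
by move: (congr1 (@complex.Re R) h).
Qed.

Lemma nrm_real (x : R) : nrm (x%:C%C : C) = `|x|.
Proof. by rewrite /nrm normc_def /= expr0n /= addr0 sqrtr_sqr. Qed.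

Lemma gt0_complexP (e : C) : 0 < e -> exists2 r : R, 0 < r & e = r%:C%C.
Proof. by case: e => x y; rewrite ltcE /= => /andP[/eqP-> x0]; exists x. Qed.

Lemma real_complex_gt0 (r : R) : ((0 : C) < r%:C%C) = (0 < r).
Proof. by rewrite -(rmorph0 (real_complex R)) ltcR. Qed.

Lemma null_sequence : exists d : nat -> R, (forall n, 0 < d n) /\
  forall e, 0 < e -> exists N, forall n, (N <= n)%N -> d n <= e.
Proof.
exists (fun n => n.+1%:R^-1); split=> [n|e e0]; first by rewrite invr_gt0.
exists (Num.trunc e^-1) => n Nn.
rewrite -[e]invrK lef_pV2 ?posrE ?invr_gt0 ?ltr0n//.
have /ltW h := truncnS_gt e^-1; apply: le_trans h _.
by rewrite ler_nat ltnS.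
Qed.

Section Convergence.
Variable A : completeNormedModType C.
Implicit Types (u v : nat -> A) (a b l : A).

Definition tends u l := forall e : R, 0 < e ->
  exists N, forall n, (N <= n)%N -> nrm (u n - l) <= e.

Definition ncauchy u := forall e : R, 0 < e ->
  exists N, forall m n, (N <= m)%N -> (N <= n)%N -> nrm (u m - u n) <= e.

Lemma tendsP u l : tends u l <-> (u n @[n --> \oo] --> l).
Proof.
split=> [ul|].
  apply/cvgrPdist_le => _ /gt0_complexP[e e0 ->].
  have [N NP] := ul e e0.
  by exists N => // n /= Nn; rewrite nrmE lecR nrmB; exact: NP.
move=> /cvgrPdist_le ul e e0.
have [|N _ NP] := ul (e%:C)%C; first by rewrite real_complex_gt0.
by exists N => n Nn; have := NP n Nn; rewrite /= nrmE lecR nrmB.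
Qed.

Lemma tends_cst a : tends (fun=> a) a.
Proof. by move=> e e0; exists 0%N => n _; rewrite subrr nrm0 ltW. Qed.

Lemma tends_eventually u v l N : (forall n, (N <= n)%N -> u n = v n) ->
  tends u l -> tends v l.
Proof.
move=> uv ul e /ul[M MP]; exists (maxn M N) => n;
  rewrite geq_max => /andP[Mn Nn].
by rewrite -uv// MP.
Qed.

Lemma small_eq0 (x : R) : 0 <= x -> (forall e, 0 < e -> x <= e) -> x = 0.
Proof.
move=> x0 xe; apply/eqP; rewrite eq_le x0 andbT leNgt; apply/negP => xp.
by have := xe (x / 2) (divr_gt0 xp (ltr0Sn _ 1)); rewrite leNgt;
  apply/negP/negPn; lra.
Qed.

Lemma tends_unique u a b : tends u a -> tends u b -> a = b.
Proof.
move=> ua ub; apply/subr0_eq/nrm0_eq0/small_eq0 => [|e e0];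
  first exact: nrm_ge0.
have e2 : 0 < e / 2 by rewrite divr_gt0.
have [N NP] := ua _ e2; have [M MP] := ub _ e2.
apply: le_trans (nrm_triangle (u (maxn N M)) _ _) _.
rewrite [leRHS](splitr e) lerD// ?MP ?leq_maxr//.
by rewrite nrmB NP// leq_maxl.
Qed.

Lemma tendsD u v a b : tends u a -> tends v b ->
  tends (fun n => u n + v n) (a + b).
Proof.
move=> ua vb e e0; have e2 : 0 < e / 2 by rewrite divr_gt0.
have [N NP] := ua _ e2; have [M MP] := vb _ e2.
exists (maxn N M) => n; rewrite geq_max => /andP[/NP un /MP vn].
rewrite opprD addrACA (splitr e); apply: le_trans (nrmD _ _) _; exact: lerD.
Qed.

Lemma tendsZ (c : C) u a : tends u a -> tends (fun n => c *: u n) (c *: a).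
Proof.
move=> ua e e0; have c0 : 0 < nrm c + 1 by rewrite ltr_wpDl ?nrm_ge0.
have [N NP] := ua (e / (nrm c + 1)) (divr_gt0 e0 c0).
exists N => n /NP; rewrite -scalerBr nrmZ ler_pdivlMr// => h.
apply: le_trans h; rewrite mulrC ler_wpM2l ?nrm_ge0//; lra.
Qed.

Lemma tends_le u a (M : R) : tends u a -> (forall n, nrm (u n) <= M) ->
  nrm a <= M.
Proof.
move=> ua uM; apply/ler_addgt0Pr => e e0; have [N NP] := ua e e0.
rewrite -[a](subrK (u N)) addrC; apply: le_trans (nrmD _ _) _.
by rewrite lerD// nrmB NP.
Qed.

Lemma ncauchyP u : ncauchy u -> exists l, tends u l.
Proof.
move=> cu; suff /cvg_ex[l ul] : cvg (u n @[n --> \oo]) by exists l;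
  exact/tendsP.
apply: cauchy_cvg; apply/cauchy_exP => _ /gt0_complexP[e e0 ->].
have [N NP] := cu (e / 2) (divr_gt0 e0 (ltr0Sn _ 1)).
exists (u N); exists N => // n /= Nn.
rewrite -ball_normE /= nrmE ltcR; apply: le_lt_trans (NP _ _ (leqnn N) Nn) _;
  lra.
Qed.

Lemma tends_ncauchy u l : tends u l -> ncauchy u.
Proof.
move=> ul e e0; have [N NP] := ul (e / 2) (divr_gt0 e0 (ltr0Sn _ 1)).
exists N => m n /NP um /NP un; apply: le_trans (nrm_triangle l _ _) _.
by rewrite (splitr e) lerD// nrmB.
Qed.

Lemma ncauchy_bounded u : ncauchy u -> exists M, forall n, nrm (u n) <= M.
Proof.
move=> /(_ 1 ltr01)[N NP].
exists (\sum_(i < N.+1) nrm (u i) + 1) => n.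
have hs i : (i <= N)%N -> nrm (u i) <= \sum_(i < N.+1) nrm (u i).
  move=> iN; rewrite (bigD1 (inord i))//= inordK ?ltnS// lerDl.
  by apply: sumr_ge0 => *; exact: nrm_ge0.
case: (leqP n N) => nN; first by apply: le_trans (hs _ nN) _; lra.
rewrite -[u n](subrK (u N)) addrC; apply: le_trans (nrmD _ _) _.
by rewrite lerD ?hs// NP// ltnW.
Qed.

End Convergence.
End RealNorm.

Section CStarBasics.
Variables (R : realType) (A : cstarType R).
Local Notation C := (cplx R).
Implicit Types (a b : A) (u v : nat -> A).

Lemma cs_mul0r a : cs_mul 0 a = 0.
Proof. by apply: (addrI (cs_mul 0 a)); rewrite -cs_mulDl !addr0. Qed.

Lemma cs_mulr0 a : cs_mul a 0 = 0.
Proof. by apply: (addrI (cs_mul a 0)); rewrite -cs_mulDr !addr0. Qed.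

Lemma cs_mulNr a b : cs_mul (- a) b = - cs_mul a b.
Proof. by apply: (addrI (cs_mul a b)); rewrite -cs_mulDl !subrr cs_mul0r. Qed.

Lemma cs_mulrN a b : cs_mul a (- b) = - cs_mul a b.
Proof. by apply: (addrI (cs_mul a b)); rewrite -cs_mulDr !subrr cs_mulr0. Qed.

Lemma cs_star0 : cs_star (0 : A) = 0.
Proof. by apply: (addrI (cs_star 0)); rewrite -cs_starD !addr0. Qed.

Lemma cs_mul_suml (I : Type) (r : seq I) (P : pred I) (F : I -> A) a :
  cs_mul (\sum_(i <- r | P i) F i) a = \sum_(i <- r | P i) cs_mul (F i) a.
Proof.
apply: (big_morph (fun x => cs_mul x a)) => [x y|]; first exact: cs_mulDl.
exact: cs_mul0r.
Qed.

Lemma cs_mul_sumr (I : Type) (r : seq I) (P : pred I) (F : I -> A) a :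
  cs_mul a (\sum_(i <- r | P i) F i) = \sum_(i <- r | P i) cs_mul a (F i).
Proof.
apply: (big_morph (fun x => cs_mul a x)) => [x y|]; first exact: cs_mulDr.
exact: cs_mulr0.
Qed.

Lemma cs_star_sum (I : Type) (r : seq I) (P : pred I) (F : I -> A) :
  cs_star (\sum_(i <- r | P i) F i) = \sum_(i <- r | P i) cs_star (F i).
Proof.
apply: (big_morph (fun x => cs_star x)) => [x y|]; first exact: cs_starD.
exact: cs_star0.
Qed.

Lemma nrmM a b : nrm (cs_mul a b) <= nrm a * nrm b.
Proof. by have := cs_normM a b; rewrite !nrmE -rmorphM /= lecR. Qed.

Lemma nrmC a : nrm (cs_mul (cs_star a) a) = nrm a ^+ 2.
Proof.
have := cs_normC a; rewrite !nrmE -rmorphXn /= => h.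
by move: (congr1 (@complex.Re R) h).
Qed.

Lemma nrm_star a : nrm (cs_star a) = nrm a.
Proof.
suff le b : nrm b <= nrm (cs_star b).
  by apply/eqP; rewrite eq_le le -{2}[a]cs_starK le.
have := nrmM (cs_star b) b; rewrite nrmC expr2.
by have [->|b0] := eqVneq (nrm b) 0; rewrite ?nrm_ge0// ler_pM2r// lt_def b0
  nrm_ge0.
Qed.

Lemma cs_starB a b : cs_star (a - b) = cs_star a - cs_star b.
Proof. by apply: (addIr (cs_star b)); rewrite -cs_starD !subrK. Qed.

Lemma tends_star u a : tends u a -> tends (fun n => cs_star (u n)) (cs_star a).
Proof.
by move=> ua e /ua[N NP]; exists N => n /NP; rewrite -cs_starB nrm_star.
Qed.

Lemma tendsM u v a b : tends u a -> tends v b ->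
  tends (fun n => cs_mul (u n) (v n)) (cs_mul a b).
Proof.
move=> ua vb e e0.
have [M MP] := ncauchy_bounded (tends_ncauchy vb).
pose K := nrm a + `|M| + 1.
have K0 : 0 < K by rewrite /K ltr_wpDl// addr_ge0 ?nrm_ge0.
have e2 : 0 < e / 2 / K by rewrite !divr_gt0.
have [N NP] := ua _ e2; have [N' NP'] := vb _ e2.
exists (maxn N N') => n; rewrite geq_max => /andP[/NP un /NP' vn].
have -> : cs_mul (u n) (v n) - cs_mul a b =
    cs_mul (u n - a) (v n) + cs_mul a (v n - b).
  by rewrite cs_mulDl cs_mulDr cs_mulNr cs_mulrN addrA subrK.
apply: le_trans (nrmD _ _) _; rewrite (splitr e) lerD//.
  apply: le_trans (nrmM _ _) _; rewrite -[leRHS](divfK (lt0r_neq0 K0)).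
  apply: ler_pM => //; rewrite ?nrm_ge0//.
  apply: le_trans (MP n) _; apply: le_trans (ler_norm M) _.
  by rewrite /K; have := nrm_ge0 a; lra.
apply: le_trans (nrmM _ _) _; rewrite -[leRHS](divfK (lt0r_neq0 K0)) mulrC.
apply: ler_pM => //; rewrite ?nrm_ge0//.
by rewrite /K; have := normr_ge0 M; lra.
Qed.

End CStarBasics.

Section StarHom.
Variables (R : realType) (A B : cstarType R) (f : A -> B).
Hypothesis fhom : star_hom f.

Lemma star_homD a b : f (a + b) = f a + f b.
Proof. by case: fhom => h _ _ _; have := h 1 a b; rewrite !scale1r. Qed.

Lemma star_hom0 : f 0 = 0.
Proof. by apply: (addrI (f 0)); rewrite -star_homD !addr0. Qed.

Lemma star_homZ c a : f (c *: a) = c *: f a.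
Proof. by case: fhom => h _ _ _; have := h c a 0; rewrite star_hom0 !addr0. Qed.

Lemma star_homM a b : f (cs_mul a b) = cs_mul (f a) (f b).
Proof. by case: fhom. Qed.

Lemma star_hom_star a : f (cs_star a) = cs_star (f a).
Proof. by case: fhom. Qed.

Lemma star_hom_sum (I : Type) (r : seq I) (P : pred I) (F : I -> A) :
  f (\sum_(i <- r | P i) F i) = \sum_(i <- r | P i) f (F i).
Proof. by apply: big_morph; [exact: star_homD|exact: star_hom0]. Qed.

Lemma star_hom_tends u a : tends u a -> tends (fun n => f (u n)) (f a).
Proof.
move=> /tendsP ua; apply/tendsP; case: fhom => _ _ _ fc.
by apply: continuous_cvg => //; exact: fc.
Qed.

End StarHom.

(** * The universal algebra of Cuntz families *)

Lemma lipschitz1_continuous (R : realType) (A B : normedModType (cplx R)) (f :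
  A -> B) :
  (forall x y, nrm (f x - f y) <= nrm (x - y)) -> continuous f.
Proof.
move=> fl x; apply/cvgrPdist_le => e e0; apply/nbhs_ballP; exists e => //= y.
by rewrite -ball_normE /= => /ltW; apply: le_trans; rewrite nrm_le.
Qed.

(* The generator None stands for a projection, which is a unit for the        *)
(* others but need not be a unit of B.                                        *)
Definition corner_family (R : realType) (E : finType) (B : cstarType R)
    (b : option E -> B) : Prop :=
  [/\ cs_star (b None) = b None,
      forall i, cs_mul (b None) (b i) = b i,
      forall i, cs_mul (b i) (b None) = b i,
      forall e f, cs_mul (cs_star (b (Some e))) (b (Some f)) =
        if e == f then b None else 0 &
      \sum_e cs_mul (b (Some e)) (cs_star (b (Some e))) = b None].

Section CuntzTerms.
Variables (R : realType) (E : finType).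
Local Notation C := (cplx R).

(** Formal terms keep the carrier of the universal algebra a fixed type; the C*-algebras in which
    they are evaluated are quantified over inside propositions only. *)
Inductive cterm :=
| Cgen of option E | Czero | Cadd of cterm & cterm | Cscale of C & cterm
| Cmul of cterm & cterm | Cstar of cterm.

Section Eval.
Variables (B : cstarType R) (b : option E -> B).

Fixpoint ceval (t : cterm) : B := match t with
  | Cgen i => b i
  | Czero => 0
  | Cadd t1 t2 => ceval t1 + ceval t2
  | Cscale c t1 => c *: ceval t1
  | Cmul t1 t2 => cs_mul (ceval t1) (ceval t2)
  | Cstar t1 => cs_star (ceval t1)
  end.

Hypothesis fam : corner_family b.

Lemma corner_nrm i : nrm (b i) <= 1.
Proof.
case: fam => b1 b2 _ b3 _.
have b0 : nrm (b None) <= 1.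
  have := nrmC (b None); rewrite b1 b2 expr2 => h.
  rewrite leNgt; apply/negP => h1; have := nrm_ge0 (b None); nra.
case: i => // e; have := nrmC (b (Some e)); rewrite b3 eqxx => h.
by rewrite -(expr_le1 (n := 2))// ?nrm_ge0// -h.
Qed.

(** The unit property passes from the generators to all terms. This is why u becomes a unit of the
    completion ([cuntz_unit]), although it need not be one in B. *)
Lemma ceval_unit t :
  cs_mul (b None) (ceval t) = ceval t /\ cs_mul (ceval t) (b None) = ceval t.
Proof.
case: fam => b1 b2 b2' b3 _.
elim: t => [i||s [s1 s2] t [t1 t2]|c t [t1 t2]|s [s1 s2] t [t1 t2]|t [t1 t2]]
  /=.
- by [].
- by rewrite cs_mul0r cs_mulr0.
- by rewrite cs_mulDr cs_mulDl s1 s2 t1 t2.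
- by rewrite -cs_scaleAr -cs_scaleAl t1 t2.
- by rewrite cs_mulA s1 -cs_mulA t2.
- by split; rewrite -{1}b1 -cs_starM ?t1 ?t2.
Qed.

End Eval.

(** The bound is uniform in the algebra and the family, because the generators are contractions in
    all of them. Hence the supremum of the seminorms is finite. *)
Lemma ceval_bounded t : exists M, forall (B : cstarType R) (b : option E -> B),
  corner_family b -> nrm (ceval b t) <= M.
Proof.
elim: t => [i||s [M MP] t [N NP]|c t [M MP]|s [M MP] t [N NP]|t [M MP]] /=.
- by exists 1 => B b fb; exact: (corner_nrm fb i).
- by exists 0 => B b _; rewrite nrm0.
- exists (M + N) => B b fb; apply: le_trans (nrmD _ _) _.
  by rewrite lerD ?MP ?NP.
- by exists (nrm c * M) => B b fb; rewrite nrmZ ler_wpM2l ?nrm_ge0 ?MP.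
- exists (M * N) => B b fb; apply: le_trans (nrmM _ _) _.
  by rewrite ler_pM ?nrm_ge0 ?MP ?NP.
- by exists M => B b fb; rewrite nrm_star MP.
Qed.

Definition ucauchy (u : nat -> cterm) : Prop := forall e : R, 0 < e ->
  exists N, forall m n, (N <= m)%N -> (N <= n)%N ->
    forall (B : cstarType R) (b : option E -> B), corner_family b ->
      nrm (ceval b (u m) - ceval b (u n)) <= e.

Lemma ucauchy_bounded u : ucauchy u -> exists M, forall n (B : cstarType R)
  (b : option E -> B), corner_family b -> nrm (ceval b (u n)) <= M.
Proof.
move=> /(_ 1 ltr01)[N NP]; have [M MP] := choice (fun n => ceval_bounded (u n)).
exists (\sum_(i < N.+1) `|M i| + 1) => n B b fb.
have hs i : (i <= N)%N -> nrm (ceval b (u i)) <= \sum_(i < N.+1) `|M i|.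
  move=> iN; rewrite (bigD1 (inord i))//= inordK ?ltnS//.
  apply: le_trans (MP i B b fb) _; apply: le_trans (ler_norm _) _.
  by rewrite lerDl; apply: sumr_ge0 => *; exact: normr_ge0.
case: (leqP n N) => nN; first by apply: le_trans (hs _ nN) _; lra.
rewrite -[ceval b (u n)](subrK (ceval b (u N))) addrC.
apply: le_trans (nrmD _ _) _.
by rewrite lerD ?hs// NP// ltnW.
Qed.

Record cseq := CSeq { cseq_val :> nat -> cterm; _ : ucauchy cseq_val }.
HB.instance Definition _ := gen_eqMixin cseq.
HB.instance Definition _ := gen_choiceMixin cseq.

Lemma cseqP (u : cseq) : ucauchy u. Proof. by case: u. Qed.

Definition clim (B : cstarType R) (b : option E -> B) (u : cseq) : B :=
  xget 0 [set l | tends (fun n => ceval b (u n)) l].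

Lemma climP (B : cstarType R) (b : option E -> B) (u : cseq) :
  corner_family b -> tends (fun n => ceval b (u n)) (clim b u).
Proof.
move=> fb; rewrite /clim; case: xgetP => // nol.
have [l ul] : exists l, tends (fun n => ceval b (u n)) l.
  apply: ncauchyP => e e0; have [N NP] := cseqP u e0.
  by exists N => m n Nm Nn; exact: NP.
by case: (nol l).
Qed.

Definition cseq_eqb (u v : cseq) : bool :=
  `[< forall (B : cstarType R) (b : option E -> B), corner_family b ->
        clim b u = clim b v >].

Lemma cseq_eqb_refl : reflexive cseq_eqb.
Proof. by move=> u; apply/asboolP. Qed.

Lemma cseq_eqb_sym : symmetric cseq_eqb.
Proof.
by move=> u v; apply/asboolP/asboolP => uv B b fb; rewrite uv.
Qed.

Lemma cseq_eqb_trans : transitive cseq_eqb.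
Proof.
by move=> v u t /asboolP uv /asboolP vt; apply/asboolP => B b fb;
  rewrite uv// vt.
Qed.

Canonical cseq_equiv :=
  EquivRel cseq_eqb cseq_eqb_refl cseq_eqb_sym cseq_eqb_trans.

(* The C*-completion of the terms for the supremum of the seminorms given by  *)
(* all corner families in all C*-algebras.                                    *)
Definition cuntz := {eq_quot cseq_equiv}%qT.
HB.instance Definition _ := Choice.on cuntz.

Definition cev (B : cstarType R) (b : option E -> B) (a : cuntz) : B :=
  clim b (repr a)%qT.

Lemma cuntz_ext (a a' : cuntz) :
  (forall (B : cstarType R) (b : option E -> B), corner_family b ->
     cev b a = cev b a') -> a = a'.
Proof.
move=> aa'; rewrite -(reprK a) -(reprK a').
by apply/eqmodP/asboolP => B b fb; exact: aa'.
Qed.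

Lemma cuntz_lim (u : nat -> cterm) : ucauchy u ->
  exists a : cuntz, forall (B : cstarType R) (b : option E ->
    B), corner_family b ->
    tends (fun n => ceval b (u n)) (cev b a).
Proof.
move=> cu; exists (\pi_(cuntz) (CSeq cu))%qT => B b fb.
rewrite /cev.
have /eqmodP/asboolP/(_ B b fb) -> : (repr (\pi_(cuntz) (CSeq cu)) =
  CSeq cu %[mod cuntz])%qT.
  by rewrite reprK.
exact: (climP (CSeq cu)).
Qed.

Lemma cuntz_seq (a : cuntz) : exists2 u, ucauchy u &
  forall (B : cstarType R) (b : option E -> B), corner_family b ->
    tends (fun n => ceval b (u n)) (cev b a).
Proof. by exists (repr a)%qT; [exact: cseqP|move=> B b; exact: climP]. Qed.

Lemma cuntz_term (t : cterm) : exists a : cuntz,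
  forall (B : cstarType R) (b : option E -> B), corner_family b ->
    cev b a = ceval b t.
Proof.
have [|a aP] := @cuntz_lim (fun=> t).
  by move=> e e0; exists 0%N => m n _ _ B b _; rewrite subrr nrm0 ltW.
by exists a => B b fb; apply: tends_unique (aP B b fb) _; exact: tends_cst.
Qed.

Lemma cuntz_add_ex (a a' : cuntz) : exists c : cuntz,
  forall (B : cstarType R) (b : option E -> B), corner_family b ->
    cev b c = cev b a + cev b a'.
Proof.
have [u cu ua] := cuntz_seq a; have [v cv va] := cuntz_seq a'.
have [|c cP] := @cuntz_lim (fun n => Cadd (u n) (v n)).
  move=> e e0; have e2 : 0 < e / 2 by rewrite divr_gt0.
  have [N NP] := cu _ e2; have [M MP] := cv _ e2.
  exists (maxn N M) => m n; rewrite !geq_max => /andP[Nm Mm] /andP[Nn Mn] B b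
    fb.
  rewrite /= opprD addrACA (splitr e); apply: le_trans (nrmD _ _) _.
  by rewrite lerD ?NP ?MP.
exists c => B b fb; apply: tends_unique (cP B b fb) _.
by apply: tendsD; [exact: ua|exact: va].
Qed.

Lemma cuntz_scale_ex (k : C) (a : cuntz) : exists c : cuntz,
  forall (B : cstarType R) (b : option E -> B), corner_family b ->
    cev b c = k *: cev b a.
Proof.
have [u cu ua] := cuntz_seq a.
have [|c cP] := @cuntz_lim (fun n => Cscale k (u n)).
  move=> e e0; have k0 : 0 < nrm k + 1 by rewrite ltr_wpDl ?nrm_ge0.
  have [N NP] := cu (e / (nrm k + 1)) (divr_gt0 e0 k0).
  exists N => m n Nm Nn B b fb; rewrite /= -scalerBr nrmZ.
  have := NP m n Nm Nn B b fb; rewrite ler_pdivlMr// => h.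
  by apply: le_trans h; rewrite mulrC ler_wpM2l ?nrm_ge0//; lra.
exists c => B b fb; apply: tends_unique (cP B b fb) _.
by apply: tendsZ; exact: ua.
Qed.

Lemma cuntz_star_ex (a : cuntz) : exists c : cuntz,
  forall (B : cstarType R) (b : option E -> B), corner_family b ->
    cev b c = cs_star (cev b a).
Proof.
have [u cu ua] := cuntz_seq a.
have [|c cP] := @cuntz_lim (fun n => Cstar (u n)).
  move=> e /cu[N NP]; exists N => m n Nm Nn B b fb /=.
  by rewrite -cs_starB nrm_star NP.
exists c => B b fb; apply: tends_unique (cP B b fb) _.
by apply: tends_star; exact: ua.
Qed.

Lemma cuntz_mul_ex (a a' : cuntz) : exists c : cuntz,
  forall (B : cstarType R) (b : option E -> B), corner_family b ->
    cev b c = cs_mul (cev b a) (cev b a').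
Proof.
have [u cu ua] := cuntz_seq a; have [v cv va] := cuntz_seq a'.
have [|c cP] := @cuntz_lim (fun n => Cmul (u n) (v n)).
  move=> e e0; have [M MP] := ucauchy_bounded cu;
    have [M' MP'] := ucauchy_bounded cv.
  pose K := `|M| + `|M'| + 1.
  have K0 : 0 < K by rewrite /K ltr_wpDl// addr_ge0.
  have MK : M <= K by have := ler_norm M; have := normr_ge0 M'; rewrite /K; lra.
  have MK' : M' <= K by have := ler_norm M'; have := normr_ge0 M; rewrite /K;
    lra.
  have e2 : 0 < e / 2 / K by rewrite !divr_gt0.
  have [N NP] := cu _ e2; have [N' NP'] := cv _ e2.
  exists (maxn N N') => m n; rewrite !geq_max => /andP[Nm Mm] /andP[Nn Mn] B b
    fb /=.
  set x := ceval b (u m); set y := ceval b (u n).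
  set x' := ceval b (v m); set y' := ceval b (v n).
  have -> : cs_mul x x' - cs_mul y y' = cs_mul (x - y) x' + cs_mul y (x' - y').
    by rewrite cs_mulDl cs_mulDr cs_mulNr cs_mulrN addrA subrK.
  apply: le_trans (nrmD _ _) _; rewrite (splitr e) lerD//.
    apply: le_trans (nrmM _ _) _; rewrite -[leRHS](divfK (lt0r_neq0 K0)).
    apply: ler_pM; rewrite ?nrm_ge0 ?NP//.
    by apply: le_trans (MP' _ B b fb) MK'.
  apply: le_trans (nrmM _ _) _; rewrite -[leRHS](divfK (lt0r_neq0 K0)) mulrC.
  apply: ler_pM; rewrite ?nrm_ge0 ?NP'//.
  by apply: le_trans (MP _ B b fb) MK.
exists c => B b fb; apply: tends_unique (cP B b fb) _.
by apply: tendsM; [exact: ua|exact: va].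
Qed.

Definition cuntz_gen (i : option E) : cuntz := projT1 (cid (cuntz_term (Cgen
  i))).
Definition cuntz_zero : cuntz := projT1 (cid (cuntz_term Czero)).
Definition cuntz_add a a' : cuntz := projT1 (cid (cuntz_add_ex a a')).
Definition cuntz_scale k a : cuntz := projT1 (cid (cuntz_scale_ex k a)).
Definition cuntz_mul a a' : cuntz := projT1 (cid (cuntz_mul_ex a a')).
Definition cuntz_star a : cuntz := projT1 (cid (cuntz_star_ex a)).
Definition cuntz_opp a : cuntz := cuntz_scale (-1) a.

Section Cev.
Variables (B : cstarType R) (b : option E -> B).
Hypothesis fb : corner_family b.

Lemma cev_gen i : cev b (cuntz_gen i) = b i.
Proof. by rewrite /cuntz_gen; case: cid => c /= ->. Qed.
Lemma cev_zero : cev b cuntz_zero = 0.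
Proof. by rewrite /cuntz_zero; case: cid => c /= ->. Qed.
Lemma cev_add a a' : cev b (cuntz_add a a') = cev b a + cev b a'.
Proof. by rewrite /cuntz_add; case: cid => c /= ->. Qed.
Lemma cev_scale k a : cev b (cuntz_scale k a) = k *: cev b a.
Proof. by rewrite /cuntz_scale; case: cid => c /= ->. Qed.
Lemma cev_mul a a' : cev b (cuntz_mul a a') = cs_mul (cev b a) (cev b a').
Proof. by rewrite /cuntz_mul; case: cid => c /= ->. Qed.
Lemma cev_star a : cev b (cuntz_star a) = cs_star (cev b a).
Proof. by rewrite /cuntz_star; case: cid => c /= ->. Qed.
Lemma cev_opp a : cev b (cuntz_opp a) = - cev b a.
Proof. by rewrite cev_scale scaleN1r. Qed.

End Cev.

Let cevE := (cev_zero, cev_add, cev_scale, cev_mul, cev_star, cev_opp, cev_gen).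

Lemma cuntz_addA : associative cuntz_add.
Proof. by move=> a b c; apply: cuntz_ext => B s fs; rewrite !cevE// addrA. Qed.
Lemma cuntz_addC : commutative cuntz_add.
Proof. by move=> a b; apply: cuntz_ext => B s fs; rewrite !cevE// addrC. Qed.
Lemma cuntz_add0 : left_id cuntz_zero cuntz_add.
Proof. by move=> a; apply: cuntz_ext => B s fs; rewrite !cevE// add0r. Qed.
Lemma cuntz_addN : left_inverse cuntz_zero cuntz_opp cuntz_add.
Proof. by move=> a; apply: cuntz_ext => B s fs; rewrite !cevE// addNr. Qed.

HB.instance Definition _ := GRing.isZmodule.Build cuntz
  cuntz_addA cuntz_addC cuntz_add0 cuntz_addN.

Lemma cuntz_scaleA (k l : C) (a : cuntz) :
  cuntz_scale k (cuntz_scale l a) = cuntz_scale (k * l) a.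
Proof. by apply: cuntz_ext => B s fs; rewrite !cevE// scalerA. Qed.
Lemma cuntz_scale1 : left_id 1 cuntz_scale.
Proof. by move=> a; apply: cuntz_ext => B s fs; rewrite !cevE// scale1r. Qed.
Lemma cuntz_scaleDr : right_distributive cuntz_scale +%R.
Proof. by move=> k a b; apply: cuntz_ext => B s fs;
  rewrite !cevE// scalerDr. Qed.
Lemma cuntz_scaleDl (a : cuntz) : {morph cuntz_scale^~ a : k l / k + l}.
Proof. by move=> k l; apply: cuntz_ext => B s fs; rewrite !cevE// scalerDl. Qed.

HB.instance Definition _ := GRing.Zmodule_isLmodule.Build C cuntz
  cuntz_scaleA cuntz_scale1 cuntz_scaleDr cuntz_scaleDl.

(** Including the value 0 makes the set visibly nonempty and its supremum nonnegative. *)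
Definition cuntz_seminorms (a : cuntz) : set R := [set r | r = 0 \/
  exists (B : cstarType R) (b : option E -> B), corner_family b /\
    r = nrm (cev b a)].

Definition cuntz_nrm (a : cuntz) : R := sup (cuntz_seminorms a).

Lemma cuntz_seminorms_bounded a : has_sup (cuntz_seminorms a).
Proof.
split; first by exists 0; left.
have [u cu ua] := cuntz_seq a; have [M MP] := ucauchy_bounded cu.
exists `|M| => r [->|[B [b [fb ->]]]]; first exact: normr_ge0.
apply: le_trans (ler_norm M).
by apply: tends_le (ua B b fb) _ => n; exact: MP.
Qed.

Lemma cev_le (B : cstarType R) (b : option E -> B) a :
  corner_family b -> nrm (cev b a) <= cuntz_nrm a.
Proof.
move=> fb; apply: ub_le_sup; last by right; exists B, b.
by case: (cuntz_seminorms_bounded a).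
Qed.

Lemma cuntz_nrm_ge0 a : 0 <= cuntz_nrm a.
Proof. by apply: ub_le_sup; [case: (cuntz_seminorms_bounded a)|left]. Qed.

Lemma cuntz_nrm_le a M : 0 <= M ->
  (forall (B : cstarType R) (b : option E -> B), corner_family b ->
     nrm (cev b a) <= M) -> cuntz_nrm a <= M.
Proof.
move=> M0 aM; apply: ge_sup; first by exists 0; left.
by move=> r [->//|[B [b [fb ->]]]]; exact: aM.
Qed.

Lemma cuntz_nrmD a a' : cuntz_nrm (a + a') <= cuntz_nrm a + cuntz_nrm a'.
Proof.
apply: cuntz_nrm_le => [|B b fb]; first by rewrite addr_ge0 ?cuntz_nrm_ge0.
by rewrite cevE//; apply: le_trans (nrmD _ _) _; rewrite lerD ?cev_le.
Qed.

Lemma cuntz_nrmZ_le (k : C) a : cuntz_nrm (k *: a) <= nrm k * cuntz_nrm a.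
Proof.
apply: cuntz_nrm_le => [|B b fb]; first by rewrite mulr_ge0 ?nrm_ge0
  ?cuntz_nrm_ge0.
by rewrite cevE// nrmZ ler_wpM2l ?nrm_ge0 ?cev_le.
Qed.

Lemma cuntz_nrmZ (k : C) a : cuntz_nrm (k *: a) = nrm k * cuntz_nrm a.
Proof.
apply/eqP; rewrite eq_le cuntz_nrmZ_le /=.
have [->|k0] := eqVneq k 0; first by rewrite nrm0 mul0r cuntz_nrm_ge0.
have nk : 0 < nrm k.
  by rewrite lt_def nrm_ge0 andbT; apply: contra k0 => /eqP/nrm0_eq0 ->.
rewrite -ler_pdivlMl// -{1}[a]scale1r -(mulVf k0) -scalerA.
apply: le_trans (cuntz_nrmZ_le _ _) _; rewrite ler_wpM2r ?cuntz_nrm_ge0//.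
have : nrm (k^-1 * k) = nrm k^-1 * nrm k by exact: (nrmZ (A := C^o)).
rewrite mulVf// /nrm normr1 /= -/(nrm k) -/(nrm k^-1) => h.
by rewrite -[leRHS]mulr1 ler_pdivlMl// mulrC -h.
Qed.

Lemma cuntz_nrm_eq0 a : cuntz_nrm a = 0 -> a = 0.
Proof.
move=> a0; apply: cuntz_ext => B b fb; rewrite cev_zero//.
by apply/nrm0_eq0/eqP; rewrite eq_le nrm_ge0 andbT -a0 cev_le.
Qed.

Local Lemma cuntz_normD (a a' : cuntz) :
  ((cuntz_nrm (a + a'))%:C%C : C) <= (cuntz_nrm a)%:C%C + (cuntz_nrm a')%:C%C.
Proof. by rewrite -rmorphD /= lecR cuntz_nrmD. Qed.
Local Lemma cuntz_normZ (k : C) (a : cuntz) :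
  ((cuntz_nrm (k *: a))%:C%C : C) = `|k| * (cuntz_nrm a)%:C%C.
Proof. by rewrite nrmE -rmorphM cuntz_nrmZ. Qed.
Local Lemma cuntz_norm_eq0 (a : cuntz) : ((cuntz_nrm a)%:C%C : C) = 0 -> a = 0.
Proof. by move=> h; apply: cuntz_nrm_eq0; move: (congr1 (@complex.Re R) h). Qed.

HB.instance Definition _ := Lmodule_isNormed.Build C cuntz
  cuntz_normD cuntz_normZ cuntz_norm_eq0.

End CuntzTerms.

(** * Completeness, C*-structure and universality of the completion *)

Section CuntzCStar.
Variables (R : realType) (E : finType).
Local Notation C := (cplx R).
Local Notation cuntz := (cuntz R E).

Definition cuntz_of (t : cterm R E) : cuntz := projT1 (cid (cuntz_term t)).

Lemma cev_of (B : cstarType R) (b : option E -> B) t :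
  corner_family b -> cev b (cuntz_of t) = ceval b t.
Proof. by move=> fb; rewrite /cuntz_of; case: cid => c /= ->. Qed.

Lemma cev_sub (B : cstarType R) (b : option E -> B) (a a' : cuntz) :
  corner_family b -> cev b (a - a') = cev b a - cev b a'.
Proof. by move=> fb; rewrite [LHS]cev_add// cev_opp. Qed.

Lemma cuntz_dense (a : cuntz) (e : R) : 0 < e ->
  exists t, nrm (a - cuntz_of t) <= e.
Proof.
move=> e0; have [u cu ua] := cuntz_seq a; have [N NP] := cu e e0.
exists (u N); apply: cuntz_nrm_le => [|B b fb]; first exact: ltW.
rewrite cev_sub// cev_of//.
have h : tends (fun n => ceval b (u (n + N)%N) - ceval b (u N)) (cev b a -
  ceval b (u N)).
  move=> d /(ua B b fb)[M MP]; exists M => n Mn.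
  by rewrite opprB addrA subrK MP// (leq_trans Mn)// leq_addr.
apply: tends_le h _ => n; exact: NP (leq_addl _ _) (leqnn _) B b fb.
Qed.

(** Choose balls of radius [d n] in F and approximate their centres by terms [q n]. The norm
    dominates each seminorm, so [q] is Cauchy uniformly over all families; thus it defines an
    element of the completion, and this is the limit of F. *)
Lemma cuntz_complete (F : set_system cuntz) : ProperFilter F -> cauchy F ->
  cvg F.
Proof.
move=> FF /cauchyP Fc.
have [d [d0 small]] := null_sequence R.
have /choice[x xP] : forall n, exists x : cuntz, F (ball x ((d n)%:C%C : C)).
  by move=> n; apply: Fc; rewrite real_complex_gt0.
have /choice[q qP] : forall n, exists t, nrm (x n - cuntz_of t) <= d n.
  by move=> n; exact: cuntz_dense.
have ballE y (r : R) z : ball y (r%:C%C : C) z -> nrm (y - z) <= r.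
  by rewrite -ball_normE /= nrmE ltcR => /ltW.
have xx m n : nrm (x m - x n) <= d m + d n.
  have [z [/ballE zm /ballE zn]] := filter_ex (filterI (xP m) (xP n)).
  apply: le_trans (nrm_triangle z _ _) _; apply: lerD; first exact: zm.
  by rewrite nrmB; exact: zn.
have qq m n : nrm (cuntz_of (q m) - cuntz_of (q n)) <= d m *+ 2 + d n *+ 2.
  apply: le_trans (nrm_triangle (x m) _ _) _.
  rewrite nrmB mulr2n -addrA; apply: lerD; first exact: qP.
  apply: le_trans (nrm_triangle (x n) _ _) _.
  by rewrite mulr2n addrA; apply: lerD; [exact: xx|exact: qP].
have cq : ucauchy q.
  move=> e e0; have [N NP] := small (e / 4) (divr_gt0 e0 (ltr0Sn _ 3)).
  exists N => m n /NP Nm /NP Nn B b fb.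
  rewrite -!cev_of// -cev_sub//; apply: le_trans (cev_le _ fb) _.
  apply: le_trans (qq m n) _; rewrite !mulr2n; lra.
have [a aP] := cuntz_lim cq.
have aq n : nrm (a - cuntz_of (q n)) <= d n *+ 2.
  apply: cuntz_nrm_le => [|B b fb]; first by rewrite mulrn_wge0// ltW// d0.
  rewrite cev_sub// cev_of// nrmB.
  apply/ler_addgt0Pr => e e0; have [N NP] := small (e / 4) (divr_gt0 e0 (ltr0Sn
    _ 3)).
  have [N' NP'] := aP B b fb (e / 2) (divr_gt0 e0 (ltr0Sn _ 1)).
  apply: le_trans (nrm_triangle (ceval b (q (maxn N N'))) _ _) _.
  have h1 := NP' _ (leq_maxr N N'); have h2 := NP _ (leq_maxl N N').
  have h3 := le_trans (cev_le _ fb) (qq n (maxn N N')).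
  rewrite cev_sub// !cev_of// in h3.
  apply: le_trans (lerD h3 h1) _; lra.
apply/cvg_ex; exists a; apply/cvg_ballP => _ /gt0_complexP[e e0 ->].
have [N NP] := small (e / 5) (divr_gt0 e0 (ltr0Sn _ 4)).
apply: filterS (xP N) => z /ballE zN.
rewrite -ball_normE /= nrmE ltcR.
have h := NP N (leqnn N); have h1 := aq N; have h2 := qP N.
apply: le_lt_trans (nrm_triangle (cuntz_of (q N)) _ _) _.
rewrite nrmB in h2.
have h3 := le_trans (nrm_triangle (x N) (cuntz_of (q N)) z) (lerD h2 zN).
apply: le_lt_trans (lerD h1 h3) _; rewrite mulr2n.
by clear -h e0; lra.
Qed.

HB.instance Definition _ := Uniform_isComplete.Build cuntz cuntz_complete.

Let cevE := (cev_zero, cev_add, cev_scale, cev_mul, cev_star, cev_opp, cev_gen).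

Lemma cuntz_mulA : associative (@cuntz_mul R E).
Proof. by move=> a b c; apply: cuntz_ext => B s fs;
  rewrite !cevE// cs_mulA. Qed.
Lemma cuntz_mulDl : left_distributive (@cuntz_mul R E) +%R.
Proof. by move=> a b c; apply: cuntz_ext => B s fs;
  rewrite !cevE// cs_mulDl. Qed.
Lemma cuntz_mulDr : right_distributive (@cuntz_mul R E) +%R.
Proof. by move=> a b c; apply: cuntz_ext => B s fs;
  rewrite !cevE// cs_mulDr. Qed.
Lemma cuntz_scaleAl (c : C) (a b : cuntz) : c *: cuntz_mul a b =
  cuntz_mul (c *: a) b.
Proof. by apply: cuntz_ext => B s fs; rewrite !cevE// cs_scaleAl. Qed.
Lemma cuntz_scaleAr (c : C) (a b : cuntz) : c *: cuntz_mul a b =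
  cuntz_mul a (c *: b).
Proof. by apply: cuntz_ext => B s fs; rewrite !cevE// cs_scaleAr. Qed.
Lemma cuntz_starK : involutive (@cuntz_star R E).
Proof. by move=> a; apply: cuntz_ext => B s fs; rewrite !cevE// cs_starK. Qed.
Lemma cuntz_starD : {morph (@cuntz_star R E) : a b / a + b}.
Proof. by move=> a b; apply: cuntz_ext => B s fs; rewrite !cevE// cs_starD. Qed.
Lemma cuntz_starZ (c : C) (a : cuntz) : cuntz_star (c *: a) =
  c^* *: cuntz_star a.
Proof. by apply: cuntz_ext => B s fs; rewrite !cevE// cs_starZ. Qed.
Lemma cuntz_starM (a b : cuntz) :
  cuntz_star (cuntz_mul a b) = cuntz_mul (cuntz_star b) (cuntz_star a).
Proof. by apply: cuntz_ext => B s fs; rewrite !cevE// cs_starM. Qed.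

Lemma cuntz_normM (a b : cuntz) : `|cuntz_mul a b| <= `|a| * `|b| :> C.
Proof.
rewrite !nrmE -rmorphM /= lecR; apply: cuntz_nrm_le => [|B s fs].
  by rewrite mulr_ge0 ?nrm_ge0.
by rewrite cevE//; apply: le_trans (nrmM _ _) _;
  rewrite ler_pM ?nrm_ge0 ?cev_le.
Qed.

(** The C*-identity holds in every representation and survives the supremum. For the lower bound,
    the norm of each image of a is compared with the square root of the norm of a^* a. *)
Lemma cuntz_normC (a : cuntz) : `|cuntz_mul (cuntz_star a) a| = `|a| ^+ 2 :> C.
Proof.
rewrite !nrmE -rmorphXn /=; congr (_%:C)%C; apply/eqP; rewrite eq_le;
  apply/andP; split.
  apply: cuntz_nrm_le => [|B s fs]; first by rewrite exprn_ge0 ?nrm_ge0.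
  by rewrite !cevE// nrmC lerXn2r ?nnegrE ?nrm_ge0 ?cev_le.
set c := cuntz_mul _ _; have c0 : 0 <= nrm c := nrm_ge0 c.
rewrite -(sqr_sqrtr c0) lerXn2r ?nnegrE ?nrm_ge0 ?sqrtr_ge0//.
apply: cuntz_nrm_le => [|B s fs]; first exact: sqrtr_ge0.
rewrite -(ler_pXn2r (n := 2)) ?nnegrE ?nrm_ge0 ?sqrtr_ge0// sqr_sqrtr//.
by rewrite -nrmC -!cevE// cev_le.
Qed.

HB.instance Definition _ := isCStarAlgebra.Build R cuntz
  cuntz_mulA cuntz_mulDl cuntz_mulDr cuntz_scaleAl cuntz_scaleAr
  cuntz_starK cuntz_starD cuntz_starZ cuntz_starM cuntz_normM cuntz_normC.

Lemma cev_star_hom (B : cstarType R) (b : option E -> B) :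
  corner_family b -> star_hom (cev b : cuntz -> B).
Proof.
move=> fb; split=> [c x y|x y|x|].
- by rewrite [LHS]cev_add// [cev b (c *: x)]cev_scale.
- exact: cev_mul.
- exact: cev_star.
- by apply: lipschitz1_continuous => x y; rewrite -cev_sub//; exact: cev_le.
Qed.

Lemma cuntz_gen_corner : corner_family (@cuntz_gen R E).
Proof.
split=> [|i|i|e f|]; apply: cuntz_ext => B b fb.
- by rewrite [LHS]cev_star// !cev_gen//; case: fb.
- by rewrite [LHS]cev_mul// !cev_gen//; case: fb.
- by rewrite [LHS]cev_mul// !cev_gen//; case: fb.
- rewrite [LHS]cev_mul// [cev _ (cs_star _)]cev_star// !cev_gen//.
  have [_ _ _ -> _] := fb.
  case: eqP => _; first by rewrite cev_gen.
  by rewrite [RHS]cev_zero.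
- rewrite (star_hom_sum (cev_star_hom fb)).
  under eq_bigr do rewrite (star_homM (cev_star_hom fb)) (star_hom_star
    (cev_star_hom fb)) cev_gen//.
  by rewrite cev_gen//; case: fb.
Qed.

Lemma cuntz_unit : is_unit (@cuntz_gen R E None).
Proof.
move=> a; split; apply: cuntz_ext => B b fb; rewrite [LHS]cev_mul// cev_gen//.
  have [u cu /(_ B b fb) ua] := cuntz_seq a.
  apply: (tends_unique _ ua).
  apply: (tends_eventually (N := 0%N) _ (tendsM (tends_cst (b None)) ua)) => n
    _.
  by have [] := ceval_unit fb (u n).
have [u cu /(_ B b fb) ua] := cuntz_seq a.
apply: (tends_unique _ ua).
apply: (tends_eventually (N := 0%N) _ (tendsM ua (tends_cst (b None)))) => n _.
by have [] := ceval_unit fb (u n).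
Qed.

Lemma star_hom_ceval (B : cstarType R) (b : option E -> B) (f : cuntz -> B) t :
  star_hom f -> (forall i, f (cuntz_gen R i) = b i) ->
  f (ceval (@cuntz_gen R E) t) = ceval b t.
Proof.
move=> fh fb; elim: t => [i||s hs t ht|c t ht|s hs t ht|t ht] /=.
- exact: fb.
- exact: (star_hom0 fh).
- by rewrite (star_homD fh) hs ht.
- by rewrite (star_homZ fh) ht.
- by rewrite (star_homM fh) hs ht.
- by rewrite (star_hom_star fh) ht.
Qed.

Lemma cuntz_ofE t : cuntz_of t = ceval (@cuntz_gen R E) t.
Proof.
apply: cuntz_ext => B b fb; rewrite cev_of//; apply/esym.
by apply: star_hom_ceval; [exact: cev_star_hom|move=> i; exact: cev_gen].
Qed.

Lemma cuntz_hom_unique (B : cstarType R) (f g : cuntz -> B) :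
  star_hom f -> star_hom g -> (forall i, f (cuntz_gen R i) =
    g (cuntz_gen R i)) ->
  f = g.
Proof.
move=> fh gh fg; apply/funext => a.
have [d [d0 small]] := null_sequence R.
have /choice[t tP] : forall n, exists t, nrm (a - cuntz_of t) <= d n.
  by move=> n; exact: cuntz_dense.
have ta : tends (fun n => cuntz_of (t n)) a.
  move=> e /small[N NP]; exists N => n /NP dn.
  by rewrite nrmB; exact: le_trans (tP n) dn.
apply: tends_unique (star_hom_tends fh ta) _.
apply: (tends_eventually (N := 0%N) _ (star_hom_tends gh ta)) => n _.
by rewrite cuntz_ofE (star_hom_ceval _ gh (fun i => erefl)) (star_hom_ceval _
  fh fg).
Qed.

End CuntzCStar.

(** * Orthogonality of Cuntz isometries *)

(* The unit of a Banach algebra is an extreme point of the unit ball: if      *)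
(* |r + k| <= 1 and |r - k| <= 1, then N k is the expectation of S_N times    *)
(* the product of the N factors r + k and r - k chosen by a simple random     *)
(* walk S_N, hence N |k| <= E |S_N|, which is at most sqrt N.                 *)
Section UnitExtreme.
Variables (R : realType) (A : cstarType R) (r k : A).
Hypotheses (rr : cs_mul r r = r) (rk : cs_mul r k = k) (kr : cs_mul k r = k)
  (r1 : nrm r <= 1) (rDk : nrm (r + k) <= 1) (rBk : nrm (r - k) <= 1).
Local Notation C := (cplx R).

Let half : C := (2^-1 : R)%:C%C.

Fixpoint random_walk (n : nat) (g : R -> R) : A :=
  if n is n'.+1 then
    half *: (cs_mul (r + k) (random_walk n' (fun z => g (z + 1)))
             + cs_mul (r - k) (random_walk n' (fun z => g (z - 1))))
  else (g 0)%:C%C *: r.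

(** With X = a r + b n k, P = b r and Q = b k, the two shifted walks are X + P and X - P. In (r +
    k)(X + P) + (r - k)(X - P) the mixed terms cancel and 2 (r X + k P) = 2 (X + Q) remains, so each
    step adds b k. *)
Lemma random_walk_affine n (a b : R) :
  random_walk n (fun z => a + b * z) = a%:C%C *: r + (b * n%:R)%:C%C *: k.
Proof.
elim: n a => [|n ih] a /=.
  by rewrite !mulr0 addr0 rmorph0 scale0r addr0.
have -> : (fun z => a + b * (z + 1)) = (fun z => (a + b) + b * z).
  by apply/funext => z; ring.
have -> : (fun z => a + b * (z - 1)) = (fun z => (a - b) + b * z).
  by apply/funext => z; ring.
have -> : b * n.+1%:R = b * n%:R + b by rewrite -natr1; ring.
rewrite !ih rmorphD rmorphB rmorphD /= !scalerDl scaleNr.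
set P := b%:C%C *: r; set Q := b%:C%C *: k; set Y := (b * n%:R)%:C%C *: k.
rewrite addrAC [_ - P + Y]addrAC [in RHS]addrA; set X := _ + Y.
have rX : cs_mul r X = X by rewrite cs_mulDr -!cs_scaleAr rr rk.
have rP : cs_mul r P = P by rewrite -cs_scaleAr rr.
have kP : cs_mul k P = Q by rewrite -cs_scaleAr kr.
clearbody X P Q.
rewrite !cs_mulDl !cs_mulDr !cs_mulNr !cs_mulrN rX rP kP; set Z := cs_mul k X.
rewrite opprK addrACA [X + P + _]addrACA subrr addr0.
rewrite [Z + Q + _]addrACA subrr add0r [X + X + _]addrACA -mulr2n -scaler_nat
  scalerA.
rewrite (_ : half * 2%:R = 1) ?scale1r//.
by rewrite /half -(rmorph_nat (real_complex R)) -rmorphM /= mulVf ?rmorph1.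
Qed.

(** The average of (z + 1)^2 and (z - 1)^2 is z^2 + 1, so each step raises the constant term of the
    quadratic majorant by a. The linear coefficient c has to be free for the induction, but it
    averages out. *)
Lemma random_walk_le n (g : R -> R) (a b c : R) :
  (forall z, `|g z| <= a * z ^+ 2 + c * z + b) ->
  nrm (random_walk n g) <= a * n%:R + b.
Proof.
elim: n g b c => [|n ih] g b c gle /=.
  rewrite nrmZ nrm_real mulr0 add0r; have := gle 0.
  rewrite expr0n /= !mulr0 !add0r => h; apply: le_trans h.
  by rewrite ler_piMr.
rewrite nrmZ nrm_real ger0_norm//.
have h1 : nrm (random_walk n (fun z => g (z + 1))) <= a * n%:R + (a + c + b).
  by apply: (ih _ _ (c + 2 * a)) => z; apply: le_trans (gle _) _;
    rewrite le_eqVlt; apply/orP; left; apply/eqP; ring.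
have h2 : nrm (random_walk n (fun z => g (z - 1))) <= a * n%:R + (a - c + b).
  by apply: (ih _ _ (c - 2 * a)) => z; apply: le_trans (gle _) _;
    rewrite le_eqVlt; apply/orP; left; apply/eqP; ring.
rewrite mulrC ler_pdivrMr//; apply: le_trans (nrmD _ _) _.
have h3 : nrm (cs_mul (r + k) (random_walk n (fun z => g (z + 1)))) <= a * n%:R
  + (a + c + b).
  by apply: le_trans (nrmM _ _) _; apply: le_trans h1;
    rewrite ler_piMl// nrm_ge0.
have h4 : nrm (cs_mul (r - k) (random_walk n (fun z => g (z - 1)))) <= a * n%:R
  + (a - c + b).
  by apply: le_trans (nrmM _ _) _; apply: le_trans h2;
    rewrite ler_piMl// nrm_ge0.
by apply: le_trans (lerD h3 h4) _; rewrite -natr1 le_eqVlt; apply/orP; left;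
  apply/eqP; ring.
Qed.

Lemma unit_extreme : k = 0.
Proof.
apply/nrm0_eq0/small_eq0 => [|e e0]; first exact: nrm_ge0.
pose s := (Num.trunc e^-1).+1.
have s0 : 0 < s%:R :> R by rewrite ltr0n.
have se : (s%:R)^-1 <= e.
  rewrite -[e]invrK lef_pV2 ?posrE ?invr_gt0//.
  by rewrite ltW// truncnS_gt.
apply: le_trans se.
(* The majorant |z| <= z^2 / (2 s) + s / 2 is tangent at |z| = s. After s^2 steps it gives s^2 |k|
   <= s / 2 + s / 2 = s, hence |k| <= 1 / s. *)
have := random_walk_le (s ^ 2) (a := (2 * s%:R)^-1) (b := s%:R / 2) (c := 0)
  (g := fun z => 0 + 1 * z).
rewrite random_walk_affine rmorph0 scale0r add0r nrmZ nrm_real mul1r.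
rewrite ger0_norm ?ler0n// natrX => /(_ _)/wrap[|h].
  move=> z; rewrite add0r mul1r mul0r addr0 -subr_ge0.
  have -> : (2 * s%:R)^-1 * z ^+ 2 + s%:R / 2 - `|z| =
    (`|z| - s%:R) ^+ 2 / (2 * s%:R) :> R.
    by rewrite -(real_normK (num_real z)); field; exact: lt0r_neq0.
  by rewrite divr_ge0 ?sqr_ge0// mulr_ge0// ltW.
have : s%:R ^+ 2 * nrm k <= s%:R by apply: le_trans h _; rewrite le_eqVlt;
  apply/orP; left; apply/eqP; field; exact: lt0r_neq0.
by rewrite expr2 -mulrA -[leRHS]mulr1 ler_pM2l// mulrC -ler_pdivlMr// div1r.
Qed.

End UnitExtreme.

Lemma nrm_projection (R : realType) (A : cstarType R) (q : A) :
  cs_star q = q -> cs_mul q q = q -> nrm q <= 1.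
Proof.
move=> qs qq; have := nrmC q; rewrite qs qq expr2 => h.
by rewrite leNgt; apply/negP => h1; have := nrm_ge0 q; nra.
Qed.

Section CuntzOrthogonal.
Variables (R : realType) (A : cstarType R) (I : finType) (v : A) (s : I -> A).
Hypotheses (vu : is_unit v) (ss : forall i, cs_mul (cs_star (s i)) (s i) = v)
  (sum_ss : \sum_i cs_mul (s i) (cs_star (s i)) = v).
Local Notation C := (cplx R).
Local Notation "a ** b" := (cs_mul a b) (at level 40, left associativity).

Let vl a : v ** a = a. Proof. by have [] := vu a. Qed.
Let vr a : a ** v = a. Proof. by have [] := vu a. Qed.

Lemma unit_star : cs_star v = v.
Proof. by rewrite -{2}[v]cs_starK -[cs_star v in RHS]vl cs_starM cs_starK vl.
  Qed.

(* With p_e = s_e s_e^*, the sum of p_j p_e p_j over e != j vanishes, so the  *)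
(* unit p_j is an average of the contractions p_j - p_j p_e p_j, and          *)
(* extremality forces p_j p_e p_j = 0.                                        *)
Lemma cuntz_orthogonal i j : i != j -> cs_star (s i) ** s j = 0.
Proof.
move=> ij; pose p e := s e ** cs_star (s e).
have ps e : cs_star (p e) = p e by rewrite /p cs_starM cs_starK.
have pp e : p e ** p e = p e.
  by rewrite /p cs_mulA -(cs_mulA (s e)) ss vr.
have p1 e : nrm (p e) <= 1 by apply: nrm_projection.
have q1 e : nrm (v - p e) <= 1.
  apply: nrm_projection; first by rewrite cs_starB unit_star ps.
  by rewrite cs_mulDl vl cs_mulNr cs_mulDr vr cs_mulrN pp subrr oppr0 addr0.
pose y e := if e == j then 0 else p j ** p e ** p j.
have ysum : \sum_e y e = 0.
  have : \sum_e p j ** p e ** p j = p j.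
    by rewrite -cs_mul_suml -cs_mul_sumr sum_ss vr pp.
  rewrite (bigD1 j)//= !pp -[X in _ = X]addr0 => /addrI h.
  rewrite (bigD1 j)//= {1}/y eqxx add0r -[RHS]h.
  by apply: eq_bigr => e; rewrite /y => /negPf ->.
have c1 e : nrm (p j - y e) <= 1.
  rewrite /y; case: eqP => _; first by rewrite subr0.
  have -> : p j - p j ** p e ** p j = p j ** (v - p e) ** p j.
    by rewrite cs_mulDr vr cs_mulrN cs_mulDl pp cs_mulNr.
  apply: le_trans (nrmM _ _) _; apply: mulr_ile1; rewrite ?nrm_ge0//.
  by apply: le_trans (nrmM _ _) _; apply: mulr_ile1; rewrite ?nrm_ge0.
pose n := #|I|; have n0 : 0 < n%:R :> R by rewrite ltr0n; apply/card_gt0P;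
  exists i.
(* An average of n contractions [p j] and [p j - y e]. Taking for P the single index i yields p_j -
   k; taking all other indices yields p_j + k, because the sum of all [y e] is 0. *)
have avg (P : pred I) :
    nrm ((n%:R^-1)%:C%C *: \sum_e (p j - (if P e then y e else 0))) <= 1.
  rewrite nrmZ nrm_real ger0_norm ?invr_ge0 ?ler0n// ler_pdivrMl// mulr1.
  apply: le_trans (nrm_sum _ _ _) _.
  rewrite /n -sum1_card natr_sum; apply: ler_sum => e _.
  by case: (P e); rewrite ?subr0.
have nE : (n%:R^-1)%:C%C *: (p j *+ n) = p j :> A.
  rewrite -(scaler_nat n (p j)) scalerA -(rmorph_nat (real_complex R)) -rmorphM
    /=.
  by rewrite mulVf ?lt0r_neq0// rmorph1 scale1r.
pose k := (n%:R^-1)%:C%C *: y i.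
have yi : y i = p j ** p i ** p j by rewrite /y (negPf ij).
have k0 : k = 0.
  apply: (@unit_extreme R A (p j)) => //.
  - by rewrite /k -cs_scaleAr yi (cs_mulA (p j) (p j ** p i)) (cs_mulA (p j) (p
      j)) pp.
  - by rewrite /k -cs_scaleAl yi -(cs_mulA (p j ** p i) (p j)) pp.
  - have := avg [pred e | e != i]; rewrite sumrB sumr_const scalerBr.
    rewrite -big_mkcond /= -/n nE.
    move: ysum; rewrite (bigD1 i)//= => /eqP; rewrite addr_eq0 => /eqP h.
    by rewrite /k h scalerN.
  - have := avg [pred e | e == i]; rewrite sumrB sumr_const scalerBr.
    by rewrite -big_mkcond /= big_pred1_eq -/n nE.
have y0 : y i = 0.
  have : n%:R%:C%C *: k = y i.
    rewrite /k scalerA -rmorphM mulfV ?lt0r_neq0// rmorph1 scale1r//.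
  by rewrite k0 scaler0.
have pij : p i ** p j = 0.
  apply/nrm0_eq0/eqP; rewrite -sqrf_eq0 -nrmC cs_starM !ps.
  by rewrite (cs_mulA (p j ** p i) (p i)) -(cs_mulA (p j) (p i) (p i)) pp -yi
    y0 nrm0.
have -> : cs_star (s i) ** s j = cs_star (s i) ** (p i ** p j) ** s j.
  by rewrite /p !cs_mulA ss vl -!cs_mulA ss vr.
by rewrite pij cs_mulr0 cs_mul0r.
Qed.

End CuntzOrthogonal.

Lemma cuntz_family_corner (R : realType) (E : finType) (B : cstarType R) (v : B)
    (t : 'I_#|E| -> B) : cuntz_family v t ->
  corner_family (fun o => if o is Some e then t (enum_rank e) else v).
Proof.
move=> [vu ss sum_ss]; split.
- exact: unit_star.
- by move=> i; have [] := vu (if i is Some e then t (enum_rank e) else v).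
- by move=> i; have [] := vu (if i is Some e then t (enum_rank e) else v).
- move=> e f; case: eqP => [->|/eqP ef]; first exact: ss.
  by apply: (cuntz_orthogonal vu ss sum_ss); rewrite (inj_eq enum_rank_inj).
- rewrite -[RHS]sum_ss (reindex (@enum_rank E))//.
  by exists enum_val => x _; rewrite ?enum_rankK ?enum_valK.
Qed.

(** * Words in the generators of a corner family *)

Section CornerWords.
Variables (R : realType) (E : finType) (B : cstarType R) (b : option E -> B).
Hypothesis fb : corner_family b.
Local Notation "x ** y" := (cs_mul x y) (at level 40, left associativity).
Local Notation u := (b None).

Let ul i : u ** b i = b i. Proof. by case: fb. Qed.
Let ur i : b i ** u = b i. Proof. by case: fb. Qed.
Let us : cs_star u = u. Proof. by case: fb. Qed.
Let bb e f : cs_star (b (Some e)) ** b (Some f) = if e == f then u else 0.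
Proof. by case: fb. Qed.

Definition sword (al : seq E) : B := foldr (fun e x => b (Some e) ** x) u al.

Lemma sword_ur al : sword al ** u = sword al.
Proof. by elim: al => [|e al ih]; rewrite /= -?cs_mulA ?ul ?ih. Qed.

Lemma sword_ul al : u ** sword al = sword al.
Proof. by case: al => [|e al]; rewrite /= ?cs_mulA ?ul. Qed.

Lemma sword_star_ur al : cs_star (sword al) ** u = cs_star (sword al).
Proof. by rewrite -us -cs_starM sword_ul. Qed.

Lemma sword_star_ul al : u ** cs_star (sword al) = cs_star (sword al).
Proof. by rewrite -{1}us -cs_starM sword_ur. Qed.

Lemma sword_cat al be : sword (al ++ be) = sword al ** sword be.
Proof. by elim: al => [|e al ih] /=; rewrite ?sword_ul// ih cs_mulA. Qed.

Lemma sword_isometry al : cs_star (sword al) ** sword al = u.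
Proof.
elim: al => [|e al ih] /=; first by rewrite us ul.
rewrite cs_starM cs_mulA -(cs_mulA _ (cs_star _)) bb eqxx.
by rewrite sword_star_ur ih.
Qed.

Lemma sword_orthogonal al be : size al = size be -> al != be ->
  cs_star (sword al) ** sword be = 0.
Proof.
elim: al be => [|e al ih] [|f be] //= [sz] ne.
rewrite cs_starM cs_mulA -(cs_mulA _ (cs_star _)) bb.
case: (eqVneq e f) ne => [->|ef _]; last by rewrite cs_mulr0 cs_mul0r.
by rewrite eqseq_cons eqxx /= sword_star_ur; exact: ih.
Qed.

Lemma sword_starM_cat be ga : cs_star (sword be) ** sword (be ++ ga) = sword ga.
Proof. by rewrite sword_cat cs_mulA sword_isometry sword_ul. Qed.

Lemma sword_starM_catl nu ga :
  cs_star (sword (nu ++ ga)) ** sword nu = cs_star (sword ga).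
Proof.
by rewrite -[X in _ ** X]cs_starK -cs_starM sword_starM_cat.
Qed.

Lemma sword_starM_incomparable be nu : ~~ prefix be nu -> ~~ prefix nu be ->
  cs_star (sword be) ** sword nu = 0.
Proof.
elim: be nu => [|e be ih] [|f nu] //= n1 n2.
rewrite cs_starM cs_mulA -(cs_mulA _ (cs_star _)) bb.
rewrite (eq_sym f e) in n2; case: (eqVneq e f) n1 n2 => [_ /= n1 n2|_ _ _].
  by rewrite sword_star_ur; exact: ih.
by rewrite cs_mulr0 cs_mul0r.
Qed.

Lemma sword_refine al be :
  \sum_e sword (rcons al e) ** cs_star (sword (rcons be e)) =
  sword al ** cs_star (sword be).
Proof.
have [_ _ _ _ bsum] := fb.
under eq_bigr => e _.
  rewrite -!cats1 !sword_cat /= ur cs_starM -cs_mulA (cs_mulA (b _)); over.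
by rewrite -cs_mul_sumr -cs_mul_suml bsum sword_star_ul.
Qed.

End CornerWords.

(** * Operators attached to functions *)

(* A real number of modulus at most 1 is the real part of a unimodular one,   *)
(* so an operator that is contractive at unimodular functions is bounded.     *)
Section UnimodularBound.
Variable R : realType.
Local Notation C := (cplx R).

(** For s = 1 or s = -1 and [nrm z <= M], this is the point of the unit circle with real part Re z /
    M in the upper or lower half plane. *)
Definition unimodular (s M : R) (z : C) : C :=
  (complex.Re z / M +i* (s * Num.sqrt (1 - (complex.Re z / M) ^+ 2)))%C.

Lemma Re_le_nrm (z : C) : `|complex.Re z| <= nrm z.
Proof.
case: z => x y; rewrite /nrm normc_def /= -sqrtr_sqr ler_wsqrtr// lerDl.
exact: sqr_ge0.
Qed.

Lemma nrm_unimodular (s M : R) z : s ^+ 2 = 1 -> 0 < M -> nrm z <= M ->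
  nrm (unimodular s M z) = 1.
Proof.
move=> s1 M0 zM; rewrite /unimodular /nrm normc_def /=.
rewrite [(s * _) ^+ 2]exprMn s1 mul1r sqr_sqrtr;
  first by rewrite addrC subrK sqrtr1.
rewrite subr_ge0 -(real_normK (num_real _)) expr_le1// normrM.
rewrite [X in _ * X]ger0_norm; last by rewrite invr_ge0 ltW.
by rewrite ler_pdivrMr// mul1r; exact: le_trans (Re_le_nrm z) zM.
Qed.

(** In each bracket the square roots cancel. As Re (- i z) = Im z, the first bracket gives the real
    part of z and the second its imaginary part. *)
Lemma unimodular_decomposition (M : R) (z : C) : 0 < M ->
  z = (M / 2)%:C%C * (unimodular 1 M z + unimodular (-1) M z)
      + (M / 2)%:C%C * 'i * (unimodular 1 M (- 'i * z) + unimodular (-1) M (-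
          'i * z)).
Proof.
move=> M0; case: z => x y; apply/eqP; rewrite eq_complex /=.
set a := Num.sqrt _; set a' := Num.sqrt _.
have M2 : M != 0 := lt0r_neq0 M0.
by apply/andP; split; apply/eqP; field.
Qed.

Lemma unimodular_continuous (T : topologicalType) (f : T -> C) (s M : R) :
  continuous f -> continuous (fun t => unimodular s M (f t)).
Proof.
move=> fc.
have Rec : continuous (fun t => complex.Re (f t) : R).
  move=> t; apply/cvgrPdist_le => e e0.
  have e0' : 0 < (e%:C%C : C) by rewrite real_complex_gt0.
  have /cvgrPdist_le/(_ _ e0') := fc t.
  apply: filterS => t'; rewrite nrmE lecR; apply: le_trans.
  rewrite (_ : complex.Re (f t) - complex.Re (f t') = complex.Re (f t - f t')).
    exact: Re_le_nrm.
  by case: (f t) => x y; case: (f t') => x' y'.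
have RCc (g : T -> R) : continuous g -> continuous (fun t => (g t)%:C%C : C).
  move=> gc t; apply/cvgrPdist_le => _ /gt0_complexP[r e0 ->].
  have /cvgrPdist_le/(_ _ e0) := gc t.
  by apply: filterS => t' h; rewrite -rmorphB /= nrmE nrm_real lecR.
have -> : (fun t => unimodular s M (f t)) = (fun t => (complex.Re (f t) /
  M)%:C%C
    + 'i * (s * Num.sqrt (1 - (complex.Re (f t) / M) ^+ 2))%:C%C).
  by apply/funext => t; apply/eqP; rewrite eq_complex /=; apply/andP; split;
    apply/eqP; ring.
have dc : continuous (fun t => complex.Re (f t) / M : R).
  by move=> t; apply: cvgM; [exact: Rec|exact: cvg_cst].
move=> t; apply: cvgD; first exact: RCc.
apply: cvgM; first exact: cvg_cst.
apply: RCc => {}t; apply: cvgM; first exact: cvg_cst.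
apply: (continuous_comp (f := fun t => 1 - (complex.Re (f t) / M) ^+ 2));
  last exact: sqrt_continuous.
apply: cvgB; first exact: cvg_cst.
by rewrite expr2; apply: cvgM; exact: dc.
Qed.

Section Operator.
Variables (I : Type) (V : normedModType C) (D : set (I -> C)) (T : (I ->
  C) -> V).
Hypotheses (D0 : D (fun=> 0)) (DZ : forall k f, D f -> D (fun i => k * f i))
  (DD : forall f g, D f -> D g -> D (fun i => f i + g i))
  (DU : forall s M f, D f -> D (fun i => unimodular s M (f i)))
  (TL : forall k f g, D f -> D g -> T (fun i => k * f i + g i) = k *: T f + T g)
  (T1 : forall f, D f -> (forall i, nrm (f i) = 1) -> nrm (T f) <= 1).

(** Four unimodular functions occur, each with a coefficient of modulus M / 2; this is the origin of
    the factor 2. *)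
Lemma unimodular_bound f M : 0 < M -> D f -> (forall i, nrm (f i) <= M) ->
  nrm (T f) <= 2 * M.
Proof.
move=> M0 Df fM; pose f' i := - 'i * f i.
have Df' : D f' by exact: DZ.
have f'M i : nrm (f' i) <= M.
  apply: le_trans (fM i); rewrite /f' nrmCM.
  by rewrite /nrm normrN normCi /= mul1r.
have T0 : T (fun=> 0) = 0.
  have := TL 1 D0 D0; rewrite scale1r.
  rewrite (_ : (fun i : I => _) = (fun=> 0)); last by apply/funext => i;
    rewrite mulr0 addr0.
  by rewrite -{1}[T _]addr0 => /addrI/esym.
have TZ k g : D g -> T (fun i => k * g i) = k *: T g.
  move=> Dg; have := TL k Dg D0; rewrite T0 addr0 => <-.
  by congr T; apply/funext => i; rewrite addr0.
have TD g h : D g -> D h -> T (fun i => g i + h i) = T g + T h.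
  move=> Dg Dh; have := TL 1 Dg Dh; rewrite scale1r => <-.
  by congr T; apply/funext => i; rewrite mul1r.
pose U s (g : I -> C) i := unimodular s M (g i).
have TU s (g : I -> C) : s ^+ 2 = 1 -> D g -> (forall i, nrm (g i) <= M) ->
  nrm (T (U s g)) <= 1.
  by move=> s1 Dg gM; apply: T1 => [|i]; [exact: DU|exact: nrm_unimodular].
have DUU (g : I -> C) : D g -> D (fun i => U 1 g i + U (-1) g i).
  by move=> Dg; apply: DD; exact: DU.
have -> : f = fun i => (M / 2)%:C%C * (U 1 f i + U (-1) f i)
    + (M / 2)%:C%C * 'i * (U 1 f' i + U (-1) f' i).
  by apply/funext => i; exact: unimodular_decomposition.
have TUU (g : I -> C) : D g -> (forall i, nrm (g i) <= M) ->
    nrm (T (fun i => U 1 g i + U (-1) g i)) <= 2.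
  move=> Dg gM; rewrite TD; try exact: DU.
  by apply: le_trans (nrmD _ _) _; apply: lerD; apply: TU => //;
    rewrite ?expr1n ?sqrrN ?expr1n.
rewrite TD; try by apply: DZ; exact: DUU.
rewrite !TZ; try exact: DUU.
have M2 : 0 <= M / 2 by rewrite divr_ge0// ltW.
have nc : nrm ((M / 2)%:C%C * 'i : C) = M / 2.
  rewrite nrmCM nrm_real ger0_norm//.
  by rewrite /nrm normCi /= mulr1.
apply: le_trans (nrmD _ _) _; rewrite !nrmZ nc nrm_real ger0_norm//.
rewrite -mulrDr -[leRHS](_ : M / 2 * (2 + 2) = _); last by field.
by rewrite ler_wpM2l// lerD ?TUU.
Qed.

End Operator.
End UnimodularBound.

Section WordLists.
Variable E : finType.

Fixpoint words (n : nat) : seq (seq E) :=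
  if n is n'.+1 then [seq rcons al e | al <- words n',
    e <- enum E] else [:: [::]].

Lemma mem_words n al : (al \in words n) = (size al == n).
Proof.
elim: n al => [|n ih] al /=; first by rewrite inE size_eq0.
apply/allpairsP/idP => [[[be e] /= [+ _ ->]]|].
  by rewrite ih size_rcons eqSS.
case/lastP: al => // al e; rewrite size_rcons eqSS => aln.
by exists (al, e); rewrite ih mem_enum.
Qed.

Lemma words_uniq n : uniq (words n).
Proof.
elim: n => //= n ih; apply: allpairs_uniq => //; first exact: enum_uniq.
by move=> [al e] [be f] _ _ /rcons_inj[-> ->].
Qed.

Lemma sum_wordsS (V : nmodType) n (F : seq E -> V) :
  \sum_(mu <- words n.+1) F mu = \sum_(mu <- words n) \sum_e F (rcons mu e).
Proof.
by rewrite /= big_allpairs_dep; apply: eq_bigr => mu _; rewrite big_enum.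
Qed.

Lemma sum_words1 (V : nmodType) n (F : seq E -> V) nu : size nu = n ->
  (forall mu, size mu = n -> mu != nu -> F mu = 0) ->
  \sum_(mu <- words n) F mu = F nu.
Proof.
move=> nun F0; rewrite (bigD1_seq nu) ?words_uniq ?mem_words ?nun//=.
rewrite big_seq_cond big1 ?addr0// => mu; rewrite mem_words => /andP[/eqP mun
  ne].
exact: F0.
Qed.

End WordLists.

Section WordOperators.
Variables (R : realType) (E : finType) (H : groupType) (w : seq E -> H).
Hypotheses (w_cat : forall al be, w (al ++ be) = (w al * w be)%g)
  (w_inj : injective w).
Variables (B : cstarType R) (b : option E -> B).
Hypothesis fb : corner_family b.
Local Notation C := (cplx R).
Local Notation "x ** y" := (cs_mul x y) (at level 40, left associativity).

Definition good (h : H) (mu : seq E) : Prop :=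
  exists be, h = (w mu * (w be)^-1)%g.

(** The word be is unique because [w] is injective, so the operator is s_mu s_be^* without a choice
    ([WopE]), and the default [[::]] is never reached when mu is good. *)
Definition Wop (h : H) (mu : seq E) : B :=
  if `[< good h mu >]
  then sword b mu ** cs_star (sword b (xget [::] [set be | h =
    (w mu * (w be)^-1)%g]))
  else 0.

Lemma WopE mu be : Wop (w mu * (w be)^-1)%g mu =
  sword b mu ** cs_star (sword b be).
Proof.
rewrite /Wop; case: asboolP => [_|[]]; last by exists be.
case: xgetP => [be' _ /= /mulgI/invg_inj/w_inj -> //|].
by move=> /(_ be)[].
Qed.

Lemma Wop_bad h mu : ~ good h mu -> Wop h mu = 0.
Proof. by rewrite /Wop => nh; case: asboolP. Qed.

Lemma good_cat h mu ga : good h mu -> good h (mu ++ ga).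
Proof.
move=> [be ->]; exists (be ++ ga).
by rewrite !w_cat invgM mulgA mulgK.
Qed.

Lemma Wop_refine h mu : good h mu -> \sum_e Wop h (rcons mu e) = Wop h mu.
Proof.
move=> [be hE]; rewrite {2}hE WopE -(sword_refine fb); apply: eq_bigr => e _.
have -> : h = (w (rcons mu e) * (w (rcons be e))^-1)%g.
  by rewrite -!cats1 !w_cat invgM mulgA mulgK.
exact: WopE.
Qed.

(** Let be and de be the words that h attaches to mu and nu. If de = be ga, then w nu = w (mu ga),
    and equality of lengths forces mu = nu; the case be = de ga is symmetric. So be and de are
    incomparable and s_be^* s_de = 0. *)
Lemma Wop_orthogonal h mu nu : size mu = size nu -> mu != nu ->
  Wop h mu ** cs_star (Wop h nu) = 0.
Proof.
move=> sz ne; have [[be hE]|nm] := pselect (good h mu); last first.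
  by rewrite (Wop_bad nm) cs_mul0r.
have [[de hE']|nn] := pselect (good h nu); last first.
  by rewrite (Wop_bad nn) cs_star0 cs_mulr0.
rewrite {1}hE hE' !WopE cs_starM cs_starK cs_mulA -(cs_mulA _ _ (sword b de)).
have key a a' ga c c' : size a = size a' -> h = (w a * (w c)^-1)%g ->
    h = (w a' * (w c')^-1)%g -> c' = c ++ ga -> a = a'.
  move=> saa ha ha' cE; have : w a' = w (a ++ ga).
    rewrite w_cat; apply: (mulIg (w c')^-1%g); rewrite -ha' {1}ha cE w_cat.
    by rewrite invgM !mulgA mulgK.
  move=> /w_inj aE; move: saa; rewrite aE size_cat => /eqP.
  by rewrite -{1}[size a]addn0 eqn_add2l eq_sym size_eq0 => /eqP ->;
    rewrite cats0.
rewrite (sword_starM_incomparable fb) ?cs_mulr0 ?cs_mul0r//.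
  apply/negP => /prefixP[ga cE]; move/eqP: ne; apply.
  exact: (key mu nu ga be de sz hE hE' cE).
apply/negP => /prefixP[ga cE]; move/eqP: ne; apply; apply/esym.
exact: (key nu mu ga de be (esym sz) hE' hE cE).
Qed.

Lemma Wop_range h mu : good h mu ->
  Wop h mu ** cs_star (Wop h mu) = sword b mu ** cs_star (sword b mu).
Proof.
move=> [be ->]; rewrite WopE cs_starM cs_starK cs_mulA -(cs_mulA _ _ (sword b
  be)).
by rewrite (sword_isometry fb) (sword_ur fb).
Qed.

Definition Wsum h n (c : seq E -> C) : B := \sum_(mu <- words E n) c mu *: Wop
  h mu.

Lemma nrm_conj (c : C) : c * c^* = (nrm c ^+ 2)%:C%C.
Proof. by rewrite -normCK nrmE -rmorphXn. Qed.

(** For X the sum, X X^* is the sum of the mutually orthogonal projections s_mu s_mu^* over the good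
    words mu of length n. This is a projection, so X is a contraction. *)
Lemma Wsum_unimodular h n c : (forall mu, nrm (c mu) = 1) ->
  nrm (Wsum h n c) <= 1.
Proof.
move=> c1; pose Q := \sum_(mu <- words E n) if `[< good h mu >]
  then sword b mu ** cs_star (sword b mu) else 0.
have XX : Wsum h n c ** cs_star (Wsum h n c) = Q.
  rewrite /Wsum cs_star_sum cs_mul_suml /Q; apply: eq_big_seq => mu.
  rewrite mem_words => /eqP smu; rewrite cs_mul_sumr (sum_words1 smu).
    rewrite -cs_scaleAl cs_starZ -cs_scaleAr scalerA nrm_conj c1 expr1n scale1r.
    case: asboolP => [g|ng]; first exact: Wop_range.
    by rewrite (Wop_bad ng) cs_mul0r.
  move=> nu snu ne; rewrite -cs_scaleAl cs_starZ -cs_scaleAr Wop_orthogonal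
    ?scaler0//.
    by rewrite smu snu.
  by rewrite eq_sym.
have Qs : cs_star Q = Q.
  rewrite /Q cs_star_sum; apply: eq_bigr => mu _.
  by case: ifP => _; rewrite ?cs_star0// cs_starM cs_starK.
have QQ : Q ** Q = Q.
  rewrite {1}/Q cs_mul_suml /Q; apply: eq_big_seq => mu.
  rewrite mem_words => /eqP smu; rewrite cs_mul_sumr (sum_words1 smu).
    case: ifP => _; last by rewrite cs_mul0r.
    by rewrite cs_mulA -(cs_mulA (sword b mu)) (sword_isometry fb) (sword_ur
      fb).
  move=> nu snu ne; case: ifP => _; last by rewrite cs_mul0r.
  case: ifP => _; last by rewrite cs_mulr0.
  rewrite cs_mulA -(cs_mulA (sword b mu)) (sword_orthogonal fb) ?smu//.
    by rewrite cs_mulr0 cs_mul0r.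
  by rewrite eq_sym.
rewrite -(expr_le1 (n := 2))// ?nrm_ge0//.
by rewrite -nrm_star -nrmC cs_starK XX; exact: nrm_projection.
Qed.

Lemma Wsum_lin h n k (c d : seq E -> C) :
  Wsum h n (fun mu => k * c mu + d mu) = k *: Wsum h n c + Wsum h n d.
Proof.
rewrite /Wsum scaler_sumr -big_split; apply: eq_bigr => mu _ /=.
by rewrite scalerDl scalerA.
Qed.

Lemma Wsum_le h n c (M : R) : 0 < M -> (forall mu, nrm (c mu) <= M) ->
  nrm (Wsum h n c) <= 2 * M.
Proof.
move=> M0 cM; apply: (unimodular_bound (D := setT) (T := Wsum h n)) => // [k f
  g _ _|f _].
  exact: Wsum_lin.
exact: Wsum_unimodular.
Qed.

End WordOperators.

(** * The operator attached to a group element and a function *)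

Section FormalSumOperator.
Variables (R : realType) (E : finType) (H : groupType) (w : seq E -> H).
Hypotheses (w_cat : forall al be, w (al ++ be) = (w al * w be)%g)
  (w_inj : injective w).
Variables (B : cstarType R) (b : option E -> B).
Hypothesis fb : corner_family b.
Variable x0 : infinite_words E.
Local Notation C := (cplx R).
Local Notation X := (infinite_words E).
Local Notation "x ** y" := (cs_mul x y) (at level 40, left associativity).
Local Notation good := (good w).

Definition cyl_fun (al : seq E) : X -> C := fun x => (mkseq x (size al) ==
  al)%:R.

(** Functions of the first n letters, supported where h already acts by exchanging a prefix of
    length n. Their operators are finite sums of the elements s_mu s_be^*. *)
Definition level (h : H) (n : nat) (g : X -> C) : Prop := exists G : seq E -> C,
  (forall x, g x = G (mkseq x n)) /\ (forall mu, ~ good h mu -> G mu = 0).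

Definition level_closure (h : H) (f : X -> C) : Prop := forall e : R, 0 < e ->
  exists n g, level h n g /\ forall x, nrm (f x - g x) <= e.

Lemma levelS h n g : level h n g -> level h n.+1 g.
Proof.
move=> [G [gG Gbad]]; exists (G \o take n); split=> [x|mu bad] /=.
  by rewrite take_mkseq// -gG.
by apply: Gbad => gt; apply: bad; rewrite -(cat_take_drop n mu);
  exact: good_cat.
Qed.

Lemma level_le h m n g : (n <= m)%N -> level h n g -> level h m g.
Proof. by move=> /subnK <- gn; elim: (m - n)%N => // k; exact: levelS. Qed.

Lemma level_lin h n k f g : level h n f -> level h n g ->
  level h n (fun x => k * f x + g x).
Proof.
move=> [F [fF Fb]] [G [gG Gb]]; exists (fun mu => k * F mu + G mu).
split=> [x|mu bad]; first by rewrite fF gG.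
by rewrite Fb// Gb// mulr0 addr0.
Qed.

Lemma level0 h n : level h n (fun=> 0).
Proof. by exists (fun=> 0). Qed.

Lemma level_cyl_fun h al : good h al -> level h (size al) (cyl_fun al).
Proof.
move=> g; exists (fun mu => (mu == al)%:R); split=> // mu bad.
by case: eqP => // e; rewrite e in bad.
Qed.

Lemma level_closure_level h n g : level h n g -> level_closure h g.
Proof.
by move=> gn e e0; exists n, g; split=> // x; rewrite subrr nrm0 ltW.
Qed.

Lemma level_closure_lin h k f g : level_closure h f -> level_closure h g ->
  level_closure h (fun x => k * f x + g x).
Proof.
move=> fL gL e e0; have k0 : 0 < nrm k + 1 by rewrite ltr_wpDl ?nrm_ge0.
have [n [f' [f'n f'P]]] := fL (e / 2 / (nrm k + 1)) (divr_gt0 (divr_gt0 e0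
  (ltr0Sn _ 1)) k0).
have [m [g' [g'm g'P]]] := gL (e / 2) (divr_gt0 e0 (ltr0Sn _ 1)).
exists (maxn n m), (fun x => k * f' x + g' x); split.
  by apply: level_lin; [exact: level_le (leq_maxl _ _) f'n|exact: level_le
    (leq_maxr _ _) g'm].
move=> x; have -> : k * f x + g x - (k * f' x + g' x) =
  k * (f x - f' x) + (g x - g' x).
  by ring.
rewrite [e](splitr e); apply: le_trans (nrmD _ _) _; apply: lerD => //.
rewrite nrmCM; have := f'P x; rewrite ler_pdivlMr// mulrC => h'.
by apply: le_trans h'; rewrite ler_wpM2r ?nrm_ge0// lerDl.
Qed.

Lemma level_closure_lim h f : (forall e : R, 0 < e ->
    exists g, level_closure h g /\ forall x, nrm (f x - g x) <= e) ->
  level_closure h f.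
Proof.
move=> fl e e0; have e2 : 0 < e / 2 by rewrite divr_gt0.
have [g [gL gP]] := fl _ e2; have [n [g' [g'n g'P]]] := gL _ e2.
exists n, g'; split=> // x; rewrite (splitr e).
by apply: le_trans (nrm_triangle (g x) _ _) _; exact: lerD.
Qed.

Lemma level_bounded h n g : level h n g -> exists2 M, 0 < M &
  forall x, nrm (g x) <= M.
Proof.
move=> [G [gG _]]; pose M := \sum_(mu <- words E n) nrm (G mu).
have M0 : 0 <= M by apply: sumr_ge0 => mu _; exact: nrm_ge0.
exists (M + 1) => [|x]; first by rewrite ltr_wpDl.
have hM : nrm (G (mkseq x n)) <= M.
  rewrite /M (bigD1_seq (mkseq x n)) ?words_uniq ?mem_words ?size_mkseq//=.
  by rewrite lerDl; apply: sumr_ge0 => mu _; exact: nrm_ge0.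
by rewrite gG; apply: le_trans hM _; rewrite lerDl.
Qed.

Lemma level_closure_bounded h f : level_closure h f ->
  exists2 M, 0 < M & forall x, nrm (f x) <= M.
Proof.
move=> /(_ 1 ltr01)[n [g [/level_bounded[M M0 gM] fg]]].
exists (M + 1) => [|x]; first by rewrite addr_gt0.
rewrite -[f x](subrK (g x)) addrC; apply: le_trans (nrmD _ _) _; exact: lerD.
Qed.

(** Induction along the decomposition of g into indicators of cylinders. Membership of the partial
    sums in [level_closure] is carried along because linearity of [op] requires it. *)
Lemma level_ind h (P : (X -> C) -> Prop) : P (fun=> 0) ->
  (forall c al be g, h = (w al * (w be)^-1)%g -> level_closure h g -> P g ->
     P (fun x => c * cyl_fun al x + g x)) ->
  forall n g, level h n g -> P g.
Proof.
move=> P0 PD n g [G [gG Gb]].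
have -> : g = (fun x => \sum_(mu <- words E n) G mu * cyl_fun mu x).
  apply/funext => x; rewrite (sum_words1 (nu := mkseq x n)) ?size_mkseq//.
    by rewrite /cyl_fun size_mkseq eqxx mulr1.
  move=> mu sz ne; rewrite /cyl_fun sz eq_sym (negPf ne) mulr0//.
suff : forall r : seq (seq E), P (fun x => \sum_(mu <- r) G mu * cyl_fun mu x)
  /\
    level_closure h (fun x => \sum_(mu <- r) G mu * cyl_fun mu x).
  by move=> /(_ (words E n))[].
elim=> [|mu r [Pr Lr]].
  under eq_fun do rewrite big_nil.
  by split=> //; exact: level_closure_level (level0 h 0).
under eq_fun do rewrite big_cons.
have [gmu|/Gb G0] := pselect (good h mu); last first.
  by rewrite G0; under eq_fun do rewrite mul0r add0r.
split; first by have [be hE] := gmu; exact: PD hE Lr Pr.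
apply: level_closure_lin => //; exact: level_closure_level (level_cyl_fun gmu).
Qed.

(** A Riemann sum: f is sampled at one point of every cylinder of length n. *)
Definition approx_op (h : H) (n : nat) (f : X -> C) : B :=
  Wsum w b h n (fun mu => f (prepend mu x0)).

Lemma approx_op_lin h n k f g :
  approx_op h n (fun x => k * f x + g x) = k *: approx_op h n f + approx_op h n
    g.
Proof. exact: Wsum_lin. Qed.

Lemma approx_op_le h n f M : 0 < M -> (forall x, nrm (f x) <= M) ->
  nrm (approx_op h n f) <= 2 * M.
Proof. by move=> M0 fM; apply: Wsum_le => // mu. Qed.

(** Subdividing a cylinder changes nothing, because the sum over e of s_{mu e} s_{be e}^* equals
    s_mu s_be^* by the Cuntz relation. Hence the Riemann sums are eventually constant at functions
    of finite level. *)
Lemma approx_op_levelS h n g : level h n g -> approx_op h n.+1 g =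
  approx_op h n g.
Proof.
move=> [G [gG Gb]]; rewrite /approx_op /Wsum sum_wordsS.
apply: eq_big_seq => mu; rewrite mem_words => /eqP smu.
have gmu ga : g (prepend (mu ++ ga) x0) = G mu.
  by rewrite gG prepend_cat -smu mkseq_prepend.
under eq_bigr do rewrite -cats1 gmu cats1.
rewrite -[mu in RHS]cats0 gmu cats0.
have [gd|/Gb ->] := pselect (good h mu); first by rewrite -scaler_sumr
  Wop_refine.
by rewrite scale0r big1// => e _; rewrite scale0r.
Qed.

Lemma approx_op_level h m n g : (n <= m)%N -> level h n g ->
  approx_op h m g = approx_op h n g.
Proof.
move=> /subnK <- gn; elim: (m - n)%N => // k <-.
by rewrite addSn approx_op_levelS//; apply: level_le gn; rewrite leq_addl.
Qed.

Lemma approx_op_cauchy h f : level_closure h f ->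
  ncauchy (fun n => approx_op h n f).
Proof.
move=> fL e e0; have e4 : 0 < e / 4 by rewrite divr_gt0.
have [N [g [gN gP]]] := fL _ e4.
exists N => m n Nm Nn.
have dec k : approx_op h k f = approx_op h k (fun x => f x - g x) + approx_op h
  k g.
  rewrite -[approx_op h k (fun x => f x - g x)]scale1r -approx_op_lin.
  by congr approx_op; apply/funext => x; rewrite mul1r subrK.
rewrite !dec (approx_op_level Nm gN) (approx_op_level Nn gN) opprD addrACA
  subrr addr0.
apply: le_trans (nrmD _ _) _; rewrite nrmN.
have le1 k := approx_op_le h k e4 gP.
by apply: le_trans (lerD (le1 m) (le1 n)) _; rewrite le_eqVlt; apply/orP;
  left; apply/eqP; field.
Qed.

Definition op (h : H) (f : X -> C) : B :=
  xget 0 [set l | tends (fun n => approx_op h n f) l].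

Lemma opP h f : level_closure h f -> tends (fun n => approx_op h n f) (op h f).
Proof.
move=> fL; rewrite /op; case: xgetP => // nol.
by have [l fl] := ncauchyP (approx_op_cauchy fL); case: (nol l).
Qed.

Lemma op_level h n g : level h n g -> op h g = approx_op h n g.
Proof.
move=> gn; apply: tends_unique (opP (level_closure_level gn)) _.
apply: (tends_eventually (N := n) _ (tends_cst (approx_op h n g))) => m nm.
by rewrite (approx_op_level nm gn).
Qed.

Lemma op_lin h k f g : level_closure h f -> level_closure h g ->
  op h (fun x => k * f x + g x) = k *: op h f + op h g.
Proof.
move=> fL gL; apply: tends_unique (opP (level_closure_lin k fL gL)) _.
apply: (tends_eventually (N := 0%N) _ (tendsD (tendsZ k (opP fL)) (opP gL))) =>
  n _.
by rewrite approx_op_lin.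
Qed.

Lemma op0 h : op h (fun=> 0) = 0.
Proof.
rewrite (op_level (level0 h 0)) /approx_op /Wsum big1// => mu _.
by rewrite scale0r.
Qed.

Lemma op_le h f M : level_closure h f -> 0 < M -> (forall x, nrm (f x) <= M) ->
  nrm (op h f) <= 2 * M.
Proof. by move=> fL M0 fM; apply: tends_le (opP fL) _ => n;
  exact: approx_op_le. Qed.

Lemma op_sub h f g : level_closure h f -> level_closure h g ->
  op h (fun x => f x - g x) = op h f - op h g.
Proof.
move=> fL gL; rewrite -scaleN1r addrC -op_lin//.
by congr op; apply/funext => x; rewrite mulN1r addrC.
Qed.

Lemma op_sub_le h f g e : level_closure h f -> level_closure h g -> 0 < e ->
  (forall x, nrm (f x - g x) <= e) -> nrm (op h f - op h g) <= 2 * e.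
Proof.
move=> fL gL e0 fg; rewrite -op_sub//; apply: op_le => //.
have := level_closure_lin (-1) gL fL.
by under eq_fun do rewrite mulN1r addrC.
Qed.

Lemma op_cyl_fun al be :
  op (w al * (w be)^-1)%g (cyl_fun al) = sword b al ** cs_star (sword b be).
Proof.
set h := (_ * _)%g; have g : good h al by exists be.
rewrite (op_level (level_cyl_fun g)) /approx_op /Wsum.
rewrite (sum_words1 (nu := al))//.
  by rewrite /cyl_fun mkseq_prepend eqxx scale1r WopE.
by move=> mu sz ne; rewrite /cyl_fun -sz mkseq_prepend (negPf ne) scale0r.
Qed.

End FormalSumOperator.

Section CylinderFunctions.
Variables (R : realType) (E : finType).
Local Notation C := (cplx R).
Local Notation X := (infinite_words E).
Local Notation cyl_fun := (@cyl_fun R E).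

Lemma cyl_fun_cat al ga (z : X) : cyl_fun (al ++ ga) (prepend al z) =
  cyl_fun ga z.
Proof.
rewrite /cyl_fun size_cat mkseqD mkseq_prepend wdrop_prepend.
by rewrite eqseq_cat// eqxx.
Qed.

Lemma cyl_fun1 al (z : X) : cyl_fun al (prepend al z) = 1.
Proof. by rewrite /cyl_fun mkseq_prepend eqxx. Qed.

Lemma cyl_fun_neq0 al (x : X) : cyl_fun al x != 0 -> exists z, x = prepend al z.
Proof.
rewrite /cyl_fun; have [e _|_] := eqVneq (mkseq x (size al)) al;
  last by rewrite eqxx.
by exists (wdrop (size al) x); rewrite -{1}e prepend_mkseq.
Qed.

End CylinderFunctions.

(** * Products and adjoints of coefficients *)

Section Convolution.
Variables (R : realType) (E : finType) (H : groupType) (w : seq E -> H).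
Hypotheses (w_cat : forall al be, w (al ++ be) = (w al * w be)%g)
  (w_inj : injective w).
Local Notation C := (cplx R).
Local Notation X := (infinite_words E).
Variable p : partial_action_data H X.
Hypotheses (p_dom : forall h y, pa_dom p h y <-> exists x, exchange w h x y)
  (p_map : forall h x y, exchange w h x y -> pa_map p h x = y).
Local Notation cyl_fun := (@cyl_fun R E).
Local Notation level_closure := (level_closure w).
Local Notation level := (level w).

(** The coefficient of (f delta_g)(f' delta_h) at g h; it does not depend on h. *)
Definition conv (g : H) (f f' : X -> C) : X -> C :=
  theta_tilde p g (fun y => theta_tilde p g^-1%g f y * f' y).

Lemma convE g f f' x : conv g f f' x =
  if `[< pa_dom p g x >] then f x * f' (pa_map p g^-1%g x) else 0.
Proof.
rewrite /conv /theta_tilde; case: asboolP => // gx.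
have gV : exchange w g^-1%g x (pa_map p g^-1%g x).
  by apply/(p_domV p_dom p_map); rewrite invgK.
case: asboolP => [_|[]]; last by apply/p_dom; exists x.
rewrite invgK; congr (f _ * _); apply: p_map.
by rewrite -{1}[g]invgK; exact: exchangeV gV.
Qed.

Lemma conv_prepend al be f f' z : conv (w al * (w be)^-1)%g f f' (prepend al z)
  =
  f (prepend al z) * f' (prepend be z).
Proof.
rewrite convE; case: asboolP => [_|[]].
  by rewrite invgF (p_map_prepend p_map).
by apply/p_dom; exists (prepend be z), al, be, z.
Qed.

Lemma conv_linl g k f1 f2 f' :
  conv g (fun x => k * f1 x + f2 x) f' = fun x => k * conv g f1 f' x + conv g
    f2 f' x.
Proof. by apply/funext => x; rewrite !convE; case: asboolP => _; ring. Qed.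

Lemma conv_linr g k f f1 f2 :
  conv g f (fun x => k * f1 x + f2 x) = fun x => k * conv g f f1 x + conv g f
    f2 x.
Proof. by apply/funext => x; rewrite !convE; case: asboolP => _; ring. Qed.

Lemma conv0l g f' : conv g (fun=> 0) f' = fun=> 0.
Proof. by apply/funext => x; rewrite convE mul0r; case: ifP. Qed.

Lemma conv0r g f : conv g f (fun=> 0) = fun=> 0.
Proof. by apply/funext => x; rewrite convE mulr0; case: ifP. Qed.

Lemma conv_sub_le g f f1 f' f1' (d M M' : R) : 0 <= d ->
  (forall x, nrm (f x - f1 x) <= d) -> (forall x, nrm (f' x - f1' x) <= d) ->
  (forall x, nrm (f1 x) <= M) -> (forall x, nrm (f' x) <= M') ->
  forall x, nrm (conv g f f' x - conv g f1 f1' x) <= d * (M + M').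
Proof.
move=> d0 ff ff' fM fM' x; rewrite !convE; case: asboolP => _; last first.
  rewrite subrr nrm0 mulr_ge0// addr_ge0//.
    exact: le_trans (nrm_ge0 _) (fM x).
  exact: le_trans (nrm_ge0 _) (fM' x).
set y := pa_map _ _ _.
have -> : f x * f' y - f1 x * f1' y = f1 x * (f' y - f1' y) + (f x - f1 x) * f'
  y.
  by ring.
apply: le_trans (nrmD _ _) _; rewrite !nrmCM mulrDr; apply: lerD.
  by rewrite mulrC; apply: ler_pM; rewrite ?nrm_ge0.
by apply: ler_pM; rewrite ?nrm_ge0.
Qed.

(** The same three cases as for s_be^* s_nu: one word is a prefix of the other, or the cylinders of
    be and nu are disjoint. *)
Lemma conv_cyl_fun al be nu : conv (w al * (w be)^-1)%g (cyl_fun al) (cyl_fun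
  nu) =
  if prefix be nu then cyl_fun (al ++ drop (size be) nu)
  else if prefix nu be then cyl_fun al else fun=> 0.
Proof.
apply/funext => x; have [[z ->]|nx] := pselect (exists z, x = prepend al z).
  rewrite conv_prepend cyl_fun1 mul1r.
  case: ifPn => [/prefixP[ga ->]|n1]; first by rewrite drop_size_cat//
    !cyl_fun_cat.
  case: ifPn => [/prefixP[ga ->]|n2]; first by rewrite prepend_cat !cyl_fun1.
  apply/eqP; apply: contraT => /cyl_fun_neq0[z' e].
  case/orP: (leq_total (size be) (size nu)) => sz.
    by have [ga [nuE _]] := prepend_prefix sz e;
      rewrite nuE prefix_prefix in n1.
  have [ga [beE _]] := prepend_prefix sz (esym e).
  by rewrite beE prefix_prefix in n2.
have c0 ga : cyl_fun (al ++ ga) x = 0.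
  apply/eqP; apply: contraT => /cyl_fun_neq0[z xz].
  by case: nx; exists (prepend ga z); rewrite xz prepend_cat.
have -> : conv (w al * (w be)^-1)%g (cyl_fun al) (cyl_fun nu) x = 0.
  by rewrite convE -[al in cyl_fun al]cats0 c0 mul0r; case: ifP.
case: ifP => _; first by rewrite c0.
by case: ifP => // _; rewrite -[al]cats0 c0.
Qed.

Definition star_fun (h : H) (f : X -> C) : X -> C :=
  theta_tilde p h (fun x => (f x)^*).

Lemma star_fun_lin h k f g : star_fun h (fun x => k * f x + g x) =
  fun x => k^* * star_fun h f x + star_fun h g x.
Proof.
apply/funext => x; rewrite /star_fun /theta_tilde; case: asboolP => _.
  by rewrite rmorphD rmorphM.
by rewrite mulr0 addr0.
Qed.

Lemma star_fun0 h : star_fun h (fun=> 0) = fun=> 0.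
Proof. by apply/funext => x; rewrite /star_fun /theta_tilde rmorph0;
  case: ifP. Qed.

Lemma star_fun_le h f g (d : R) : 0 <= d -> (forall x, nrm (f x - g x) <= d) ->
  forall x, nrm (star_fun h f x - star_fun h g x) <= d.
Proof.
move=> d0 fg x; rewrite /star_fun /theta_tilde; case: asboolP => _;
  last by rewrite subrr nrm0.
by rewrite -rmorphB /nrm norm_conjC; exact: fg.
Qed.

Lemma star_fun_cyl_fun al be :
  star_fun (w be * (w al)^-1)%g (cyl_fun al) = cyl_fun be.
Proof.
apply/funext => x; rewrite /star_fun /theta_tilde.
have [[z ->]|nx] := pselect (exists z, x = prepend be z).
  case: asboolP => [_|[]].
    by rewrite invgF (p_map_prepend p_map) !cyl_fun1 rmorph1.
  by apply/p_dom; exists (prepend al z), be, al, z.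
have -> : cyl_fun be x = 0.
  by apply/eqP; apply: contraT => /cyl_fun_neq0[z xz]; case: nx; exists z.
case: asboolP => // hx.
apply/eqP; apply: contraT; rewrite conjC_eq0 => /cyl_fun_neq0[z xz].
case: nx; exists z; have := p_mapK p_dom p_map hx.
by rewrite xz (p_map_prepend p_map).
Qed.

Variables (B : cstarType R) (b : option E -> B).
Hypothesis fb : corner_family b.
Variable x0 : X.
Local Notation "x ** y" := (cs_mul x y) (at level 40, left associativity).
Local Notation op := (op w b x0).

Lemma level_closure_seq h f : level_closure h f ->
  exists F : nat -> X -> C, (forall n, exists m, level h m (F n)) /\
    (forall e, 0 < e -> exists N, forall n, (N <= n)%N ->
      forall x, nrm (f x - F n x) <= e).
Proof.
move=> fL; have [d [d0 dP]] := null_sequence R.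
have /choice[F FP] : forall n, exists g, (exists m, level h m g) /\
    forall x, nrm (f x - g x) <= d n.
  by move=> n; have [m [g [gm fg]]] := fL (d n) (d0 n); exists g; split=> //;
    exists m.
exists F; split=> [n|e e0]; first by have [] := FP n.
have [N NP] := dP e e0; exists N => n /NP dn x.
by have [_ /(_ x) h1] := FP n; exact: le_trans h1 dn.
Qed.

Lemma op_tends h f (F : nat -> X -> C) : level_closure h f ->
  (forall n, level_closure h (F n)) ->
  (forall e, 0 < e -> exists N, forall n, (N <= n)%N ->
    forall x, nrm (f x - F n x) <= e) ->
  tends (fun n => op h (F n)) (op h f).
Proof.
move=> fL FL fF e e0; have e2 : 0 < e / 2 by rewrite divr_gt0.
have [N NP] := fF _ e2; exists N => n /NP h1; rewrite nrmB.
have := op_sub_le w_cat w_inj fb x0 fL (FL n) e2 h1.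
by rewrite mulrC divfK ?pnatr_eq0.
Qed.

(** By linearity in each factor it suffices to treat two cylinder indicators, where [conv_cyl_fun]
    and the rules for s_be^* s_nu give the same answer. *)
Lemma op_conv_level g h n m f f' : level g n f -> level h m f' ->
  level_closure (g * h)%g (conv g f f') /\
  op g f ** op h f' = op (g * h)%g (conv g f f').
Proof.
move=> fn f'm.
pose P f := level_closure (g * h)%g (conv g f f') /\
  op g f ** op h f' = op (g * h)%g (conv g f f').
apply: (level_ind w_cat (P := P)) fn => [|c al be k gE kL [Pk1 Pk2]].
  split; first by rewrite conv0l; exact: level_closure_level (level0 R w _ 0).
  by rewrite conv0l !(op0 w_cat w_inj fb) cs_mul0r.
suff [Q1 Q2] : level_closure (g * h)%g (conv g (cyl_fun al) f') /\
    op g (cyl_fun al) ** op h f' = op (g * h)%g (conv g (cyl_fun al) f').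
  have aL : level_closure g (cyl_fun al).
    by apply: level_closure_level; apply: level_cyl_fun; exists be.
  rewrite /P conv_linl; split; first exact: (level_closure_lin w_cat).
  by rewrite !(op_lin w_cat w_inj fb)// cs_mulDl -cs_scaleAl Q2 Pk2.
pose Q f' := level_closure (g * h)%g (conv g (cyl_fun al) f') /\
  op g (cyl_fun al) ** op h f' = op (g * h)%g (conv g (cyl_fun al) f').
apply: (level_ind w_cat (P := Q)) f'm => [|d nu de k' hE kL' [Qk1 Qk2]].
  split; first by rewrite conv0r; exact: level_closure_level (level0 R w _ 0).
  by rewrite conv0r !(op0 w_cat w_inj fb) cs_mulr0.
suff [S1 S2] : Q (cyl_fun nu).
  have nL : level_closure h (cyl_fun nu).
    by apply: level_closure_level; apply: level_cyl_fun; exists de.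
  rewrite /Q conv_linr; split; first exact: (level_closure_lin w_cat).
  by rewrite !(op_lin w_cat w_inj fb)// cs_mulDr -cs_scaleAr S2 Qk2.
rewrite /Q gE hE conv_cyl_fun !(op_cyl_fun w_cat w_inj fb).
rewrite cs_mulA -(cs_mulA (sword b al)).
have Lc (l : H) a a' : l = (w a * (w a')^-1)%g -> level_closure l (cyl_fun a).
  by move=> ->; apply: level_closure_level; apply: level_cyl_fun; exists a'.
case: ifPn => [/prefixP[ga ->]|n1].
  rewrite drop_size_cat// (sword_starM_cat fb) -(sword_cat fb).
  have -> : (w al * (w be)^-1 * (w (be ++ ga) * (w de)^-1) =
    w (al ++ ga) * (w de)^-1)%g.
    by rewrite !w_cat !mulgA mulgVK.
  by rewrite (op_cyl_fun w_cat w_inj fb); split=> //; exact: Lc.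
case: ifPn => [/prefixP[ga ->]|n2].
  rewrite (sword_starM_catl fb) -cs_mulA -cs_starM -(sword_cat fb).
  have -> : (w al * (w (nu ++ ga))^-1 * (w nu * (w de)^-1) =
    w al * (w (de ++ ga))^-1)%g.
    by rewrite !w_cat !invgM !mulgA mulgVK.
  by rewrite (op_cyl_fun w_cat w_inj fb); split=> //; exact: Lc.
rewrite (sword_starM_incomparable fb n1 n2) cs_mulr0 cs_mul0r (op0 w_cat w_inj
  fb).
by split=> //; exact: level_closure_level (level0 R w _ 0).
Qed.

Lemma op_conv g h f f' : level_closure g f -> level_closure h f' ->
  level_closure (g * h)%g (conv g f f') /\
  op g f ** op h f' = op (g * h)%g (conv g f f').
Proof.
move=> fL f'L.
have [F [FL fF]] := level_closure_seq fL; have [F' [FL' fF']] :=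
  level_closure_seq f'L.
have [M M0 fM] := level_closure_bounded fL; have [M' M0' fM'] :=
  level_closure_bounded f'L.
have FFL n : level_closure (g * h)%g (conv g (F n) (F' n)).
  by have [m Fm] := FL n; have [m' Fm'] := FL' n;
    have [] := op_conv_level Fm Fm'.
have fFc e : 0 < e -> exists N, forall n, (N <= n)%N -> forall x,
    nrm (conv g f f' x - conv g (F n) (F' n) x) <= e.
  move=> e0; pose K := M + 1 + M'; have K0 : 0 < K by rewrite /K; lra.
  (* d <= 1 bounds the approximants [F n] by M + 1, and d <= e / K makes the error d (M + 1 + M') at
     most e. *)
  pose d := Num.min 1 (e / K).
  have d0 : 0 < d by rewrite /d lt_min ltr01 divr_gt0.
  have [N NP] := fF d d0; have [N' NP'] := fF' d d0.
  exists (maxn N N') => n; rewrite geq_max => /andP[/NP h1 /NP' h2] x.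
  have dK : d * K <= e by rewrite -ler_pdivlMr// /d ge_min lexx orbT.
  apply: le_trans dK; apply: (conv_sub_le (M := M + 1) g (ltW d0) h1 h2 _ fM')
    => y.
  rewrite -[F n y](subrK (f y)) addrC; apply: le_trans (nrmD _ _) _;
    apply: lerD => //.
  by rewrite nrmB; apply: le_trans (h1 y) _; rewrite /d ge_min lexx.
have cL : level_closure (g * h)%g (conv g f f').
  refine (@level_closure_lim _ _ _ _ _ (conv g f f') _).
  move=> e e0; have [N NP] := fFc e e0.
  by exists (conv g (F N) (F' N)); split=> // x; exact: NP.
have FLc n : level_closure g (F n) by have [m Fm] := FL n;
  exact: level_closure_level Fm.
have FLc' n : level_closure h (F' n) by have [m Fm] := FL' n;
  exact: level_closure_level Fm.
split=> //; apply: (tends_unique _ (op_tends cL FFL fFc)).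
apply: (tends_eventually (N := 0%N) _ (tendsM (op_tends fL FLc fF) (op_tends
  f'L FLc' fF'))) => n _.
by have [m Fm] := FL n; have [m' Fm'] := FL' n;
  have [_] := op_conv_level Fm Fm'.
Qed.

Lemma op_star h f : level_closure h^-1%g f ->
  level_closure h (star_fun h f) /\ op h (star_fun h f) = cs_star (op h^-1%g f).
Proof.
pose P g := level_closure h (star_fun h g) /\
  op h (star_fun h g) = cs_star (op h^-1%g g).
have lev n g : level h^-1%g n g -> P g.
  apply: (level_ind w_cat (P := P)) => [|c al be k hE kL [Pk1 Pk2]].
    rewrite /P star_fun0 !(op0 w_cat w_inj fb) cs_star0; split=> //.
    exact: level_closure_level (level0 R w _ 0).
  have hE' : h = (w be * (w al)^-1)%g by rewrite -[h]invgK hE invgF.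
  have aL : level_closure h^-1%g (cyl_fun al).
    by apply: level_closure_level; apply: level_cyl_fun; exists be.
  have bL : level_closure h (cyl_fun be).
    by apply: level_closure_level; apply: level_cyl_fun; exists al.
  have sE : star_fun h (cyl_fun al) = cyl_fun be by rewrite hE'
    star_fun_cyl_fun.
  rewrite /P star_fun_lin sE; split; first exact: (level_closure_lin w_cat).
  rewrite !(op_lin w_cat w_inj fb)// Pk2 cs_starD cs_starZ.
  rewrite {1}hE' hE !(op_cyl_fun w_cat w_inj fb) cs_starM cs_starK.
  by [].
move=> fL; have [F [FL fF]] := level_closure_seq fL.
have FsL n : level_closure h (star_fun h (F n)).
  by have [m Fm] := FL n; have [] := lev m _ Fm.
have fFs e : 0 < e -> exists N, forall n, (N <= n)%N -> forall x,
    nrm (star_fun h f x - star_fun h (F n) x) <= e.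
  move=> e0; have [N NP] := fF e e0; exists N => n /NP h1.
  by apply: star_fun_le => //; exact: ltW.
have sL : level_closure h (star_fun h f).
  refine (@level_closure_lim _ _ _ _ _ (star_fun h f) _).
  move=> e e0; have [N NP] := fFs e e0.
  by exists (star_fun h (F N)); split=> // x; exact: NP.
have FLc n : level_closure h^-1%g (F n) by have [m Fm] := FL n;
  exact: level_closure_level Fm.
split=> //; apply: (tends_unique (op_tends sL FsL fFs)).
apply: (tends_eventually (N := 0%N) _ (tends_star (op_tends fL FLc fF))) => n _.
by have [m Fm] := FL n; have [_ ->] := lev m _ Fm.
Qed.

End Convolution.

(** * The crossed product *)

Section FormalSumsHom.
Variables (R : realType) (E : finType) (H : groupType) (w : seq E -> H).
Hypotheses (w_cat : forall al be, w (al ++ be) = (w al * w be)%g)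
  (w_inj : injective w).
Local Notation C := (cplx R).
Local Notation X := (infinite_words E).
Variable p : partial_action_data H X.
Hypotheses (p_dom : forall h y, pa_dom p h y <-> exists x, exchange w h x y)
  (p_map : forall h x y, exchange w h x y -> pa_map p h x = y).
Variables (B : cstarType R) (b : option E -> B).
Hypothesis fb : corner_family b.
Variable x0 : X.
Local Notation "x ** y" := (cs_mul x y) (at level 40, left associativity).
Local Notation op := (op w b x0).
Local Notation level_closure := (level_closure w).

(** Around a point of the domain all sufficiently long prefixes are good and f oscillates little;
    around any other point f is close to its value 0. By [koenig_bar] a single length N works for
    all points, and sampling f on the good words of length N gives the approximation. *)
Lemma C0_level_closure h (f : X -> C) : C0 R (pa_dom p h) f ->
  level_closure h f.
Proof.
move=> [fc f0] e e0.
have e2 : 0 < e / 2 by rewrite divr_gt0.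
have cyl_sub mu (ga : seq E) x : cylinder (mu ++ ga) x -> cylinder mu x.
  by move=> [z _ <-]; exists (prepend ga z) => //; rewrite prepend_cat.
pose Q mu := (forall x y, cylinder mu x -> cylinder mu y ->
  nrm (f x - f y) <= e) /\
  (good w h mu \/ forall x, cylinder mu x -> nrm (f x) <= e).
have [||N NP] := @koenig_bar E Q.
- move=> mu c [Q1 Q2]; rewrite -cats1; split=> [x y /cyl_sub mx /cyl_sub my|].
    exact: Q1.
  case: Q2 => [gd|sm]; first by left; exact: good_cat.
  by right=> x /cyl_sub; exact: sm.
- move=> x; have [n nx] : exists n, forall y, cylinder (mkseq x n) y ->
    nrm (f x - f y) <= e / 2.
    have e2' : 0 < ((e / 2)%:C%C : C) by rewrite real_complex_gt0.
    have /cvgrPdist_le/(_ _ e2')/nbhs_cylinder[n nx] := fc x.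
    by exists n => y /nx /=; rewrite nrmE lecR.
  have [[x' [al [be [z [hE _ xE]]]]]|nhx] := pselect (exists x',
    exchange w h x' x).
    (* The first [size al] letters make the prefix good; the summand n keeps f within e / 2 of its
       value at x. *)
    exists (size al + n)%N.
    have nx' y : cylinder (mkseq x (size al + n)) y -> nrm (f x - f y) <= e / 2.
      move=> /cylinderP; rewrite size_mkseq => yE; apply: nx; apply/cylinderP.
      by rewrite size_mkseq -(take_mkseq y (leq_addl (size al) n)) yE
        take_mkseq// leq_addl.
    split=> [y y' /nx' h1 /nx' h2|].
      apply: le_trans (nrm_triangle (f x) _ _) _.
      by rewrite (splitr e); apply: lerD => //; rewrite nrmB.
    by left; rewrite mkseqD xE mkseq_prepend; apply: good_cat => //; exists be.
  have fx : f x = 0 by apply: f0 => /p_dom.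
  exists n; split=> [y y' /nx h1 /nx h2|].
    apply: le_trans (nrm_triangle (f x) _ _) _.
    by rewrite (splitr e); apply: lerD => //; rewrite nrmB.
  right=> y /nx; rewrite fx sub0r nrmN => /le_trans; apply.
  by rewrite ler_pdivrMr// ler_peMr ?ltW// ltr1n.
pose G mu := if `[< good w h mu >] then f (prepend mu x0) else 0.
exists N, (fun x => G (mkseq x N)); split.
  by exists G; split=> // mu; rewrite /G; case: asboolP.
move=> x; have [Q1 Q2] := NP _ (size_mkseq x N).
have cx := cylinder_mkseq x N.
rewrite /G; case: asboolP => [gd|ngd].
  by apply: Q1 => //; exists x0.
by rewrite subr0; case: Q2 => // /(_ x cx).
Qed.

Lemma level_closure_sum h (I : Type) (s : seq I) (F : I -> X -> C) :
  (forall i, level_closure h (F i)) ->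
  level_closure h (fun x => \sum_(i <- s) F i x) /\
  op h (fun x => \sum_(i <- s) F i x) = \sum_(i <- s) op h (F i).
Proof.
move=> FL; elim: s => [|i s [ih1 ih2]].
  under eq_fun do rewrite big_nil.
  by rewrite big_nil (op0 w_cat w_inj fb); split=> //;
    exact: level_closure_level (level0 R w h 0).
have eqF : (fun x => \sum_(j <- i :: s) F j x) =
    (fun x => 1 * F i x + \sum_(j <- s) F j x).
  by apply/funext => x; rewrite big_cons mul1r.
rewrite eqF big_cons; split; first exact: (level_closure_lin w_cat).
by rewrite (op_lin w_cat w_inj fb)// scale1r ih2.
Qed.

Definition fs_op (a : H -> X -> C) : B := \sum_(h \in [set: H]) op h (a h).

Lemma fs_opE a (A : {fset H}) : (forall h, h \notin A -> a h = fun=> 0) ->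
  fs_op a = \sum_(h <- A) op h (a h).
Proof.
by move=> aA; apply: fsbigTE => h /aA ->; exact: (op0 w_cat w_inj fb).
Qed.

Lemma formal_sums_supp (a : H -> X -> C) : formal_sums p a ->
  exists A : {fset H}, forall h, h \notin A -> a h = fun=> 0.
Proof.
move=> [_ fin]; exists (fset_set [set h | a h <> (fun=> 0)]) => h.
by rewrite in_fset_set// notin_setE /= => /contrapT.
Qed.

Lemma formal_sums_level (a : H -> X -> C) h : formal_sums p a ->
  level_closure h (a h).
Proof. by move=> [aC _]; exact: C0_level_closure. Qed.

(** On monomials these are [op_lin], [op_conv] and [op_star]. For sums, the substitution h = g^-1 k
    turns the double sum over k and g into a product of two sums; the set [K] of products contains
    the support of the result. *)
Lemma fs_op_hom : formal_sums_hom p fs_op.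
Proof.
split.
- move=> c a a' fa fa'.
  have [A aA] := formal_sums_supp fa; have [A' aA'] := formal_sums_supp fa'.
  rewrite !(@fs_opE _ (A `|` A')%fset).
  + rewrite scaler_sumr -big_split; apply: eq_bigr => h _ /=.
    by apply: (op_lin w_cat w_inj fb); exact: formal_sums_level.
  + by move=> h; rewrite in_fsetU negb_or => /andP[_ /aA'].
  + by move=> h; rewrite in_fsetU negb_or => /andP[/aA].
  + move=> h; rewrite in_fsetU negb_or => /andP[/aA ha /aA' ha'].
    by apply/funext => x; rewrite /fs_add /fs_scale ha ha' mulr0 addr0.
- move=> a a' fa fa'.
  have [A aA] := formal_sums_supp fa; have [A' aA'] := formal_sums_supp fa'.
  have aL := formal_sums_level _ fa; have aL' := formal_sums_level _ fa'.
  pose K := [fset (g * h)%g | g in A, h in A']%fset.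
  pose F g k := conv p g (a g) (a' (g^-1 * k)%g).
  have FP g k : level_closure k (F g k) /\
      op k (F g k) = op g (a g) ** op (g^-1 * k)%g (a' (g^-1 * k)%g).
    have := op_conv w_cat w_inj p_dom p_map fb x0 (aL g) (aL' (g^-1 * k)%g).
    by rewrite mulVKg => -[h1 h2].
  have notK g k : g \in A -> k \notin K -> a' (g^-1 * k)%g = fun=> 0.
    move=> gA kK; apply: aA'; apply: contra kK => kA'.
    by apply/imfset2P; exists g => //; exists (g^-1 * k)%g => //;
      rewrite mulVKg.
  have mulE k : fs_mul p a a' k = fun x => \sum_(g <- A) F g k x.
    apply/funext => x; rewrite /fs_mul; apply: fsbigTE => g /aA ag.
    have := conv0l p_dom p_map g (a' (g^-1 * k)%g).
    by rewrite -/(conv p g (a g) (a' (g^-1 * k)%g) x) ag => ->.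
  rewrite (@fs_opE _ K); last first.
    move=> k kK; rewrite mulE; apply/funext => x;
      rewrite big_seq big1// => g gA.
    by rewrite /F (notK _ _ gA kK) (conv0r p_dom p_map).
  under eq_bigr => k _.
    rewrite mulE; have [_ ->] := level_closure_sum A (fun g => (FP g k).1).
    under eq_bigr do rewrite (FP _ _).2.
    over.
  rewrite exchange_big (fs_opE aA) cs_mul_suml; apply: eq_big_seq => g gA.
  rewrite -cs_mul_sumr; congr cs_mul.
  rewrite -(@fsbigTE _ _ _ _ K (fun k => op (g^-1 * k)%g (a' (g^-1 * k)%g)));
    last first.
    by move=> k kK; rewrite (notK _ _ gA kK) (op0 w_cat w_inj fb).
  rewrite /fs_op [RHS](@reindex_fsbigT _ _ _ _ _ (fun k => (g^-1 * k)%g))//.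
  by exists (fun k => (g * k)%g) => k; rewrite ?mulKg ?mulVKg.
- move=> a fa; have [A aA] := formal_sums_supp fa.
  have -> : cs_star (fs_op a) = \sum_(h \in [set: H]) cs_star (op h (a h)).
    rewrite (fs_opE aA) cs_star_sum; apply/esym/fsbigTE => h /aA ->.
    by rewrite (op0 w_cat w_inj fb) cs_star0.
  rewrite [RHS](@reindex_fsbigT _ _ _ _ _ (fun k : H => k^-1%g)); last first.
    by exists (fun k : H => k^-1%g); exact: invgK.
  apply: eq_fsbigr => h _.
  by have [_ ->] := op_star w_cat w_inj p_dom p_map fb x0 (formal_sums_level
    h^-1%g fa).
Qed.

End FormalSumsHom.

(** * Uniqueness of algebras with a universal property *)

Lemma star_hom_id (R : realType) (A : cstarType R) : star_hom (fun a : A => a).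
Proof. by split=> // x; exact: cvg_id. Qed.

Lemma star_hom_comp (R : realType) (A B D : cstarType R) (f : A ->
  B) (g : B -> D) :
  star_hom f -> star_hom g -> star_hom (fun a => g (f a)).
Proof.
move=> [f1 f2 f3 f4] [g1 g2 g3 g4]; split.
- by move=> c a b; rewrite f1 g1.
- by move=> a b; rewrite f2 g2.
- by move=> a; rewrite f3 g3.
- by move=> x; apply: continuous_comp; [exact: f4|exact: g4].
Qed.

Lemma cstar_isomorphic_trans (R : realType) (A B D : cstarType R) :
  cstar_isomorphic A B -> cstar_isomorphic B D -> cstar_isomorphic A D.
Proof.
move=> [f fh fb] [g gh gb]; exists (fun a => g (f a));
  first exact: star_hom_comp.
exact: bij_comp.
Qed.

Lemma crossed_product_unique (R : realType) (H : groupType) (X :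
  topologicalType)
    (p : partial_action_data H X) (A B : cstarType R) :
  is_partial_crossed_product p A -> is_partial_crossed_product p B ->
  cstar_isomorphic A B.
Proof.
move=> [i [ih iu]] [j [jh ju]].
have [f [[fh fi] _]] := iu B j jh; have [g [[gh gj] _]] := ju A i ih.
exists f => //; exists g => a.
  have [e [[_ _] eu]] := iu A i ih.
  have e1 : e = (fun a => g (f a)).
    by apply: eu; split=> [|c cf]; [exact: star_hom_comp|rewrite fi// gj].
  have e2 : e = (fun a => a) by apply: eu; split=> //; exact: star_hom_id.
  by rewrite e1 in e2; exact: (congr1 (fun k => k a) e2).
have [e [[_ _] eu]] := ju B j jh.
have e1 : e = (fun a => f (g a)).
  by apply: eu; split=> [|c cf]; [exact: star_hom_comp|rewrite gj// fi].
have e2 : e = (fun a => a) by apply: eu; split=> //; exact: star_hom_id.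
by rewrite e1 in e2; exact: (congr1 (fun k => k a) e2).
Qed.

Lemma cuntz_algebra_unique (R : realType) n (A B : cstarType R) :
  is_cuntz_algebra n A -> is_cuntz_algebra n B -> cstar_isomorphic A B.
Proof.
move=> [u [s [us iu]]] [v [t [vt ju]]].
have [f [[fh fu fs] _]] := iu B v t vt; have [g [[gh gv gt] _]] := ju A u s us.
exists f => //; exists g => a.
  have [e [[_ _ _] eu]] := iu A u s us.
  have e1 : e = (fun a => g (f a)).
    by apply: eu; split=> [||i]; [exact: star_hom_comp|rewrite fu gv|rewrite fs
      gt].
  have e2 : e = (fun a => a) by apply: eu; split=> //; exact: star_hom_id.
  by rewrite e1 in e2; exact: (congr1 (fun k => k a) e2).
have [e [[_ _ _] eu]] := ju B v t vt.
have e1 : e = (fun a => f (g a)).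
  by apply: eu; split=> [||i]; [exact: star_hom_comp|rewrite gv fu|rewrite gt
    fs].
have e2 : e = (fun a => a) by apply: eu; split=> //; exact: star_hom_id.
by rewrite e1 in e2; exact: (congr1 (fun k => k a) e2).
Qed.

Lemma cuntz_is_cuntz_algebra (R : realType) (E : finType) :
  is_cuntz_algebra #|E| (cuntz R E : cstarType R).
Proof.
exists (cuntz_gen R None), (fun i => cuntz_gen R (Some (enum_val i))).
have [_ _ _ gg gsum] := cuntz_gen_corner R E.
split; first split.
- exact: cuntz_unit.
- by move=> i; rewrite gg eqxx.
- rewrite -[RHS]gsum (reindex (@enum_val E predT))//=.
  by exists enum_rank => x _; rewrite ?enum_rankK ?enum_valK.
move=> B v t vt; have fb := cuntz_family_corner vt.
set b := (fun o : option E => _) in fb.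
exists (cev b); split.
  split; first exact: cev_star_hom.
    by rewrite cev_gen.
  by move=> i; rewrite cev_gen// /b enum_valK.
move=> g [gh gv gt]; apply: cuntz_hom_unique => //; first exact: cev_star_hom.
move=> [e|]; rewrite cev_gen// /b ?gv//.
by rewrite -gt enum_rankK.
Qed.

Lemma continuous_nrm (R : realType) (T : topologicalType) (f : T -> cplx R) :
  (forall x (r : R), 0 < r -> nbhs x [set y | nrm (f x - f y) <= r]) ->
    continuous f.
Proof.
move=> fP x; apply/cvgrPdist_le => _ /gt0_complexP[r e0 ->].
by apply: filterS (fP x r e0) => y; rewrite nrmE lecR.
Qed.

Section ContinuousFunctions.
Variables (R : realType) (T : topologicalType).
Local Notation C := (cplx R).
Implicit Types f g : T -> C.

Lemma continuousZD k f g : continuous f -> continuous g ->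
  continuous (fun x => k * f x + g x).
Proof.
by move=> fc gc x; apply: cvgD; [apply: cvgM; [exact: cvg_cst|exact: fc]|exact:
  gc].
Qed.

Lemma continuous_mul f g : continuous f -> continuous g ->
  continuous (fun x => f x * g x).
Proof. by move=> fc gc x; apply: cvgM; [exact: fc|exact: gc]. Qed.

Lemma continuous_conj f : continuous f -> continuous (fun x => (f x)^*).
Proof.
move=> fc x; apply/cvgrPdist_le => e e0; have /cvgrPdist_le/(_ _ e0) := fc x.
by apply: filterS => y; rewrite -rmorphB norm_conjC.
Qed.

End ContinuousFunctions.

(** * Representations of the formal sums *)

Section CrossedProduct.
Variables (R : realType) (E : finType) (H : groupType) (w : seq E -> H).
Hypotheses (w_cat : forall al be, w (al ++ be) = (w al * w be)%g)
  (w_inj : injective w).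
Local Notation C := (cplx R).
Local Notation X := (infinite_words E).
Variable p : partial_action_data H X.
Hypotheses (p_dom : forall h y, pa_dom p h y <-> exists x, exchange w h x y)
  (p_map : forall h x y, exchange w h x y -> pa_map p h x = y).
Local Notation cyl_fun := (@cyl_fun R E).
Local Notation "x ** y" := (cs_mul x y) (at level 40, left associativity).

Lemma cyl_fun_continuous al : continuous (cyl_fun al).
Proof.
apply: continuous_nrm => x r r0.
apply/nbhs_cylinder; exists (size al) => y /cylinderP; rewrite size_mkseq => yx.
by rewrite /= /cyl_fun yx subrr nrm0 ltW.
Qed.

Lemma p_dom_prepend al be z : pa_dom p (w al * (w be)^-1)%g (prepend al z).
Proof. by apply/p_dom; exists (prepend be z), al, be, z. Qed.

Lemma cyl_fun_C0 al be : C0 R (pa_dom p (w al * (w be)^-1)%g) (cyl_fun al).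
Proof.
split; first exact: cyl_fun_continuous.
move=> x nx; apply/eqP; apply: contraT => /cyl_fun_neq0[z xz].
by case: nx; rewrite xz; exact: p_dom_prepend.
Qed.

Lemma C0_lin (D : set X) k (f g : X -> C) : C0 R D f -> C0 R D g ->
  C0 R D (fun x => k * f x + g x).
Proof.
move=> [fc f0] [gc g0]; split=> [|x Dx]; first exact: (@continuousZD R X k f g
  fc gc).
by rewrite f0// g0// mulr0 addr0.
Qed.

Lemma C00 (D : set X) : C0 R D (fun=> 0).
Proof. by split=> //; exact: cst_continuous. Qed.

Lemma level_closure_C0 h f : level_closure w h f -> C0 R (pa_dom p h) f.
Proof.
move=> fL; split=> [|x nx].
  apply: continuous_nrm => x r r0.
  have [n [g [[G [gG _]] fg]]] := fL (r / 2) (divr_gt0 r0 (ltr0Sn _ 1)).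
  apply/nbhs_cylinder; exists n => y /cylinderP; rewrite size_mkseq => yx /=.
  apply: le_trans (nrm_triangle (g x) _ _) _.
  by rewrite (splitr r); apply: lerD => //; rewrite gG -yx -gG nrmB.
apply/nrm0_eq0/small_eq0 => [|e e0]; first exact: nrm_ge0.
have [n [g [[G [gG Gb]] fg]]] := fL e e0.
have := fg x; rewrite gG Gb ?subr0// => -[be hE]; case: nx.
by rewrite -(prepend_mkseq n x) hE; exact: p_dom_prepend.
Qed.

(** The monomial f delta_h. *)
Definition single (f : X -> C) (h : H) : H -> X -> C :=
  fun k => if k == h then f else fun=> 0.

Lemma single_formal_sums f h : C0 R (pa_dom p h) f ->
  formal_sums p (single f h).
Proof.
move=> fC; split=> [k|]; rewrite /single.
  by case: eqP => [->|_]; [|exact: C00].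
by apply: (sub_finite_set _ (finite_set1 h)) => k /=; case: eqP.
Qed.

Lemma single_lin k f g h : fs_add (fs_scale k (single f h)) (single g h) =
  single (fun x => k * f x + g x) h.
Proof.
apply/funext => l; apply/funext => x; rewrite /fs_add /fs_scale /single.
by case: eqP => // _; rewrite mulr0 addr0.
Qed.

Lemma single_mul f g f' h :
  fs_mul p (single f g) (single f' h) = single (conv p g f f') (g * h)%g.
Proof.
apply/funext => k; apply/funext => x; rewrite /fs_mul.
have -> : \sum_(l \in [set: H]) theta_tilde p l
    (fun y => theta_tilde p l^-1%g (single f g l) y * single f' h (l^-1 * k)%g
      y) x =
    conv p g f (single f' h (g^-1 * k)%g) x.
  rewrite (@fsbigTE _ _ _ _ [fset g]%fset) ?big_seq_fset1 /single ?eqxx// => l.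
  rewrite in_fset1 => /negPf ->.
  by rewrite -/(conv p l (fun=> 0) _ x) (conv0l p_dom p_map).
rewrite /single; have [->|kgh] := eqVneq k (g * h)%g;
  first by rewrite mulKg eqxx.
case: eqP => [e|_]; last by rewrite (conv0r p_dom p_map).
by move: kgh; rewrite -e mulVKg eqxx.
Qed.

Lemma single_star f h : fs_star p (single f h) =
  single (star_fun p h^-1%g f) h^-1%g.
Proof.
apply/funext => k; rewrite /fs_star /single.
have [->|kh] := eqVneq k h^-1%g; first by rewrite invgK eqxx.
case: eqP => [e|_]; last exact: star_fun0.
by rewrite -e invgK eqxx in kh.
Qed.

Section Representation.
Variable x0 : X.
Variables (B : cstarType R) (rho : (H -> X -> C) -> B).
Hypothesis rhoh : formal_sums_hom p rho.

Lemma rho_single_lin k f g h : C0 R (pa_dom p h) f -> C0 R (pa_dom p h) g ->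
  rho (single (fun x => k * f x + g x) h) = k *: rho (single f h) + rho (single
    g h).
Proof.
case: rhoh => rl _ _ fC gC; rewrite -single_lin rl//; exact: single_formal_sums.
Qed.

Lemma rho_single0 h : rho (single (fun=> 0) h) = 0.
Proof.
have := rho_single_lin 1 (C00 (pa_dom p h)) (C00 (pa_dom p h)).
rewrite (_ : (fun x : X => _) = (fun=> 0)); last by apply/funext => x;
  rewrite mulr0 addr0.
by rewrite scale1r -{1}[rho _]addr0 => /addrI/esym.
Qed.

(** The element that has to become s_al s_be^* ([rword_sword]). *)
Definition rword al be : B := rho (single (cyl_fun al) (w al * (w be)^-1)%g).

Lemma rword_mul al be nu de : rword al be ** rword nu de =
  if prefix be nu then rword (al ++ drop (size be) nu) de
  else if prefix nu be then rword al (de ++ drop (size nu) be) else 0.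
Proof.
case: rhoh => _ rM _; rewrite /rword -rM; try by apply: single_formal_sums;
  exact: cyl_fun_C0.
rewrite single_mul (conv_cyl_fun R p_dom p_map).
case: ifPn => [/prefixP[ga ->]|n1].
  by rewrite drop_size_cat// !w_cat !mulgA mulgVK.
case: ifPn => [/prefixP[ga ->]|n2].
  by rewrite drop_size_cat// !w_cat !invgM !mulgA mulgVK.
exact: rho_single0.
Qed.

Lemma rword_star al be : cs_star (rword al be) = rword be al.
Proof.
case: rhoh => _ _ rS; rewrite /rword -rS; last by apply: single_formal_sums;
  exact: cyl_fun_C0.
by rewrite single_star invgF (star_fun_cyl_fun R p_dom p_map).
Qed.

Definition rho_gen (o : option E) : B :=
  if o is Some e then rword [:: e] [::] else rword [::] [::].

Lemma rword_nil al : rword al al = rho (single (cyl_fun al) 1%g).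
Proof. by rewrite /rword mulgV. Qed.

Lemma rho_gen_corner : corner_family rho_gen.
Proof.
split.
- exact: rword_star.
- by case=> [e|]; rewrite rword_mul.
- by case=> [e|]; rewrite rword_mul.
- move=> e f; rewrite /= rword_star rword_mul /= !andbT.
  by have [_|ef] := eqVneq e f; rewrite // eq_sym (negPf ef).
(* The relation for the sum of the s_e s_e^* is the partition of the space into one-letter
   cylinders. [rho] is linear on admissible coefficients only, so membership in [C0] is proved along
   with additivity. *)
- have L : forall s : seq E, rho (single (fun x => \sum_(e <- s) cyl_fun [:: e]
    x) 1%g) =
      \sum_(e <- s) rword [:: e] [:: e] /\ C0 R (pa_dom p 1%g) (fun x =>
        \sum_(e <- s) cyl_fun [:: e] x).
    elim=> [|e s [ih1 ih2]].
      under eq_fun do rewrite big_nil.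
      by rewrite big_nil rho_single0; split=> //; exact: C00.
    have -> : (fun x => \sum_(i <- e :: s) cyl_fun [:: i] x) =
        (fun x => 1 * cyl_fun [:: e] x + \sum_(i <- s) cyl_fun [:: i] x).
      by apply/funext => x; rewrite big_cons mul1r.
    have eC : C0 R (pa_dom p 1%g) (cyl_fun [:: e]).
      by have := cyl_fun_C0 [:: e] [:: e]; rewrite mulgV.
    rewrite rho_single_lin// big_cons scale1r ih1 rword_nil; split=> //.
    exact: C0_lin.
  have [+ _] := L (index_enum E).
  have -> : (fun x => \sum_e cyl_fun [:: e] x) = cyl_fun [::].
    apply/funext => x; rewrite (bigD1 (x 0%N))//= big1 => [|e ne].
      by rewrite addr0 /cyl_fun /= !eqxx.
    by rewrite /cyl_fun /= eqseq_cons eqxx andbT eq_sym (negPf ne).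
  rewrite -rword_nil => h; transitivity (\sum_e rword [:: e] [:: e]);
    last exact: esym h.
  by apply: eq_bigr => e _ /=; rewrite rword_star rword_mul.
Qed.

Lemma rword_sword al be :
  sword rho_gen al ** cs_star (sword rho_gen be) = rword al be.
Proof.
have sE a : sword rho_gen a = rword a [::].
  by elim: a => //= e a ->; rewrite rword_mul prefix0s drop0.
by rewrite !sE rword_star rword_mul /= cats0.
Qed.

(** [rho] is only an algebraic *-homomorphism, so boundedness must be proved. If g is unimodular,
    then (g delta_1)^* (g delta_1) = 1 delta_1, whose image is a projection; so [rho] is contractive
    at g and [unimodular_bound] applies. *)
Lemma rho_continuous_bound f M : continuous f -> 0 < M ->
  (forall x, nrm (f x) <= M) ->
  nrm (rho (single f 1%g)) <= 2 * M.
Proof.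
move=> fc M0 fM; case: rhoh => _ rM rS.
have dom1 : pa_dom p 1%g = setT.
  by apply/seteqP; split=> // x _; apply/p_dom; exists x; exact: exchange1.
have map1 x : pa_map p 1%g x = x by apply: p_map; exact: exchange1.
have cC g : continuous g -> C0 R (pa_dom p 1%g) g.
  by move=> gc; split=> [//|x]; rewrite dom1 => /(_ I).
pose D : set (X -> C) := [set f | continuous f].
pose T (f : X -> C) := rho (single f 1%g).
refine (@unimodular_bound R X _ D T _ _ _ _ _ _ f M M0 fc fM).
- exact: cst_continuous.
- move=> k g gc; exact: (@continuous_mul R X (fun=> k) g (@cst_continuous _ _
    k) gc).
- move=> g g' gc gc' /=; have := @continuousZD R X 1 g g' gc gc'.
  by under eq_fun do rewrite mul1r.
- by move=> s N g gc; exact: (@unimodular_continuous R X g s N gc).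
- by move=> k g g' gc gc'; exact: (rho_single_lin k (cC g gc) (cC g' gc')).
- move=> g gc g1; rewrite /T -(expr_le1 (n := 2))// ?nrm_ge0// -nrmC -rS;
    last first.
    by apply: single_formal_sums; exact: cC.
  rewrite single_star invg1.
  have sC : C0 R (pa_dom p 1%g) (star_fun p 1%g g).
    apply: cC => x; rewrite /star_fun.
    have -> : theta_tilde p 1%g (fun x => (g x)^*) = (fun x => (g x)^*).
      by apply/funext => y; rewrite /theta_tilde dom1 invg1 map1;
        case: asboolP => // -[].
    exact: (continuous_conj gc).
  rewrite -rM; try (by apply: single_formal_sums => //; exact: cC).
  rewrite single_mul mulg1.
  have -> : conv p 1%g (star_fun p 1%g g) g = cyl_fun [::].
    apply/funext => x; rewrite (convE p_dom p_map) invg1 map1 dom1.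
    case: asboolP => [_|[]//].
    rewrite /star_fun /theta_tilde dom1 invg1 map1.
    case: asboolP => [_|[]//].
    by rewrite mulrC nrm_conj g1 expr1n /cyl_fun eqxx.
  rewrite -rword_nil; have [p1 p2 _ _ _] := rho_gen_corner.
  exact: nrm_projection p1 (p2 None).
Qed.

(** The C*-identity reduces to h = 1: the product of f delta_h with its adjoint is |f|^2 delta_1, so
    the square of the norm is at most 2 M^2, which is at most (2 M)^2. *)
Lemma rho_bound f h M : C0 R (pa_dom p h) f -> 0 < M ->
  (forall x, nrm (f x) <= M) ->
  nrm (rho (single f h)) <= 2 * M.
Proof.
move=> fC M0 fM; case: rhoh => _ rM rS.
have [fc f0] := fC; have ff := single_formal_sums fC.
have F : conv p h f (star_fun p h^-1%g f) = (fun x => f x * (f x)^*).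
  apply/funext => x; rewrite (convE p_dom p_map); case: asboolP => [hx|nhx];
    last first.
    by rewrite f0// mul0r.
  rewrite /star_fun /theta_tilde invgK (p_mapK p_dom p_map hx).
  case: asboolP => // -[]; apply/p_dom; exists x.
  by apply/(p_domV p_dom p_map); rewrite invgK.
have : nrm (rho (single f h)) ^+ 2 <= 2 * M ^+ 2.
  rewrite -nrm_star -nrmC cs_starK -rS// single_star.
  (* Continuity of the transported function is obtained by approximation: [op_star] places it in
     [level_closure], whose members are continuous and vanish off the domain. *)
  have sC : C0 R (pa_dom p h^-1%g) (star_fun p h^-1%g f).
    apply: level_closure_C0.
    have fL : level_closure w (h^-1)^-1%g f.
      by rewrite invgK; exact: (C0_level_closure w_cat p_dom x0).
    by have [] := op_star w_cat w_inj p_dom p_map rho_gen_corner x0 fL.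
  rewrite -(rM _ _ ff (single_formal_sums sC)).
  rewrite single_mul mulgV F; apply: rho_continuous_bound.
  - exact: (@continuous_mul R X f _ fc (continuous_conj fc)).
  - exact: exprn_gt0.
  - move=> x; rewrite nrm_conj nrm_real ger0_norm ?exprn_ge0 ?nrm_ge0//.
    by rewrite lerXn2r ?nnegrE ?nrm_ge0// ltW.
have M2 : 0 <= 2 * M by rewrite mulr_ge0// ltW.
move=> h2; rewrite -(ler_pXn2r (n := 2)) ?nnegrE ?nrm_ge0//.
by apply: le_trans h2 _; rewrite exprMn ler_pM2r ?exprn_gt0// expr2; lra.
Qed.

End Representation.

Lemma nrm_cev_sub (B : cstarType R) (b : option E -> B) (a a' : cuntz R E) :
  corner_family b -> nrm (cev b a - cev b a') <= nrm (a - a').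
Proof. by move=> fb; rewrite -cev_sub//; exact: cev_le. Qed.

Variable x0 : X.
Local Notation iota := (fs_op w (cuntz_gen R (E := E)) x0).
Local Notation iop := (op w (cuntz_gen R (E := E)) x0).

Lemma iota_single f h : iota (single f h) = iop h f.
Proof.
rewrite (fs_opE w_cat w_inj (cuntz_gen_corner R E) x0 (A := [fset h]%fset)).
  by rewrite big_seq_fset1 /single eqxx.
by move=> k; rewrite in_fset1 /single => /negPf ->.
Qed.

Lemma star_hom_sword (B : cstarType R) (b : option E -> B) (f : cuntz R E ->
  B) al :
  star_hom f -> (forall i, f (cuntz_gen R i) = b i) ->
  f (sword (cuntz_gen R (E := E)) al) = sword b al.
Proof.
by move=> fh fb; elim: al => [|e al ih]; rewrite /= ?fb// (star_homM fh) fb ih.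
Qed.

(** Both sides are linear in f and equal [rword] on cylinder indicators, by [rword_sword]. Both are
    also bounded by twice the supremum norm of f, so uniform approximation extends the equality to
    all admissible f. *)
Lemma cev_iop (B : cstarType R) (rho : (H -> X -> C) -> B) h f :
  formal_sums_hom p rho -> C0 R (pa_dom p h) f ->
  cev (rho_gen rho) (iop h f) = rho (single f h).
Proof.
move=> rhoh fC; have fb := rho_gen_corner rhoh.
have fh := cev_star_hom fb; have gb := cuntz_gen_corner R E.
pose P g := C0 R (pa_dom p h) g /\ cev (rho_gen rho) (iop h g) =
  rho (single g h).
have lev n g : level w h n g -> P g.
  apply: (level_ind w_cat (P := P)) => [|c al be k hE kL [kC kE]].
    split; first exact: C00.
    by rewrite (op0 w_cat w_inj gb) (star_hom0 fh) (rho_single0 rhoh).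
  have aC : C0 R (pa_dom p h) (cyl_fun al) by rewrite hE; exact: cyl_fun_C0.
  have aL : level_closure w h (cyl_fun al).
    by apply: level_closure_level; apply: level_cyl_fun; exists be.
  split; first exact: C0_lin.
  have e1 := op_lin w_cat w_inj gb x0 c aL kL.
  have e2 := star_homD fh (c *: iop h (cyl_fun al)) (iop h k).
  have e3 := star_homZ fh c (iop h (cyl_fun al)).
  have e4 := congr1 (cev (rho_gen rho)) e1.
  apply: (etrans e4); apply: (etrans e2); apply: (etrans (congr2 +%R e3 kE)).
  rewrite (rho_single_lin rhoh c aC kC); congr (_ *: _ + _).
  rewrite {1}hE (op_cyl_fun w_cat w_inj gb) (star_homM fh) (star_hom_star fh).
  rewrite !(star_hom_sword _ fh (cev_gen fb)) (rword_sword rhoh).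
  by rewrite /rword -hE.
have fL := C0_level_closure w_cat p_dom x0 fC.
apply/subr0_eq/nrm0_eq0/small_eq0 => [|e e0]; first exact: nrm_ge0.
have e4 : 0 < e / 4 by rewrite divr_gt0.
have [n [g [gn fg]]] := fL _ e4; have [gC gE] := lev n g gn.
apply: le_trans (nrm_triangle (cev (rho_gen rho) (iop h g)) _ _) _.
have h1 : nrm (iop h f - iop h g) <= 2 * (e / 4).
  by apply: (op_sub_le w_cat w_inj gb) => //; exact: level_closure_level gn.
have h2 : nrm (cev (rho_gen rho) (iop h g) - rho (single f h)) <= 2 * (e / 4).
  rewrite gE; have fgC := C0_lin (-1) gC fC.
  have -> : rho (single g h) - rho (single f h) =
      - rho (single (fun x => -1 * g x + f x) h).
    by rewrite (rho_single_lin rhoh)// scaleN1r opprD opprK.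
  rewrite nrmN; apply: (rho_bound x0 rhoh fgC e4) => x.
  by rewrite mulN1r addrC; exact: fg.
apply: le_trans (lerD (le_trans (nrm_cev_sub _ _ fb) h1) h2) _.
by rewrite le_eqVlt; apply/orP; left; apply/eqP; field.
Qed.

Lemma rho_sum_single (B : cstarType R) (rho : (H -> X -> C) ->
  B) a (s : seq H) :
  formal_sums_hom p rho -> formal_sums p a -> uniq s ->
  rho (fun k => if k \in s then a k else fun=> 0) =
  \sum_(h <- s) rho (single (a h) h).
Proof.
move=> rhoh [aC afin].
have sub s' : formal_sums p (fun k => if k \in s' then a k else fun=> 0).
  split=> [k|]; first by case: ifP => _; [exact: aC|exact: C00].
  by apply: sub_finite_set afin => k /=; case: ifP.
elim: s => [_|h s ih /= /andP[hs us]].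
  rewrite big_nil -(rho_single0 rhoh 1%g); congr rho.
  by apply/funext => k; rewrite /single in_nil; case: ifP.
rewrite big_cons -ih//; case: rhoh => rl _ _.
rewrite -[rho (single _ _)]scale1r -rl//; last exact: single_formal_sums.
congr rho; apply/funext => k; apply/funext => x.
rewrite /fs_add /fs_scale /single in_cons mul1r.
by have [->|_] := eqVneq k h; rewrite /= ?(negPf hs) ?addr0 ?add0r.
Qed.

(** Existence of the morphism is [cev_iop] summed over the support. It is unique because the
    generators are images of monomials: s_e comes from the indicator of the cylinder of e at w e,
    and u from the constant 1 at the neutral element. *)
Lemma cuntz_is_crossed_product :
  is_partial_crossed_product p (cuntz R E : cstarType R).
Proof.
have gb := cuntz_gen_corner R E.
have ih := fs_op_hom w_cat w_inj p_dom p_map gb x0.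
exists iota; split=> // B rho rhoh; have fb := rho_gen_corner rhoh.
have fh := cev_star_hom fb.
exists (cev (rho_gen rho)); split.
  split=> // a fa; have [A aA] := formal_sums_supp fa.
  rewrite (fs_opE w_cat w_inj gb x0 aA) (star_hom_sum fh).
  have {2}-> : a = (fun k => if k \in (A : seq H) then a k else fun=> 0).
    by apply/funext => k; case: ifPn => // /aA.
  rewrite rho_sum_single ?fset_uniq//; apply: eq_bigr => h _.
  by apply: cev_iop => //; case: fa.
move=> g [gh gi]; apply: cuntz_hom_unique => // i; rewrite cev_gen//.
have word al : sword (cuntz_gen R (E := E)) al **
    cs_star (sword (cuntz_gen R (E := E)) [::]) =
    iota (single (cyl_fun al) (w al * (w [::])^-1)%g).
  by rewrite iota_single (op_cyl_fun w_cat w_inj gb).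
have gw al : g (iota (single (cyl_fun al) (w al * (w [::])^-1)%g)) =
  rword rho al [::].
  by rewrite gi//; apply: single_formal_sums; exact: cyl_fun_C0.
have [g1 g2 g3 _ _] := gb.
case: i => [e|]; rewrite /= -gw -word /= g1 ?g3 ?g2//.
Qed.

End CrossedProduct.

(** * Generation of the universal group, and the conclusion *)

(** The ideal at phi(e) contains the indicator of the cylinder of e, which takes the value 1 at e
    x0. So K contains all phi(e), and these generate because phi is onto. *)
Lemma C0_nonzero_generates (R : realType) (G : groupType) (E : finType)
    (S : self_similar_group G E) (x0 : infinite_words E) : exhausting S ->
  generates [set g | C0 R (pa_dom (theta_universal S) g) <> [set fun=> 0]].
Proof.
move=> ex K [K1 KM KV] sK; apply/seteqP; split=> // h _.
have Kgen e : K (phi_universal S (free_gen e)).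
  apply: sK => /= C0e.
  have : C0 R (pa_dom (theta_universal S) (phi_universal S (free_gen e)))
    (cyl_fun R [:: e]).
    have := cyl_fun_C0 R (@theta_dom G E S) [:: e] [::].
    rewrite /word_image /free_word big_seq1 big_nil.
    by rewrite (phi1 S) invg1 mulg1.
  rewrite C0e => /(congr1 (fun f => f (prepend [:: e] x0))).
  by rewrite /= cyl_fun1 => /eqP; rewrite oner_eq0.
have [g <-] := phi_surj ex h.
rewrite /phi_universal /free_lift /eval_word.
elim: (repr g) => [|[e c] u ih]; first by rewrite big_nil.
rewrite big_cons; apply: KM => //=.
have := Kgen e; rewrite /phi_universal free_lift_gen => Ke.
by case: c => //; exact: KV.
Qed.

Theorem theorem5p5 (R : realType) (G : groupType) (E : finType)
    (S : self_similar_group G E)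
    (countG : countable [set: G])
    (E_gt0 : (0 < #|E|)%N)
    (S_pseudo_free : pseudo_free S)
    (S_exhausting : exhausting S) :
  [/\ inducible (quigg_raeburn E) (phi_universal S)
        /\ is_topological_partial_action (theta_universal S),
      (exists A : cstarType R, is_partial_crossed_product (theta_universal S) A)
        /\ (exists O : cstarType R, is_cuntz_algebra #|E| O),
      forall A O : cstarType R,
        is_partial_crossed_product (theta_universal S) A ->
        is_cuntz_algebra #|E| O ->
        cstar_isomorphic A O
    & generates
        [set g | C0 R (pa_dom (theta_universal S) g) <> [set fun=> 0]]].
Proof.
(* The infinite word x0 is the tail of the sample points in the Riemann sums, and it shows that
   cylinders are nonempty. *)
have [x0] : exists x0 : infinite_words E, True.
  by have /card_gt0P[e _] := E_gt0; exists (fun=> e).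
move=> _.
have cp : is_partial_crossed_product (theta_universal S)
    (cuntz R E : cstarType R).
  exact: (cuntz_is_crossed_product R (word_image_cat S)
    (word_image_inj countG S_pseudo_free) (@theta_dom G E S)
    (theta_map countG S_pseudo_free) x0).
have ca := cuntz_is_cuntz_algebra R E.
split; last exact: C0_nonzero_generates.
- by split; [exact: phi_inducible|exact: theta_topological].
- by split; [exists (cuntz R E : cstarType R)|exists (cuntz R E : cstarType R)].
- move=> A O Acp Oca; apply: cstar_isomorphic_trans (crossed_product_unique Acp
    cp) _.
  exact: cuntz_algebra_unique ca Oca.
Qed.
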